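(* Let $\alpha\in(0,1)$. Let $\psi$ be a function on $[0,T]\times\frac1N\mathbb T_N^n$ such that $\xi_e=\xi_e^N:=\nabla_e^N\psi$ ($|e|=1$, $e>0$) satisfies the system $$\partial_t\xi_e=-\nabla^N_e\Big\{\bar a\sum_{|e'|=1,e'>0}\nabla^{N,*}_{e'}\xi_{e'}\Big\}+\nabla^N_eg,$$ where the functions $\bar a=\bar a(t,\frac xN)$ and $g=g(t,\frac xN)$ (with $g$ continuous in $t$) satisfy (B.1) $c_-\le\bar a\le c_+$ with $0<c_-<c_+<\infty$; (B.2) $[\bar a]^{*,N}_\alpha\le\bar A<\infty$; and $\|\nabla^Ng\|_\infty<\infty$, $\|\xi^N_\cdot\|_\infty<\infty$. Then, with $C=C(n,c_\pm,T,\alpha)$ independent of $N$, $$|\tilde\xi^N_\cdot|^*_{1+\alpha}\le C\big[(\bar A+1)^{1+\frac1\alpha}\|\xi^N_\cdot\|_\infty+\|\nabla^Ng\|_\infty\big],$$ $$|\nabla^N\xi^N_\cdot|_0^{(1)}\le C\big[(\bar A+1)^{\frac1\alpha}\|\xi^N_\cdot\|_\infty+(\bar A+1)^{-1}\|\nabla^Ng\|_\infty\big].$$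
   Context: Lattice notation. $N\in\mathbb N$, $T>0$ fixed, $\mathbb T^n=\mathbb R^n/\mathbb Z^n$, $\mathbb T_N^n=(\mathbb Z/N\mathbb Z)^n$; functions on $\frac1N\mathbb T^n_N\subset\mathbb T^n$ are written $u(\frac xN)$. For $e\in\mathbb Z^n$, $|e|=1$: $\nabla_e^Nu(\frac xN)=N(u(\frac{x+e}N)-u(\frac xN))$, $\nabla_e^{N,*}=\nabla^N_{-e}$. ''$e>0$'' means that the nonzero component of $e$ is $1$. Norms. $\Omega=[0,T]\times\mathbb T^n$, $\Omega_N=[0,T]\times\frac1N\mathbb T_N^n$. For $X=(t,z)$, $Y=(s,y)$: $|X-Y|=\max\{|t-s|^{1/2},|z-y|\}$ with $|z-y|$ the Euclidean distance on the torus, and $d(X)=\sqrt t$. For $F$ on $\Omega$, $\nabla^N_eF(t,z)=N(F(t,z+\frac eN)-F(t,z))$, and $|\nabla^NF(X)-\nabla^NF(Y)|=\max_{|e|=1,e>0}|\nabla^N_eF(X)-\nabla_e^NF(Y)|$. The polylinear interpolation in space of a function $u$ on $\Omega_N$ is $\tilde u(t,z)=\sum_{v\in\{0,1\}^n}\prod_{i=1}^n\vartheta(v_i,z_i)\,u(t,\frac{[Nz]+v}N)$, where $\vartheta(1,b)=\{Nb\}$, $\vartheta(0,b)=1-\{Nb\}$ and $[\cdot],\{\cdot\}$ are (componentwise) integer and fractional parts. $[\bar a]^{*,N}_\alpha=\sup_{X\neq Y\in\Omega_N}(d(X)\wedge d(Y))^\alpha\frac{|\bar a(X)-\bar a(Y)|}{|X-Y|^\alpha}$;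 $\|\nabla^Ng\|_\infty=\max_{|e|=1}\sup_{\Omega_N}|\nabla^N_eg|$; $\|\xi^N_\cdot\|_\infty=\max_e\sup_{\Omega_N}|\xi^N_e|$. $[F]^*_{1+\alpha}=\sup_{X\ne Y\in\Omega}(d(X)\wedge d(Y))^{1+\alpha}\frac{|\nabla^NF(X)-\nabla^NF(Y)|}{|X-Y|^\alpha}$; $\langle F\rangle^{*,N}_{1+\alpha}=\sup(d(X)\wedge d(Y))^{1+\alpha}\frac{|F(X)-F(Y)|}{|t-s|^{(1+\alpha)/2}}$ over $X=(t,\frac xN)\ne Y=(s,\frac xN)$ in $\Omega_N$ with the same spatial coordinate. With maxima over unit vectors $e,e_1,e_2>0$: $|\nabla^N\xi^N_\cdot|_0^{(1)}=\max_{e_1,e_2}\sup_{X\in\Omega_N}d(X)|\nabla^N_{e_1}\xi^N_{e_2}(X)|$ (equal to the same supremum over $\Omega$ for $\tilde\xi^N$), and $|\tilde\xi^N_\cdot|^*_{1+\alpha}=|\nabla^N\xi^N_\cdot|^{(1)}_0+\max_e[\tilde\xi^N_e]^*_{1+\alpha}+\max_e\langle\xi^N_e\rangle^{*,N}_{1+\alpha}$. *)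

(* Defs.v *)
From HB Require Import structures.
From mathcomp Require Import all_boot all_order all_algebra.
From mathcomp Require Import all_classical all_reals all_analysis.
Import Order.TTheory GRing.Theory Num.Theory.
Import numFieldNormedType.Exports.

Set Implicit Arguments.
Unset Strict Implicit.
Unset Printing Implicit Defensive.

Local Open Scope classical_set_scope.
Local Open Scope ring_scope.

(* A point of R^n/Z^n is given by any representative in 'rV[R]_n; functions   *)
(* on the torus are Z^n-periodic functions of the representative.  A function *)
(* on [0,T] x (1/N)T_N^n is a function on R * 'rV[R]_n of which only the      *)
(* values at the points of [OmegaN T N] matter; everything below evaluates    *)
(* such functions at these points only.                                       *)

Section Geometry.
Variables (R : realType) (n : nat).
Implicit Types (z y e : 'rV[R]_n) (X Y : R * 'rV[R]_n).

Definition intvec (k : 'rV[int]_n) : 'rV[R]_n := map_mx intr k.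

Definition unitvec (i : 'I_n) : 'rV[R]_n := delta_mx ord0 i.

Definition torus_eq z y : Prop := exists k : 'rV[int]_n, z = y + intvec k.

Definition enorm z : R := Num.sqrt (\sum_(i < n) z ord0 i ^+ 2).

Definition torus_dist z y : R :=
  inf [set enorm (z - y + intvec k) | k in [set: 'rV[int]_n]].

Definition Omega (T : R) : set (R * 'rV[R]_n) :=
  [set X | 0 <= X.1 <= T].

Definition OmegaN (T : R) (N : nat) : set (R * 'rV[R]_n) :=
  [set X | 0 <= X.1 <= T /\
           exists x : 'rV[int]_n, X.2 = N%:R^-1 *: intvec x].

Definition same_point X Y : Prop := X.1 = Y.1 /\ torus_eq X.2 Y.2.

Definition pdist X Y : R :=
  Num.max (Num.sqrt `|X.1 - Y.1|) (torus_dist X.2 Y.2).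

Definition dist0 X : R := Num.sqrt X.1.

End Geometry.

Section Functions.
Variables (R : realType) (n : nat) (T : R) (N : nat).
Implicit Types (u F : R * 'rV[R]_n -> R) (e : 'rV[R]_n) (X Y : R * 'rV[R]_n).

Definition lattice_function u : Prop :=
  forall X (k : 'rV[int]_n), OmegaN T N X ->
    u (X.1, X.2 + intvec R k) = u X.

Definition nabla e F X : R :=
  N%:R * (F (X.1, X.2 + N%:R^-1 *: e) - F X).

Definition nabla_star e F X : R := nabla (- e) F X.

Definition grad_diff F X Y : R :=
  \big[Num.max/0]_(i < n)
    `|nabla (unitvec R i) F X - nabla (unitvec R i) F Y|.

Definition frac (b : R) : R := b - (Num.floor b)%:~R.

Definition vartheta (v : bool) (b : R) : R :=
  if v then frac (N%:R * b) else 1 - frac (N%:R * b).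

Definition interp u X : R :=
  \sum_(v : {ffun 'I_n -> bool})
    (\prod_(i < n) vartheta (v i) (X.2 ord0 i)) *
    u (X.1, N%:R^-1 *:
         \row_(i < n) ((Num.floor (N%:R * X.2 ord0 i))%:~R + (v i)%:R)).

End Functions.

Section Norms.
Variables (R : realType) (n : nat) (T : R) (N : nat) (alpha : R).
Implicit Types (a g F : R * 'rV[R]_n -> R) (xi : 'I_n -> R * 'rV[R]_n -> R).
Local Open Scope ereal_scope.

(* All the suprema below are suprema of nonnegative quantities, so that 0 is  *)
(* a neutral base for the maxima over directions.                             *)

Definition sup_lattice F : \bar R :=
  ereal_sup [set (`|F X|%R)%:E | X in OmegaN T N].

Definition holder_a a : \bar R :=
  ereal_sup [set r | exists X Y : R * 'rV[R]_n,
    [/\ OmegaN T N X, OmegaN T N Y, ~ same_point X Y &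
     r = ((Num.min (dist0 X) (dist0 Y) `^ alpha * `|a X - a Y|
           / pdist X Y `^ alpha)%R)%:E]].

Definition norm_grad g : \bar R :=
  \big[maxe/0]_(i < n)
    maxe (sup_lattice (nabla N (unitvec R i) g))
         (sup_lattice (nabla N (- unitvec R i)%R g)).

Definition norm_xi xi : \bar R := \big[maxe/0]_(i < n) sup_lattice (xi i).

Definition holder_1alpha F : \bar R :=
  ereal_sup [set r | exists X Y : R * 'rV[R]_n,
    [/\ Omega T X, Omega T Y, ~ same_point X Y &
     r = ((Num.min (dist0 X) (dist0 Y) `^ (1 + alpha) * grad_diff N F X Y
           / pdist X Y `^ alpha)%R)%:E]].

Definition holder_time F : \bar R :=
  ereal_sup [set r | exists (t s : R) (z : 'rV[R]_n),
    [/\ OmegaN T N (t, z), OmegaN T N (s, z), t <> s &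
     r = ((Num.min (dist0 (t, z)) (dist0 (s, z)) `^ (1 + alpha)
           * `|F (t, z) - F (s, z)|
           / `|t - s| `^ ((1 + alpha) / 2))%R)%:E]].

Definition weighted_grad xi : \bar R :=
  \big[maxe/0]_(i < n) \big[maxe/0]_(j < n)
    ereal_sup [set ((dist0 X * `|nabla N (unitvec R i) (xi j) X|)%R)%:E
              | X in OmegaN T N].

(* The interpolation of the lattice functions [xi i] is part of the           *)
(* definition.                                                                *)
Definition full_norm xi : \bar R :=
  weighted_grad xi
  + \big[maxe/0]_(i < n) holder_1alpha (interp N (xi i))
  + \big[maxe/0]_(i < n) holder_time (xi i).

End Norms.

Section Equation.
Variables (R : realType) (n : nat) (T : R) (N : nat).
Variables (a g : R * 'rV[R]_n -> R) (xi : 'I_n -> R * 'rV[R]_n -> R).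

(* Classical solutions.  No regularity is imposed at t = 0, where [a] may     *)
(* fail to be continuous, and at t = T only continuity is required.           *)
Definition solves_system : Prop :=
  forall (i : 'I_n) (z : 'rV[R]_n), OmegaN T N (0, z) ->
    {within [set` `]0, T]], continuous (fun t : R => xi i (t, z))} /\
    forall t : R, 0 < t < T ->
      is_derive t 1 (fun s : R => xi i (s, z))
        (- nabla N (unitvec R i)
             (fun X => a X *
                \sum_(j < n) nabla_star N (unitvec R j) (xi j) X) (t, z)
         + nabla N (unitvec R i) g (t, z)).

End Equation.

(* Main.v *)
Require Import Defs.
From HB Require Import structures.
From mathcomp Require Import all_boot all_order all_algebra.
From mathcomp Require Import all_classical all_reals all_analysis.
From mathcomp Require Import ring lra.
Import Order.TTheory GRing.Theory Num.Theory.
Import numFieldNormedType.Exports.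
Set Implicit Arguments.
Unset Strict Implicit.
Unset Printing Implicit Defensive.
Local Open Scope classical_set_scope.
Local Open Scope ring_scope.

(* Since [xi = nabla psi] and [a] is scalar, the system says that
   [d_t psi = a Lap psi + g] up to a function of time.  Freeze [a] at a point [X0] of
   [Omega_N].  Each [xi_j] then solves a heat equation with constant coefficient
   [b = a(X0)] and right-hand side [nabla_j f], [f = (a - b) div xi + g - g(., x0)],
   where [|f(X)| <= M |X - X0|^alpha] with
   [M = C (Abar |nabla xi|^(1) + |nabla g|) t^(-(1 + alpha) / 2)].

   Let [P_r] be the heat flow.  The gradient bound [r |nabla P_r f|^2 <= P_r (f^2)]
   (interpolate along [P_(r-s) ((P_s f)^2)]) and [P_r (dist^2) <= dist^2 + 2 n r], iterated
   by the semigroup property, bound [k] differences of [P_r f] at points near [X0] by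
   [C M r^((alpha - k) / 2)].  Along [s |-> nabla^k P_(b (t - s)) xi_j(s)] this is a bound
   for the derivative; it is integrable at [s = t] for few differences and at the far end
   for many, which gives the Hoelder bounds of [xi] and [nabla xi] by
   [Z = C ((Abar + 1) |nabla xi|^(1) + |xi| + |nabla g|)].  Flows frozen at different
   points but started from the same datum differ only by their heat times, so no
   comparison of different equations is needed.

   Finally [|nabla xi|^(1) <= eps Z + C eps^(-1/alpha) |xi|] with [eps] of order
   [1 / (Abar + 1)] absorbs the gradient. *)

(** * The heat flow on a finite abelian group *)

(** After rescaling to mesh one, [N] survives only as the size of the torus, and no heat-flow
    constant sees it: these constants come from positivity, mass one and [lap (dist^2) <= 2 n],
    without kernel estimates or integrals. A bound [f^2 <= lam + mu dist^2] is all that is carried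
    along the flow, which keeps its form and only enlarges [lam]; a Hoelder bound enters this class
    by concavity. Mesh one also removes the singularity at heat time zero, so powers of [1 + r]
    replace powers of [r]. Every flow starts at a positive time, [t / 2] or later, because the
    weights give no control at time zero. The seminorm of [a] is invariant under the rescaling; only
    [g], which is Lipschitz and not weighted Hoelder, brings in [T]. The absorption is not circular:
    on the mesh-one lattice the gradient supremum is at most [2 |xi|] times the root of the rescaled
    final time. This depends on [N], but serves only to know that the supremum is finite. *)

Lemma is_derive_affine (R : realType) (F : R -> R) (c b s d : R) :
  is_derive (c + b * s) 1 F d ->
  is_derive s 1 (fun r => F (c + b * r)) (d * b).
Proof.
move=> dF; have H : is_derive s 1 (fun r => c + b * r) b.
  have H1 := is_deriveD (is_derive_cst c s 1) (is_deriveZ b (is_derive_id s 1)).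
  by apply: (is_derive_eq H1); rewrite add0r -[LHS]/(b * 1) mulr1.
exact: (@is_derive1_comp _ F (fun r => c + b * r)).
Qed.

Section Heat.
Variables (R : realType) (L : finZmodType) (n : nat) (e : 'I_n -> L).
Implicit Types (f g : L -> R) (x y v : L) (t r s : R).

Definition nbsum f x := \sum_i (f (x + e i) + f (x - e i)).

Definition lap f x := nbsum f x - (2 * n)%:R * f x.

Definition diff v f x := f (x + v) - f x.

Definition heat_coef f x k := iter k nbsum f x / k`!%:R.

(* [e^(t lap)], written as [e^(-2nt) e^(t nbsum)] so that positivity for [0 <= t]
   is visible on the power series. *)
Definition heat t f x :=
  expR (- (2 * n)%:R * t) * limn (pseries (heat_coef f x) t).

Lemma nbsum_bound f (B : R) : (forall x, `|f x| <= B) ->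
  forall x, `|nbsum f x| <= (2 * n)%:R * B.
Proof.
move=> fB x; apply: (le_trans (ler_norm_sum _ _ _)).
apply: (@le_trans _ _ (\sum_(i < n) (B + B))).
  by apply: ler_sum => i _; apply: (le_trans (ler_normD _ _)); exact: lerD.
by rewrite sumr_const card_ord -mulr2n -mulrnA mulr_natl.
Qed.

Lemma iter_nbsum_bound f (B : R) : (forall x, `|f x| <= B) ->
  forall k x, `|iter k nbsum f x| <= (2 * n)%:R ^+ k * B.
Proof.
move=> fB; elim=> [|k IH] x; first by rewrite expr0 mul1r.
by rewrite iterS exprS -mulrA; exact: nbsum_bound.
Qed.

Lemma finfun_bounded f : exists B : R, forall x, `|f x| <= B.
Proof.
exists (\sum_y `|f y|) => x.
by rewrite (bigD1 x)//= lerDl; apply: sumr_ge0.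
Qed.

Lemma cvg_heat_coef f x t : cvgn (pseries (heat_coef f x) t).
Proof.
have [B fB] := finfun_bounded f.
apply: normed_cvg.
apply: (@series_le_cvg _ _ (fun k => B * exp_coeff ((2 * n)%:R * `|t|) k)).
- by move=> k; exact: normr_ge0.
- by move=> k; rewrite mulr_ge0 ?exp_coeff_ge0 ?mulr_ge0// (le_trans _ (fB x)).
- move=> k; rewrite /heat_coef /exp_coeff/= !normrM normrX normfV normr_nat.
  rewrite exprMn (_ : B * _ = (2 * n)%:R ^+ k * B / k`!%:R * `|t| ^+ k).
    by rewrite !ler_wpM2r ?exprn_ge0 ?invr_ge0 ?ler0n ?iter_nbsum_bound.
  by field; rewrite pnatr_eq0 -lt0n fact_gt0.
- rewrite (_ : (fun _ => _) = B *: exp_coeff ((2 * n)%:R * `|t|))//.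
  exact/is_cvg_seriesZ/is_cvg_series_exp_coeff.
Qed.

Arguments cvg_heat_coef : clear implicits.

Lemma nbsumDZ f g (c : R) :
  nbsum (fun y => f y + c * g y) = (fun y => nbsum f y + c * nbsum g y).
Proof.
apply/funext => y; rewrite /nbsum mulr_sumr -big_split/=.
by apply: eq_bigr => i _; rewrite mulrDr addrACA.
Qed.

Lemma iter_nbsumDZ k f g (c : R) :
  iter k nbsum (fun y => f y + c * g y) =
  (fun y => iter k nbsum f y + c * iter k nbsum g y).
Proof. by elim: k => //= k ->; rewrite nbsumDZ. Qed.

Lemma heatDZ t f g (c : R) x :
  heat t (fun y => f y + c * g y) x = heat t f x + c * heat t g x.
Proof.
rewrite /heat mulrCA -mulrDr; congr (_ * _).
have cf := cvg_heat_coef f x t; have cg := cvg_heat_coef g x t.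
rewrite (_ : pseries _ t =
   pseries (heat_coef f x) t + c *: pseries (heat_coef g x) t).
  rewrite limD//; last exact: is_cvgZl_tmp.
  by rewrite limZl_tmp.
apply/funext => m; rewrite /pseries /series/= !fctE /= scaler_sumr -big_split/=.
apply: eq_bigr => k _; rewrite /heat_coef iter_nbsumDZ /= /GRing.scale/=; ring.
Qed.

Lemma heat_const t (c : R) x : heat t (fun=> c) x = c.
Proof.
rewrite /heat (_ : limn _ = c * expR ((2 * n)%:R * t)).
  by rewrite mulrCA -expRD mulNr addNr expR0 mulr1.
have iE k y : iter k nbsum (fun=> c) y = (2 * n)%:R ^+ k * c.
  elim: k y => [|k IH] y; first by rewrite mul1r.
  rewrite iterS /nbsum; under eq_bigr do rewrite !IH.
  by rewrite sumr_const card_ord -mulr2n -mulrnA exprS -mulrA mulr_natl.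
rewrite /expR -[RHS]/(c *: _) -lim_seriesZ; last exact: is_cvg_series_exp_coeff.
congr (limn (series _)); apply/funext => k.
by rewrite /heat_coef /= iE -[RHS]/(c * (_ / _)) exprMn; ring.
Qed.

Lemma heat0 f x : heat 0 f x = f x.
Proof.
rewrite /heat mulr0 expR0 mul1r; apply: lim_near_cst => //.
near=> m; rewrite -[m]prednK; last by near: m.
rewrite /pseries /series/= big_nat_recl//= big1 ?addr0.
  by rewrite /heat_coef/= divr1 expr0 mulr1.
by move=> i _; rewrite expr0n mulr0.
Unshelve. all: by end_near. Qed.

Lemma heat_sum t (I : finType) (F : I -> L -> R) (c : I -> R) x :
  heat t (fun y => \sum_i c i * F i y) x = \sum_i c i * heat t (F i) x.
Proof.
suff H (s : seq I) : heat t (fun y => \sum_(i <- s) c i * F i y) x =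
    \sum_(i <- s) c i * heat t (F i) x by exact: H.
elim: s => [|i s IH].
  by rewrite big_nil; under eq_fun do rewrite big_nil; rewrite heat_const.
rewrite big_cons -IH addrC -heatDZ.
by under eq_fun do rewrite big_cons addrC.
Qed.

Definition point_mass y : L -> R := fun z => (z == y)%:R.

(** On finitely many sites the flow is a finite sum of fixed functions of time, so a time-dependent
    datum can be differentiated, or shown continuous, term by term. *)
Lemma heat_kernel t f x : heat t f x = \sum_y f y * heat t (point_mass y) x.
Proof.
rewrite -heat_sum; congr (heat t _ x); apply/funext => z.
rewrite (bigD1 z)//= /point_mass eqxx mulr1 big1 ?addr0// => y.
by rewrite eq_sym => /negbTE ->; rewrite mulr0.
Qed.

Lemma heat_ge0 t f x : 0 <= t -> (forall y, 0 <= f y) -> 0 <= heat t f x.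
Proof.
move=> t0 f0; rewrite /heat mulr_ge0 ?expR_ge0//.
have q0 k y : 0 <= iter k nbsum f y.
  elim: k y => //= k IH y; apply: sumr_ge0 => i _.
  by rewrite addr_ge0.
apply: limr_ge; first exact: cvg_heat_coef.
near=> m; apply: sumr_ge0 => k _.
by rewrite mulr_ge0 ?exprn_ge0// /heat_coef divr_ge0.
Unshelve. all: by end_near. Qed.

Lemma heat_le t f g x : 0 <= t -> (forall y, f y <= g y) ->
  heat t f x <= heat t g x.
Proof.
move=> t0 fg; rewrite -subr_ge0.
rewrite (_ : _ - _ = heat t (fun y => g y + (-1) * f y) x).
  by apply: heat_ge0 => // y; rewrite mulN1r subr_ge0.
by rewrite heatDZ mulN1r.
Qed.

Lemma heat_translate t f v x : heat t (fun y => f (y + v)) x = heat t f (x + v).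
Proof.
rewrite /heat; congr (_ * limn (pseries _ _)); apply/funext => k.
rewrite /heat_coef; congr (_ / _).
elim: k x => //= k IH x; rewrite /nbsum; apply: eq_bigr => i _.
by rewrite !IH ![_ + v]addrAC.
Qed.

Lemma heat_diff t f v x : heat t (diff v f) x = diff v (heat t f) x.
Proof.
rewrite (_ : diff v f = (fun y => f (y + v) + (-1) * f y)).
  by rewrite heatDZ heat_translate mulN1r.
by apply/funext => y; rewrite mulN1r.
Qed.

Lemma lapE f x : lap f x = \sum_i (f (x + e i) + f (x - e i) - 2 * f x).
Proof.
rewrite big_split/= sumr_const card_ord /lap; congr (_ + _).
by rewrite mulNrn -mulr_natl natrM; congr (- _); ring.
Qed.

Lemma heat_lap t f x : heat t (lap f) x = lap (heat t f) x.
Proof.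
rewrite lapE.
rewrite (_ : lap f = (fun y =>
  (\sum_i 1 * (f (y + e i) + 1 * f (y - e i))) + (- (2 * n)%:R) * f y)).
  rewrite heatDZ heat_sum; under eq_bigr do
    rewrite mul1r heatDZ !heat_translate mul1r.
  by rewrite mulNr -[LHS]/(lap _ _) lapE.
apply/funext => y; rewrite /lap mulNr; congr (_ - _).
by apply: eq_bigr => i _; rewrite !mul1r.
Qed.

Lemma is_derive_heat f x t :
  is_derive t 1 (fun s => heat s f x) (heat t (lap f) x).
Proof.
(* Differentiating the exponential series of [nbsum] shifts its coefficients to those of [nbsum g];
   the prefactor then supplies the diagonal term of [lap]. *)
have dc g : pseries_diffs (heat_coef g x) = heat_coef (nbsum g) x.
  apply/funext => k; rewrite /pseries_diffs /heat_coef -iterSr factS natrM.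
  by rewrite invfM mulrCA mulVKf ?pnatr_eq0.
have d1 : is_derive t 1 (fun s => limn (pseries (heat_coef f x) s))
    (limn (pseries (heat_coef (nbsum f) x) t)).
  rewrite -dc; apply: (@pseries_snd_diffs _ _ (`|t| + 1)).
  - exact: cvg_heat_coef.
  - rewrite dc; exact: cvg_heat_coef.
  - rewrite !dc; exact: cvg_heat_coef.
  - by rewrite [ltRHS]ger0_norm ?addr_ge0// ltrDl.
have d2 : is_derive t 1 (fun s => expR (- (2 * n)%:R * s))
   (- (2 * n)%:R * expR (- (2 * n)%:R * t)).
  have := @is_derive_affine _ expR 0 (- (2 * n)%:R) t _ (is_derive_expR _).
  by rewrite add0r mulrC; under [X in is_derive _ _ X _]eq_fun do rewrite add0r.
apply: (is_derive_eq (is_deriveM d2 d1)).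
rewrite (_ : lap f = (fun y => nbsum f y + (- (2 * n)%:R) * f y)); last first.
  by apply/funext => y; rewrite mulNr.
rewrite heatDZ /heat /GRing.scale/=; ring.
Qed.

End Heat.

(** * Increments compared through derivatives *)

Section Calculus.
Variable R : realType.

(** Stands in for integrating an inequality between derivatives. It asks only for derivatives inside
    the interval and continuity up to its ends, which is the regularity that [solves_system]
    grants. *)
Lemma ler_increment (G H dG dH : R -> R) (a b : R) : a <= b ->
  (forall s, a < s < b -> is_derive s 1 G (dG s)) ->
  (forall s, a < s < b -> is_derive s 1 H (dH s)) ->
  {within `[a, b], continuous G} -> {within `[a, b], continuous H} ->
  (forall s, a < s < b -> dG s <= dH s) ->
  G b - G a <= H b - H a.
Proof.
move=> ab DG DH cG cH le_dG; case: ltgtP ab => // [ab _|-> _]; last first.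
  by rewrite !subrr.
have [c] := @MVT R (H - G) (fun s => dH s - dG s) a b ab
  (fun s sab => is_deriveB (DH s sab) (DG s sab))
  (fun s => continuousB (cH s) (cG s)).
rewrite in_itv/= => cab; rewrite !fctE => E.
have : 0 <= (dH c - dG c) * (b - a).
  by rewrite mulr_ge0 ?subr_ge0 ?le_dG// ltW.
by rewrite -E; lra.
Qed.

Lemma ler_abs_increment (G H dG dH : R -> R) (a b : R) : a <= b ->
  (forall s, a < s < b -> is_derive s 1 G (dG s)) ->
  (forall s, a < s < b -> is_derive s 1 H (dH s)) ->
  {within `[a, b], continuous G} -> {within `[a, b], continuous H} ->
  (forall s, a < s < b -> `|dG s| <= dH s) ->
  `|G b - G a| <= H b - H a.
Proof.
move=> ab DG DH cG cH le_dG; rewrite ler_norml; apply/andP; split.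
  have := @ler_increment (fun s => - G s) H (fun s => - dG s) dH a b ab.
  rewrite opprK => K; rewrite lerNl opprB addrC; apply: K => //.
  - by move=> s sab; exact/is_deriveN/DG.
  - by move=> s; exact/continuousN/cG.
  - by move=> s /le_dG; rewrite ler_norml => /andP[]; lra.
by apply: ler_increment ab DG DH cG cH _ => s /le_dG; rewrite ler_norml => /andP[].
Qed.

Lemma is_derive_bigsum (I : Type) (r : seq I) (F : I -> R -> R) (dF : I -> R)
    (s : R) : (forall i, is_derive s 1 (F i) (dF i)) ->
  is_derive s 1 (fun t => \sum_(i <- r) F i t) (\sum_(i <- r) dF i).
Proof.
move=> DF; elim: r => [|i r IH].
  rewrite big_nil; under [X in is_derive _ _ X _]eq_fun do rewrite big_nil.
  exact: is_derive_cst.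
rewrite big_cons; under [X in is_derive _ _ X _]eq_fun do rewrite big_cons.
exact: is_deriveD (DF i) IH.
Qed.

Lemma is_derive_continuous (F : R -> R) (s d : R) :
  is_derive s 1 F d -> {for s, continuous F}.
Proof.
by move=> DF; apply/differentiable_continuous/derivable1_diffP/ex_derive.
Qed.

End Calculus.

(** * Semigroup law, Jensen's inequality and gradient bound *)

Section Semigroup.
Variables (R : realType) (L : finZmodType) (n : nat) (e : 'I_n -> L).
Implicit Types (f g : L -> R) (x y v : L) (t r s b : R) (u : R -> L -> R).

Notation heat := (heat e).
Notation lap := (lap e).

(** For negative [b] this is the flow applied to the residual of [u] in the heat equation with
    coefficient [- b]. The semigroup law, the gradient bound and Duhamel's formula are all read off
    from it. *)
Lemma is_derive_heat_flow u (du : L -> R) (c b s : R) x :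
  (forall y, is_derive s 1 (fun r => u r y) (du y)) ->
  is_derive s 1 (fun r => heat (c + b * r) (u r) x)
    (heat (c + b * s) (fun y => du y + b * lap (u s) y) x).
Proof.
move=> Du; rewrite heatDZ -[in X in _ + X]/(heat _ (lap (u s)) x) heat_lap.
under [X in is_derive _ _ X _]eq_fun do rewrite heat_kernel.
have K y := is_deriveM (Du y)
  (is_derive_affine (is_derive_heat e (point_mass R y) x (c + b * s))).
apply: (is_derive_eq (is_derive_bigsum (index_enum L) K)).
rewrite big_split/= addrC; congr (_ + _).
  by rewrite heat_kernel; apply: eq_bigr => y _; rewrite -[LHS]/(_ * _) mulrC.
rewrite -heat_lap.
rewrite (_ : lap (u s) = (fun z => \sum_y u s y * lap (point_mass R y) z)).
  rewrite heat_sum mulr_sumr; apply: eq_bigr => y _.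
  by rewrite -[LHS]/(_ * _); ring.
apply/funext => z; rewrite -[u s]/(fun y => u s y).
have E w : u s w = \sum_y u s y * point_mass R y w.
  by rewrite -[LHS](heat0 e) heat_kernel; apply: eq_bigr => y _; rewrite heat0.
rewrite lapE [LHS](_ : _ = \sum_i \sum_y u s y *
   (point_mass R y (z + e i) + point_mass R y (z - e i) - 2 * point_mass R y z)).
  by rewrite exchange_big/=; apply: eq_bigr => y _; rewrite lapE mulr_sumr.
apply: eq_bigr => i _; rewrite !(E (z + _), E z).
by rewrite mulr_sumr -big_split -sumrB/=; apply: eq_bigr => y _; ring.
Qed.

Lemma continuous_heat_flow u (A : set R) (c b : R) x :
  (forall y, {within A, continuous (fun r => u r y)}) ->
  {within A, continuous (fun r => heat (c + b * r) (u r) x)}.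
Proof.
move=> Cu; under [X in continuous X]eq_fun do rewrite heat_kernel.
elim: (index_enum L) => [|y l IH].
  under [X in continuous X]eq_fun do rewrite big_nil.
  by move=> ?; exact: cvg_cst.
under [X in continuous X]eq_fun do rewrite big_cons.
move=> s; apply: cvgD; last exact: IH.
apply: cvgM; first exact: Cu.
apply: (@continuous_subspaceT _ _ A (fun r => heat (c + b * r) _ x)) => r.
exact/(is_derive_continuous (is_derive_affine (is_derive_heat _ _ _ _))).
Qed.

(** The flow of [heat q f] for the remaining time [r + s - q] does not depend on [q]; compare
    [q = s] with [q = 0]. *)
Lemma heatD r s f x : 0 <= s -> heat r (heat s f) x = heat (r + s) f x.
Proof.
move=> s0.
have D t : is_derive t 1 (fun r0 => heat (r + s + (-1) * r0) (heat r0 f) x) 0.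
  have K := @is_derive_heat_flow (fun r0 => heat r0 f) _ (r + s) (-1) t x
    (fun y => is_derive_heat e f y t).
  apply: (is_derive_eq K); rewrite -[RHS](heat_const e (r + s - t) 0 x).
  rewrite mulN1r; congr (heat _ _ x); apply/funext => y.
  by rewrite mulN1r heat_lap subrr.
have C : {within `[0, s], continuous (fun r0 => heat (r + s + (-1) * r0) (heat r0 f) x)}.
  by apply: continuous_subspaceT => t; exact: is_derive_continuous (D t).
have [c _] := MVT_segment s0 (fun t _ => D t) C.
rewrite mul0r => /eqP; rewrite subr_eq0 => /eqP.
rewrite mulN1r addrK mulr0 addr0 => ->; congr (heat _ _ x).
by apply/funext => y; rewrite heat0.
Qed.

(** Jensen's inequality, as nonnegativity of the variance of [f] under the heat kernel. *)
Lemma sqr_heat_le r f x : 0 <= r ->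
  heat r f x ^+ 2 <= heat r (fun y => f y ^+ 2) x.
Proof.
move=> r0; set m := heat r f x.
have : 0 <= heat r (fun y => (f y - m) ^+ 2) x.
  by apply: heat_ge0 => // y; exact: sqr_ge0.
rewrite (_ : (fun y => _) = (fun y => (f y ^+ 2 + m ^+ 2 * 1) + (- 2 * m) * f y)).
  by rewrite 2!heatDZ heat_const -/m; lra.
by apply/funext => y; ring.
Qed.

Definition gens : pred L := [pred v | [exists i, (v == e i) || (v == - e i)]].

Lemma gensP v : reflect (exists i, v = e i \/ v = - e i) (v \in gens).
Proof.
apply: (iffP existsP) => -[i H]; exists i.
  by case/orP: H => /eqP ->; [left|right].
by case: H => ->; rewrite eqxx ?orbT.
Qed.

(** The right-hand side is the carre du champ, the sum of the squared differences of [g] to all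
    neighbours; only the one along [v] is kept. *)
Lemma lap_sqr_ge g v x : v \in gens ->
  diff v g x ^+ 2 <= lap (fun y => g y ^+ 2) x - 2 * g x * lap g x.
Proof.
move=> /gensP[i H].
rewrite !lapE mulr_sumr -sumrB (bigD1 i)//=.
rewrite -[leLHS]addr0 lerD//.
  rewrite /diff; have := sqr_ge0 (g (x + e i) - g x).
  have := sqr_ge0 (g (x - e i) - g x).
  by case: H => ->; nra.
apply: sumr_ge0 => j _.
have := sqr_ge0 (g (x + e j) - g x); have := sqr_ge0 (g (x - e j) - g x); nra.
Qed.

(* Interpolate between [heat r (f^2)] and [(heat r f)^2] along
   [s |-> heat (r - s) ((heat s f)^2)]; the increment operators commute with the
   flow, hence the derivative dominates the squared gradient of [heat r f]. *)
Lemma diff_heat_sqr r f v x : v \in gens -> 0 <= r ->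
  r * diff v (heat r f) x ^+ 2 <= heat r (fun y => f y ^+ 2) x.
Proof.
move=> vS r0; set d := diff v (heat r f) x.
pose F t := heat (r + (-1) * t) (fun y => heat t f y ^+ 2) x.
pose dF t := heat (r + (-1) * t)
   (fun y => 2 * heat t f y * lap (heat t f) y
      + (-1) * lap (fun y => heat t f y ^+ 2) y) x.
have DF t : is_derive t 1 F (dF t).
  apply: (is_derive_heat_flow (u := fun t y => heat t f y ^+ 2)) => y.
  have D := is_derive_heat e f y t; apply: (is_derive_eq (is_deriveM D D)).
  by rewrite -[LHS]/(_ * _ + _ * _) heat_lap; ring.
have dFle t : 0 <= t -> t <= r -> dF t <= - d ^+ 2.
  move=> t0 tr; rewrite /dF.
  have H1 : heat (r + -1 * t) (fun y => diff v (heat t f) y ^+ 2) x >= d ^+ 2.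
    rewrite (_ : d = heat (r + -1 * t) (diff v (heat t f)) x).
      by apply: sqr_heat_le; rewrite mulN1r subr_ge0.
    by rewrite heat_diff /d /diff !heatD// mulN1r subrK.
  have := @heat_le _ _ _ e (r + -1 * t) (fun y => 2 * heat t f y *
    lap (heat t f) y + 1 * diff v (heat t f) y ^+ 2)
    (lap (fun y => heat t f y ^+ 2)) x.
  have rt : 0 <= r + -1 * t by lra.
  have le y : 2 * heat t f y * lap (heat t f) y + 1 * diff v (heat t f) y ^+ 2 <=
      lap (fun y => heat t f y ^+ 2) y.
    by have := lap_sqr_ge (heat t f) y vS; lra.
  by rewrite !heatDZ => /(_ rt le); move: H1; lra.
have C : {within `[0, r], continuous F}.
  by apply: continuous_subspaceT => t; exact: is_derive_continuous (DF t).
have [c] := MVT_segment r0 (fun t _ => DF t) C.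
rewrite in_itv/= => /andP[c0 cr] E.
have : F r - F 0 <= - d ^+ 2 * r by rewrite subr0 in E; rewrite E ler_wpM2r// dFle.
have : 0 <= F r by apply: heat_ge0; [lra|move=> y; exact: sqr_ge0].
rewrite /F mulr0 addr0 (_ : (fun y => heat 0 f y ^+ 2) = (fun y => f y ^+ 2)).
  by lra.
by apply/funext => y; rewrite heat0.
Qed.

End Semigroup.

(** * Inequalities for real powers *)

Section Powers.
Variable R : realType.
Implicit Types x y p q c a b : R.

Lemma powR_add x a b : 0 < x -> x `^ (a + b) = x `^ a * x `^ b.
Proof. by move=> x0; rewrite powRD//; apply/implyP => _; rewrite gt_eqF. Qed.

Lemma le_powR x y c : 0 <= c -> 0 <= x -> x <= y -> x `^ c <= y `^ c.
Proof.
by move=> c0 x0 xy; apply: ge0_ler_powR; rewrite ?nnegrE ?(le_trans x0 xy).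
Qed.

Lemma ge_powR x y c : c <= 0 -> 0 < x -> x <= y -> y `^ c <= x `^ c.
Proof.
move=> c0 x0 xy; have y0 := lt_le_trans x0 xy.
rewrite -[c]opprK powRN [x `^ _]powRN lef_pV2 ?posrE ?powR_gt0//.
by apply: le_powR; rewrite ?oppr_ge0//; exact: ltW.
Qed.

(** A tangent-line bound. It puts a power of the squared distance below an affine function of it,
    which is the class that the heat flow propagates. *)
Lemma powR_concave a p q : 0 < a -> a <= 1 -> 0 <= p -> 0 < q ->
  p `^ a <= q `^ a + q `^ (a - 1) * p.
Proof.
move=> a0 a1 p0 q0; have [pq|qp] := leP p q.
  by rewrite -[leLHS]addr0 lerD ?mulr_ge0 ?powR_ge0//; apply: le_powR => //; exact: ltW.
rewrite -(mulr_powRB1 p0 a0) -[leLHS]add0r lerD ?powR_ge0// mulrC.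
by rewrite ler_wpM2r//; apply: ge_powR; [lra|by []|exact: ltW].
Qed.

Lemma powR_subadd a p : 0 < a -> a <= 1 -> 0 <= p -> (1 + p) `^ a <= 1 + p `^ a.
Proof.
move=> a0 a1 p0.
rewrite -(mulr_powRB1 _ a0); last lra.
rewrite mulrDl mul1r; apply: lerD.
  have E : (1 : R) = 1 `^ (a - 1) by rewrite powR1.
  by rewrite [leRHS]E; apply: ge_powR; lra.
case: ltgtP p0 => // [p0 _|<- _]; last by rewrite mul0r powR_ge0.
rewrite -(mulr_powRB1 (ltW p0) a0) ler_wpM2l ?(ltW p0)//.
by apply: ge_powR; lra.
Qed.

Lemma powR_half_sqr x a : 0 < x -> (x `^ (a / 2)) ^+ 2 = x `^ a.
Proof. by move=> x0; rewrite expr2 -powR_add//; congr powR; lra. Qed.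

Lemma ler_abs_sqr x y : 0 <= y -> x ^+ 2 <= y ^+ 2 -> `|x| <= y.
Proof.
by move=> y0; rewrite -real_normK ?num_real// ler_pXn2r// nnegrE.
Qed.

Lemma is_derive_powR_affine (c b a s : R) : 0 < c + b * s ->
  is_derive s 1 (fun r => (c + b * r) `^ a) (a * (c + b * s) `^ (a - 1) * b).
Proof.
move=> h; apply: (is_derive_affine (F := fun x => x `^ a)).
exact: is_derive1_powR.
Qed.

End Powers.

(** * Iterated differences of the heat flow *)

Section Kernel.
Variables (R : realType) (L : finZmodType) (n : nat) (e : 'I_n -> L).
Implicit Types (f g phi : L -> R) (x y v : L) (vs : seq L) (t r s b lam mu : R).

Notation heat := (heat e).
Notation lap := (lap e).
Notation gens := (gens e).

Definition diffs vs f := foldr (@diff R L) f vs.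

Lemma diffC v1 v2 f : diff v1 (diff v2 f) = diff v2 (diff v1 f).
Proof.
apply/funext => x; rewrite /diff [x + v2 + v1]addrAC; ring.
Qed.

Lemma diffs_diff v vs f : diffs vs (diff v f) = diff v (diffs vs f).
Proof. by elim: vs => //= w vs ->; rewrite diffC. Qed.

Lemma heat_diffs t vs f x : heat t (diffs vs f) x = diffs vs (heat t f) x.
Proof.
elim: vs x => //= v vs IH x; rewrite heat_diff /diff.
by rewrite !IH.
Qed.

Lemma diffsDZ vs f g b x :
  diffs vs (fun y => f y + b * g y) x = diffs vs f x + b * diffs vs g x.
Proof. by elim: vs x => //= v vs IH x; rewrite /diff !IH; ring. Qed.

Lemma lap_diffs vs f x : lap (diffs vs f) x = diffs vs (lap f) x.
Proof.
elim: vs x => //= v vs IH x.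
rewrite /(diff v (diffs vs (lap f))) -!IH !lapE -sumrB; apply: eq_bigr => i _.
by rewrite /diff [x + e i + v]addrAC [x - e i + v]addrAC; ring.
Qed.

Lemma lap_diff2 f x : lap f x = \sum_i - diff (- e i) (diff (e i) f) x.
Proof.
by rewrite lapE; apply: eq_bigr => i _; rewrite /diff addrNK; ring.
Qed.

Lemma heat_moment phi (c r : R) x : (forall y, lap phi y <= c) -> 0 <= r ->
  heat r phi x <= phi x + c * r.
Proof.
move=> lc r0.
have := @ler_increment R (fun s => heat s phi x) (fun s => 0 + c * s)
  (fun s => heat s (lap phi) x) (fun=> 1 * c) 0 r r0.
rewrite heat0 => H.
suff : heat r phi x - phi x <= 0 + c * r - (0 + c * 0) by lra.
have DH s : is_derive s 1 (fun s => 0 + c * s) (1 * c).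
  exact: (is_derive_affine (F := id) (is_derive_id _ _)).
apply: (H (fun s _ => is_derive_heat e phi x s) (fun s _ => DH s)) => [||s /andP[s0 _]].
- by apply: continuous_subspaceT => s; exact: is_derive_continuous (is_derive_heat e phi x s).
- by apply: continuous_subspaceT => s; exact: is_derive_continuous (DH s).
- rewrite mul1r -[leRHS](heat_const e s c x); apply: heat_le => //; exact: ltW.
Qed.

Section Weight.
Variable phi : L -> R.
Hypothesis phi0 : forall y, 0 <= phi y.
Hypothesis lap_phi : forall y, lap phi y <= (2 * n)%:R.
Hypothesis phi_step : forall v y, v \in gens -> phi (y + v) <= 2 * phi y + 2.

(** Dictated by short times in [diff_heat_bound]: four times the sum of the second moments at [x]
    and [x + v] has coefficient [12] in front of [phi x] and [16 n] in front of [r]. *)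
Definition step_const : R := (16 * n + 12)%:R.

Lemma heat_sqr_bound f lam mu r x : 0 <= mu -> 0 <= r ->
  (forall y, f y ^+ 2 <= lam + mu * phi y) ->
  heat r (fun y => f y ^+ 2) x <= lam + mu * (phi x + (2 * n)%:R * r).
Proof.
move=> mu0 r0 fb; apply: (@le_trans _ _ (heat r (fun y => lam + mu * phi y) x)).
  exact: heat_le.
rewrite heatDZ heat_const lerD2l ler_wpM2l//.
exact: heat_moment.
Qed.

(** The gradient bound gives [1 / r]. At mesh one a difference is never worse than two values, which
    are bounded directly when [r < 1], so the factor improves to [1 / (1 + r)]. *)
Lemma diff_heat_bound f lam mu r v x : 0 <= lam -> 0 <= mu -> 0 <= r ->
  v \in gens -> (forall y, f y ^+ 2 <= lam + mu * phi y) ->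
  diff v (heat r f) x ^+ 2 <=
    step_const / (1 + r) * (lam + mu * (phi x + 1 + r)).
Proof.
move=> lam0 mu0 r0 vS fb; have hb y := heat_sqr_bound y mu0 r0 fb.
have n0 : 0 <= n%:R :> R by [].
have phx := phi0 x.
rewrite mulrAC ler_pdivlMr; last lra.
rewrite /step_const natrD natrM.
have H y : 0 <= mu * phi y by rewrite mulr_ge0.
have [r1|r1] := leP 1 r.
  have := diff_heat_sqr f x vS r0; have := hb x; rewrite natrM => H1 H2.
  set D := diff _ _ _ in H2 *.
  have rD : D ^+ 2 * (1 + r) <= 2 * (r * D ^+ 2) by have := sqr_ge0 D; nra.
  apply: (le_trans rD).
  have A1 : 0 <= n%:R * lam by rewrite mulr_ge0.
  have A2 : 0 <= mu * n%:R * r by rewrite !mulr_ge0.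
  have A3 : 0 <= mu * n%:R by rewrite !mulr_ge0.
  have A4 : 0 <= n%:R * (mu * phi x) by rewrite !mulr_ge0.
  have A5 : 0 <= mu * r by rewrite !mulr_ge0.
  nra.
have H1 := le_trans (sqr_heat_le e f (x + v) r0) (hb (x + v)).
have H2 := le_trans (sqr_heat_le e f x r0) (hb x).
rewrite /diff; set p := heat r f (x + v) in H1 *; set q := heat r f x in H2 *.
have : (p - q) ^+ 2 <= 2 * (p ^+ 2 + q ^+ 2) by have := sqr_ge0 (p + q); nra.
have : mu * phi (x + v) <= mu * (2 * phi x + 2) by rewrite ler_wpM2l ?phi_step.
move: H1 H2; rewrite natrM => H1 H2 H3 H4.
have A1 : 0 <= n%:R * lam by rewrite mulr_ge0.
have A2 : 0 <= mu * n%:R * r by rewrite !mulr_ge0.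
have A3 : 0 <= mu * n%:R by rewrite !mulr_ge0.
have A4 : 0 <= n%:R * (mu * phi x) by rewrite !mulr_ge0.
have A5 : 0 <= mu * r by rewrite !mulr_ge0.
have A6 := H x.
have : (p - q) ^+ 2 * (1 + r) <= 2 * (p - q) ^+ 2 by have := sqr_ge0 (p - q); nra.
nra.
Qed.

(* [k] increments of [heat (k r)] split into [k] copies of one increment of [heat r];
   the class of functions with [f^2 <= lam + mu phi] is stable under each copy. *)
Lemma diffs_heat_mul_bound vs f lam mu r x : 0 <= lam -> 0 <= mu -> 0 <= r ->
  all gens vs -> (forall y, f y ^+ 2 <= lam + mu * phi y) ->
  diffs vs (heat ((size vs)%:R * r) f) x ^+ 2 <=
    (step_const / (1 + r)) ^+ size vs * (lam + mu * (phi x + (size vs)%:R * (1 + r))).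
Proof.
move=> lam0 mu0 r0 + fb; elim: vs x => [|v vs IH] x /=.
  by rewrite mul0r heat0 expr0 mul1r mul0r addr0.
case/andP=> vS vsS.
have c0 : 0 <= step_const / (1 + r).
  by rewrite divr_ge0 ?ler0n//; lra.
rewrite -natr1 mulrDl mul1r addrC.
rewrite (_ : diffs vs _ = heat r (diffs vs (heat ((size vs)%:R * r) f))); last first.
  apply/funext => y; rewrite heat_diffs; congr (diffs vs _ y).
  by apply/funext => z; rewrite heatD// mulr_ge0.
set K := (step_const / (1 + r)) ^+ size vs.
have K0 : 0 <= K by rewrite exprn_ge0.
have := @diff_heat_bound (diffs vs (heat ((size vs)%:R * r) f))
  (K * (lam + mu * ((size vs)%:R * (1 + r)))) (K * mu) r v x.
move=> H; apply: le_trans (H _ _ _ _ _) _ => //.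
- by rewrite mulr_ge0// addr_ge0// !mulr_ge0//; lra.
- by rewrite mulr_ge0.
- move=> y; apply: le_trans (IH y vsS) _; rewrite -/K.
  by rewrite le_eqVlt; apply/orP; left; apply/eqP; ring.
- by rewrite exprS -/K le_eqVlt; apply/orP; left; apply/eqP; ring.
Qed.

(** Cutting [r] into [k] equal steps costs [k ^ k], from [(1 + r) / k <= 1 + r / k], and one more
    [k] from the moment. With [k + 1] for [k] the case [k = 0] is covered as well. *)
Definition kernel_const (k : nat) : R := (step_const * k.+1%:R) ^+ k.+1.

Lemma diffs_heat_bound vs f lam mu r x : 0 <= lam -> 0 <= mu -> 0 <= r ->
  all gens vs -> (forall y, f y ^+ 2 <= lam + mu * phi y) ->
  diffs vs (heat r f) x ^+ 2 <=
    kernel_const (size vs) / (1 + r) ^+ size vs * (lam + mu * (phi x + 1 + r)).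
Proof.
move=> lam0 mu0 r0 vsS fb.
have phx : 0 <= mu * phi x by rewrite mulr_ge0.
have sc1 : 1 <= step_const by rewrite /step_const (ler_nat R 1) addn_gt0 orbT.
have [/size0nil->|k0] := eqVneq (size vs) 0%N.
  rewrite /= expr0 divr1 /kernel_const expr1 mulr1.
  apply: le_trans (le_trans (sqr_heat_le e f x r0) (heat_sqr_bound x mu0 r0 fb)) _.
  apply: (@le_trans _ _ (step_const * (lam + mu * (phi x + r)))).
    have : mu * (phi x + (2 * n)%:R * r) <= step_const * (mu * (phi x + r)).
      rewrite mulrCA ler_wpM2l// mulrDr lerD//; first by rewrite ler_peMl.
      by rewrite ler_wpM2r// /step_const ler_nat (leq_trans _ (leq_addr _ _))// leq_mul2r orbT.
    have : lam <= step_const * lam by rewrite ler_peMl.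
    by rewrite mulrDr; lra.
  by rewrite ler_wpM2l ?ler0n// lerD2l ler_wpM2l//; lra.
have kp : 0 < (size vs)%:R :> R by rewrite ltr0n lt0n.
have k1 : 1 <= (size vs)%:R :> R by rewrite (ler_nat R 1) lt0n.
set k := size vs in k0 kp k1 *.
have rk : 0 <= r / k%:R by rewrite divr_ge0// ltW.
have := diffs_heat_mul_bound x lam0 mu0 rk vsS fb.
rewrite -/k mulrCA divff ?gt_eqF// mulr1 => /le_trans; apply.
have rk1 : r / k%:R <= r by rewrite ler_pdivrMr// ler_peMr.
have q1 : (1 + r) / k%:R <= 1 + r / k%:R.
  by rewrite mulrDl mul1r lerD2r invf_le1.
have E1 : (step_const / (1 + r / k%:R)) ^+ k <= (step_const * k%:R) ^+ k / (1 + r) ^+ k.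
  have sk0 : 0 <= step_const * k%:R by rewrite mulr_ge0 ?ler0n.
  rewrite -expr_div_n; apply: lerXn2r.
  - by rewrite nnegrE divr_ge0//; lra.
  - by rewrite nnegrE divr_ge0//; lra.
  rewrite -mulrA ler_wpM2l ?ler0n//.
  rewrite -[k%:R / _]invrK lef_pV2 ?posrE ?invf_div//; first lra.
  by rewrite divr_gt0//; lra.
have E2 : lam + mu * (phi x + k%:R * (1 + r / k%:R)) <=
   k%:R * (lam + mu * (phi x + 1 + r)).
  have -> : k%:R * (1 + r / k%:R) = k%:R + r by field; rewrite gt_eqF.
  have A1 : lam <= k%:R * lam by rewrite ler_peMl.
  have A2 : mu * phi x <= k%:R * (mu * phi x) by rewrite ler_peMl.
  have A3 : mu * r <= k%:R * (mu * r) by rewrite ler_peMl// mulr_ge0.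
  lra.
apply: le_trans (ler_pM _ _ E1 E2) _.
- by rewrite exprn_ge0// divr_ge0 ?ler0n//; lra.
- by rewrite addr_ge0// mulr_ge0// addr_ge0// mulr_ge0//; lra.
rewrite mulrA ler_wpM2r//.
  by rewrite addr_ge0// mulr_ge0// !addr_ge0.
rewrite mulrAC ler_wpM2r ?invr_ge0 ?exprn_ge0//; first lra.
rewrite /kernel_const exprSr ler_pM ?exprn_ge0 ?mulr_ge0 ?ler0n//.
  by rewrite lerXn2r ?nnegrE ?mulr_ge0 ?ler0n// ler_wpM2l ?ler0n// ler_nat.
by apply: (@le_trans _ _ (1 * k.+1%:R)); [rewrite mul1r ler_nat|rewrite ler_wpM2r].
Qed.

End Weight.
End Kernel.

(** * Frozen coefficients *)

Section Center.
Variables (R : realType) (L : finZmodType) (n : nat) (e : 'I_n -> L).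
Variables (nu : L -> R) (alpha cm cp : R).
Implicit Types (f g : L -> R) (x y v : L) (vs : seq L) (t r s b : R).
Implicit Types (w dw : R -> L -> R).

Notation heat := (heat e).
Notation lap := (lap e).
Notation gens := (gens e).

Hypothesis alpha01 : 0 < alpha < 1.
Hypothesis cm0 : 0 < cm.
Hypothesis cmp : cm <= cp.
Hypothesis nu_ge0 : forall y, 0 <= nu y.
Hypothesis nu0 : nu 0 = 0.
Hypothesis nu_step : forall v y, v \in gens -> nu (y + v) <= nu y + 1.
Hypothesis nu_semiconcave : forall i y,
  nu (y + e i) ^+ 2 + nu (y - e i) ^+ 2 <= 2 * nu y ^+ 2 + 2.

Let phi x0 y := nu (y - x0) ^+ 2.

Let phi_ge0 x0 y : 0 <= phi x0 y. Proof. exact: sqr_ge0. Qed.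

Let lap_phi x0 y : lap (phi x0) y <= (2 * n)%:R.
Proof.
rewrite lapE; apply: (@le_trans _ _ (\sum_(i < n) 2)).
  apply: ler_sum => i _; rewrite /phi [y + _ - _]addrAC [y - e i - x0]addrAC.
  have := nu_semiconcave i (y - x0); lra.
by rewrite sumr_const card_ord -mulrnA.
Qed.

Let phi_step x0 v y : v \in gens -> phi x0 (y + v) <= 2 * phi x0 y + 2.
Proof.
move=> vS; rewrite /phi addrAC; have := nu_step (y - x0) vS.
have := nu_ge0 (y - x0); have := nu_ge0 (y - x0 + v).
set p := nu (_ + v); set q := nu (_ - _) => p0 q0 pq.
have : p ^+ 2 <= (q + 1) ^+ 2 by apply: lerXn2r => //; rewrite nnegrE; lra.
have := sqr_ge0 (q - 1); lra.
Qed.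

(** This constant arises for the square of the difference. As it is at least one, it is below its
    own square, and no root has to be taken. *)
Definition source_const (k : nat) (c : R) : R := 2 * (1 + c) * kernel_const R n k.

Lemma kernel_const_ge1 k : 1 <= kernel_const R n k.
Proof.
rewrite /kernel_const exprn_ege1// /step_const -natrM.
by rewrite (ler_nat R 1) muln_gt0 addn_gt0 orbT.
Qed.

Lemma source_const_ge1 k c : 0 <= c -> 1 <= source_const k c.
Proof. by move=> c0; have := kernel_const_ge1 k; rewrite /source_const; nra. Qed.

(** By [powR_concave] with [q = 1 + r], the class bound holds with [lam] of order [(1 + r) ^ alpha]
    and [mu] of order [(1 + r) ^ (alpha - 1)]. Within parabolic distance of order [sqrt (1 + r)]
    from the centre both contribute [(1 + r) ^ alpha]. *)
Lemma diffs_heat_source vs f (M c theta r : R) x0 x :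
  0 <= M -> 0 <= c -> 0 <= r -> all gens vs ->
  0 <= theta -> theta <= c * (1 + r) -> nu (x - x0) ^+ 2 <= c * (1 + r) ->
  (forall y, f y ^+ 2 <= M ^+ 2 * (theta + nu (y - x0) ^+ 2) `^ alpha) ->
  `|diffs vs (heat r f) x| <=
    source_const (size vs) c * M * (1 + r) `^ ((alpha - (size vs)%:R) / 2).
Proof.
case/andP: alpha01 => a0 a1.
move=> M0 c0 r0 vsS th0 th1 nux fb; set k := size vs.
have q0 : 0 < 1 + r by lra.
have SC := source_const_ge1 k c0.
apply: ler_abs_sqr.
  by apply: mulr_ge0; [apply: mulr_ge0 => //; lra|exact: powR_ge0].
have lam0 : 0 <= M ^+ 2 * (1 + c) * (1 + r) `^ alpha.
  by rewrite !mulr_ge0 ?sqr_ge0 ?powR_ge0//; lra.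
have mu0 : 0 <= M ^+ 2 * (1 + r) `^ (alpha - 1) by rewrite mulr_ge0 ?sqr_ge0 ?powR_ge0.
have qa : (1 + r) `^ (alpha - 1) * (1 + r) = (1 + r) `^ alpha.
  by rewrite mulrC mulr_powRB1//; lra.
have fb' y : f y ^+ 2 <= M ^+ 2 * (1 + c) * (1 + r) `^ alpha +
    M ^+ 2 * (1 + r) `^ (alpha - 1) * phi x0 y.
  apply: le_trans (fb y) _; rewrite -[X in _ <= X + _]mulrA -[X in _ <= _ + X]mulrA -mulrDr.
  rewrite ler_wpM2l ?sqr_ge0//.
  have p0 : 0 <= theta + nu (y - x0) ^+ 2 by rewrite addr_ge0// sqr_ge0.
  apply: le_trans (powR_concave a0 (ltW a1) p0 q0) _.
  have : (1 + r) `^ (alpha - 1) * theta <= c * ((1 + r) `^ (alpha - 1) * (1 + r)).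
    by rewrite mulrCA ler_wpM2l ?powR_ge0.
  rewrite qa /phi => H; rewrite mulrDr; lra.
apply: le_trans (diffs_heat_bound (@phi_ge0 x0) (@lap_phi x0) (@phi_step x0) x
  lam0 mu0 r0 vsS fb') _.
rewrite -/k.
have : M ^+ 2 * (1 + c) * (1 + r) `^ alpha +
    M ^+ 2 * (1 + r) `^ (alpha - 1) * (phi x0 x + 1 + r) <=
    2 * (1 + c) * M ^+ 2 * (1 + r) `^ alpha.
  have : M ^+ 2 * (1 + r) `^ (alpha - 1) * phi x0 x <=
      M ^+ 2 * (1 + r) `^ (alpha - 1) * (c * (1 + r)).
    by rewrite ler_wpM2l.
  have -> : M ^+ 2 * (1 + r) `^ (alpha - 1) * (c * (1 + r)) =
    c * M ^+ 2 * ((1 + r) `^ (alpha - 1) * (1 + r)) by ring.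
  have -> : M ^+ 2 * (1 + r) `^ (alpha - 1) * (phi x0 x + 1 + r) =
    M ^+ 2 * (1 + r) `^ (alpha - 1) * phi x0 x +
    M ^+ 2 * ((1 + r) `^ (alpha - 1) * (1 + r)) by ring.
  by rewrite qa; lra.
have kc := kernel_const_ge1 k.
move=> /(ler_wpM2l (_ : 0 <= kernel_const R n k / (1 + r) ^+ k)) H.
apply: le_trans (H _) _.
  by apply: divr_ge0; [lra|apply: exprn_ge0; lra].
rewrite 2!exprMn powR_half_sqr// powR_add// powRN powR_mulrn ?(ltW q0)//.
set P := (1 + r) `^ alpha / (1 + r) ^+ k.
have P0 : 0 <= M ^+ 2 * P by rewrite mulr_ge0 ?sqr_ge0// divr_ge0 ?powR_ge0// exprn_ge0 ?ltW.
rewrite [leLHS](_ : _ = source_const k c * (M ^+ 2 * P)); last first.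
  by rewrite /source_const /P; field; rewrite gt_eqF// exprn_gt0.
rewrite -[leRHS]mulrA; apply: ler_wpM2r => //.
by rewrite expr2; apply: ler_peMr; lra.
Qed.

(* Freezing the coefficient at [(t0, x0)]: [w] solves the equation with constant
   coefficient [b] up to the increment of a function [f] vanishing to order [alpha] at
   [(t0, x0)] in the parabolic distance. *)
Definition center_source w dw (j : 'I_n) (M a t t0 b : R) x0 := forall s,
  a < s < t -> exists f, (forall y, dw s y - b * lap (w s) y = diff (e j) f y) /\
    forall y, f y ^+ 2 <= M ^+ 2 * (`|t0 - s| + nu (y - x0) ^+ 2) `^ alpha.

Lemma is_derive_diffs vs w (d : L -> R) s y :
  (forall y, is_derive s 1 (fun r => w r y) (d y)) ->
  is_derive s 1 (fun r => diffs vs (w r) y) (diffs vs d y).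
Proof.
by move=> D; elim: vs y => [|v vs IH] y; [exact: D|exact: is_deriveB (IH _) (IH _)].
Qed.

Lemma continuous_diffs vs w (A : set R) y :
  (forall y, {within A, continuous (fun r => w r y)}) ->
  {within A, continuous (fun r => diffs vs (w r) y)}.
Proof.
move=> D; elim: vs y => [|v vs IH] y; first exact: D.
by move=> s; apply: cvgB; exact: IH.
Qed.

(** This is [(alpha - (k + 1)) / 2 + 1]: [k] differences of the solution, one from the source, and a
    gain of one by integrating in time. It is positive for [k <= 1] and negative for [k >= 2]. *)
Definition holder_exp (k : nat) : R := (1 + alpha - k%:R) / 2.

(* Duhamel's formula without integrals: [s |-> heat (r0 + b (t - s)) (w s)] has the
   frozen source as its derivative, and its increments are compared with those of a
   power of [1 + r0 + b (t - s)]. *)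
Lemma duhamel_bound w dw j (M a t t0 b r0 c : R) x0 x vs :
  a <= t -> 0 < b -> 0 <= r0 -> 0 <= M -> 0 <= c -> all gens vs ->
  holder_exp (size vs) != 0 ->
  (forall y, {within `[a, t], continuous (fun r => w r y)}) ->
  (forall s y, a < s < t -> is_derive s 1 (fun r => w r y) (dw s y)) ->
  center_source w dw j M a t t0 b x0 ->
  (forall s, a < s < t -> `|t0 - s| <= c * (1 + (r0 + b * (t - s)))) ->
  nu (x - x0) ^+ 2 <= c * (1 + r0) ->
  `|heat r0 (diffs vs (w t)) x - heat (r0 + b * (t - a)) (diffs vs (w a)) x| <=
    source_const (size vs).+1 c * M / (b * holder_exp (size vs)) *
    ((1 + (r0 + b * (t - a))) `^ holder_exp (size vs)
     - (1 + r0) `^ holder_exp (size vs)).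
Proof.
move=> ab b0 r00 M0 c0 vsS; set be := holder_exp _ => be0 Cw Dw src ht hx.
set K := source_const _ _ * M.
pose G s := heat (r0 + b * t + (- b) * s) (diffs vs (w s)) x.
pose dG s := heat (r0 + b * t + (- b) * s)
  (fun y => diffs vs (dw s) y + (- b) * lap (diffs vs (w s)) y) x.
(* An antiderivative of [K] times the power [be - 1]; [be != 0] rules out a logarithm. *)
pose H s := - (K / (b * be)) * ((1 + r0 + b * t) + (- b) * s) `^ be.
pose dH s := - (K / (b * be)) *
  (be * ((1 + r0 + b * t) + (- b) * s) `^ (be - 1) * (- b)).
have pos s : s <= t -> 0 < (1 + r0 + b * t) + (- b) * s.
  by move=> st; have : 0 <= b * (t - s) by [rewrite mulr_ge0 ?(ltW b0)// subr_ge0]; lra.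
have DG s : a < s < t -> is_derive s 1 G (dG s).
  move=> sat; apply: is_derive_heat_flow => y; apply: is_derive_diffs => z.
  exact: Dw.
have DH s : s <= t -> is_derive s 1 H (dH s).
  by move=> st; apply: is_deriveZ; exact/is_derive_powR_affine/pos.
have CG : {within `[a, t], continuous G}.
  by apply: continuous_heat_flow => y; exact: continuous_diffs.
have CH : {within `[a, t], continuous H}.
  apply: continuous_in_subspaceT => s; rewrite inE/= in_itv/= => /andP[_ st].
  exact: is_derive_continuous (DH s st).
have dGH s : a < s < t -> `|dG s| <= dH s.
  move=> sat; have [f [fE fb]] := src s sat; case/andP: (sat) => as_ st.
  have rE : r0 + b * t + - b * s = r0 + b * (t - s) by ring.
  have bts : 0 <= b * (t - s) by rewrite mulr_ge0 ?(ltW b0)// subr_ge0 ltW.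
  (* The source is itself a difference along [e j], hence one more difference falls on the flow of
     [f]. *)
  have -> : dG s = diffs (e j :: vs) (heat (r0 + b * (t - s)) f) x.
    rewrite -heat_diffs /dG rE; congr (heat _ _ x); apply/funext => y.
    rewrite lap_diffs -diffsDZ -[RHS]/(diff (e j) (diffs vs f) y) -diffs_diff.
    by congr (diffs vs _ y); apply/funext => z; rewrite mulNr fE.
  have jS : all gens (e j :: vs).
    by rewrite /= vsS andbT; apply/gensP; exists j; left.
  apply: le_trans (@diffs_heat_source (e j :: vs) f M c `|t0 - s|
    (r0 + b * (t - s)) x0 x M0 c0 _ jS _ _ _ fb) _ => //.
  - lra.
  - exact: ht.
  - by apply: le_trans hx _; rewrite ler_wpM2l//; lra.
  rewrite [size _]/= -/K /dH.
  have -> : - (K / (b * be)) * (be * (1 + r0 + b * t + - b * s) `^ (be - 1) * - b) =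
    K * (1 + r0 + b * t + - b * s) `^ (be - 1) by field; rewrite be0 gt_eqF.
  rewrite le_eqVlt; apply/orP; left; apply/eqP; congr (_ * _ `^ _); first lra.
  by rewrite /be /holder_exp -natr1; lra.
have := ler_abs_increment ab DG (fun s sat => DH s (ltW (andP sat).2)) CG CH dGH.
rewrite /G /H.
have -> : r0 + b * t + - b * t = r0 by ring.
have -> : r0 + b * t + - b * a = r0 + b * (t - a) by ring.
have -> : 1 + r0 + b * t + - b * t = 1 + r0 by ring.
have -> : 1 + r0 + b * t + - b * a = 1 + (r0 + b * (t - a)) by ring.
move=> /le_trans; apply; rewrite le_eqVlt; apply/orP; left; apply/eqP; ring.
Qed.

Lemma powR_scale (be tau b : R) : 0 < be <= 1 -> 0 <= tau -> 0 <= b <= cp ->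
  (b * tau) `^ be <= (cp + 1) * tau `^ be.
Proof.
move=> /andP[be0 be1] tau0 /andP[b0 bc].
rewrite powRM// ler_wpM2r ?powR_ge0//.
apply: (@le_trans _ _ ((cp + 1) `^ be)); first by apply: le_powR; lra.
by apply: ler1_powR; lra.
Qed.

Definition near_const (k : nat) : R :=
  source_const k.+1 (1 + cm^-1) / (cm * holder_exp k) * (cp + 1).

(** A positive exponent makes the Duhamel bound integrable up to [s = t0], so the flow can be run
    down to heat time zero. The constant [1 + cm^-1] compares the elapsed time [t0 - s] with the
    heat time [b (t0 - s)]. *)
Lemma near_bound w dw j (M a t0 b : R) x0 vs :
  a <= t0 -> cm <= b <= cp -> 0 <= M -> all gens vs ->
  0 < holder_exp (size vs) <= 1 ->
  (forall y, {within `[a, t0], continuous (fun r => w r y)}) ->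
  (forall s y, a < s < t0 -> is_derive s 1 (fun r => w r y) (dw s y)) ->
  center_source w dw j M a t0 t0 b x0 ->
  `|diffs vs (w t0) x0 - heat (b * (t0 - a)) (diffs vs (w a)) x0| <=
    near_const (size vs) * M * (t0 - a) `^ holder_exp (size vs).
Proof.
move=> at0 /andP[cb bc] M0 vsS; rewrite /near_const.
set be := holder_exp _; case/andP=> be0 be1 Cw Dw src.
have b0 : 0 < b by exact: lt_le_trans cm0 cb.
have icm : 0 < cm^-1 by rewrite invr_gt0.
have c0 : 0 <= 1 + cm^-1 by lra.
have be_neq0 : be != 0 by rewrite gt_eqF.
have R0 : 0 <= b * (t0 - a) by rewrite mulr_ge0 ?(ltW b0)// subr_ge0.
have := duhamel_bound (r0 := 0) (x := x0) at0 b0 (lexx 0) M0 c0 vsS be_neq0 Cw Dw src.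
rewrite heat0 !add0r addr0 powR1 -/be => /(_ _ _)/le_trans; apply.
- move=> s /andP[_ st]; rewrite ger0_norm ?subr_ge0 ?(ltW st)//.
  have ts : 0 <= t0 - s by rewrite subr_ge0 ltW.
  have : t0 - s <= cm^-1 * (b * (t0 - s)).
    by rewrite mulrA ler_peMl// mulrC ler_pdivlMr// mul1r.
  have : 0 <= b * (t0 - s) by rewrite mulr_ge0// ltW.
  by rewrite add0r; lra.
- by rewrite subrr nu0 expr0n/=; lra.
set S := source_const _ _; have S1 : 1 <= S by exact: source_const_ge1.
have SM : 0 <= S * M by apply: mulr_ge0 => //; lra.
have cp1 : (b * (t0 - a)) `^ be <= (cp + 1) * (t0 - a) `^ be.
  by apply: powR_scale; rewrite ?be0 ?subr_ge0 ?(ltW b0).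
have := powR_subadd be0 be1 R0 => sub.
apply: (@le_trans _ _ (S * M / (b * be) * ((cp + 1) * (t0 - a) `^ be))).
  apply: ler_wpM2l; last lra.
  by rewrite divr_ge0// mulr_ge0// ltW.
rewrite (_ : S / (cm * be) * (cp + 1) * M * _ =
  S * M / (cm * be) * ((cp + 1) * (t0 - a) `^ be)); last by ring.
apply: ler_wpM2r; first by rewrite mulr_ge0 ?powR_ge0//; lra.
apply: ler_wpM2l => //.
rewrite lef_pV2 ?posrE ?(mulr_gt0 b0 be0) ?(mulr_gt0 cm0 be0)//.
by rewrite ler_wpM2r// ltW.
Qed.

Definition far_const (k : nat) (c : R) : R :=
  source_const k.+1 c / (cm * - holder_exp k) +
  kernel_const R n k * cm `^ (- (1 + alpha) / 2).

(** With a negative exponent the end [s = t] dominates, however early the start. The bounded datum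
    contributes the power [- k / 2], which splits into [holder_exp k], left to [1 + r0], and
    [- (1 + alpha) / 2], which becomes the weight in [t - a]. *)
Lemma far_bound w dw j (M K a t t0 b r0 c : R) x0 x vs :
  a < t -> cm <= b <= cp -> 0 <= M -> 0 <= K -> 0 <= c -> 0 <= r0 ->
  all gens vs -> holder_exp (size vs) < 0 ->
  (forall y, {within `[a, t], continuous (fun r => w r y)}) ->
  (forall s y, a < s < t -> is_derive s 1 (fun r => w r y) (dw s y)) ->
  center_source w dw j M a t t0 b x0 ->
  (forall s, a < s < t -> `|t0 - s| <= c * (1 + (r0 + b * (t - s)))) ->
  nu (x - x0) ^+ 2 <= c * (1 + r0) ->
  (forall y, `|w a y| <= K) ->
  `|heat r0 (diffs vs (w t)) x| <= far_const (size vs) c *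
    (M + K * (t - a) `^ (- (1 + alpha) / 2)) * (1 + r0) `^ holder_exp (size vs).
Proof.
move=> at_ /andP[cb bc] M0 K0 c0 r00 vsS be0 Cw Dw src ht hx wK.
have b0 : 0 < b by exact: lt_le_trans cm0 cb.
have be_neq0 : holder_exp (size vs) != 0 by rewrite lt_eqF.
have := duhamel_bound (ltW at_) b0 r00 M0 c0 vsS be_neq0 Cw Dw src ht hx.
rewrite /far_const; set k := size vs in be0 be_neq0 *; set be := holder_exp k in be0 be_neq0 *.
set q := 1 + (r0 + b * (t - a)).
have ta : 0 < t - a by rewrite subr_gt0.
have bta : 0 < b * (t - a) by rewrite mulr_gt0.
have q0 : 0 < q by rewrite /q; lra.
have rq : 1 + r0 <= q by rewrite /q; lra.
set S := source_const _ _; have S1 : 1 <= S by exact: source_const_ge1.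
have SM : 0 <= S * M by apply: mulr_ge0 => //; lra.
have kc := kernel_const_ge1 k.
set kk := kernel_const R n k in kc *.
have kk0 : 0 <= kk by lra.
have nbe : 0 < - be by lra.
have cbe : 0 < cm * - be by apply: mulr_gt0.
set m := - (1 + alpha) / 2.
have H1 : `|heat (r0 + b * (t - a)) (diffs vs (w a)) x| <=
    kk * cm `^ m * (K * (t - a) `^ m) * (1 + r0) `^ be.
  apply: (@le_trans _ _ (kk * K * q `^ (- k%:R / 2))).
    rewrite heat_diffs; apply: ler_abs_sqr.
      by rewrite mulr_ge0 ?powR_ge0// mulr_ge0.
    have B1 y : w a y ^+ 2 <= K ^+ 2 + 0 * phi x0 y.
      rewrite mul0r addr0 -(real_normK (num_real (w a y))).
      by apply: lerXn2r; rewrite ?nnegrE.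
    have rb0 : 0 <= r0 + b * (t - a) by lra.
    apply: le_trans (diffs_heat_bound (@phi_ge0 x0) (@lap_phi x0) (@phi_step x0)
      x (sqr_ge0 K) (lexx 0) rb0 vsS B1) _.
    rewrite mul0r addr0 -/k -/kk -/q 2!exprMn powR_half_sqr//.
    rewrite powRN powR_mulrn ?(ltW q0)// mulrAC.
    rewrite ler_wpM2r ?sqr_ge0//.
    by rewrite ler_wpM2r ?invr_ge0 ?exprn_ge0 ?(ltW q0)// expr2 ler_peMr.
  have -> : - k%:R / 2 = be + m by rewrite /be /holder_exp /m; lra.
  rewrite powR_add//.
  have E1 : q `^ be <= (1 + r0) `^ be by apply: ge_powR; lra.
  have E2 : q `^ m <= cm `^ m * (t - a) `^ m.
    case/andP: alpha01 => a0 a1.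
    rewrite -powRM ?(ltW cm0) ?(ltW ta)//; apply: ge_powR; first by rewrite /m; lra.
      by rewrite mulr_gt0.
    have : cm * (t - a) <= b * (t - a) by rewrite ler_wpM2r// ltW.
    by rewrite /q; lra.
  rewrite (_ : kk * cm `^ m * _ * _ =
    kk * K * ((1 + r0) `^ be * (cm `^ m * (t - a) `^ m))); last by ring.
  by apply: ler_wpM2l; [exact: mulr_ge0|apply: ler_pM; rewrite ?powR_ge0].
have H2 : S * M / (b * be) * (q `^ be - (1 + r0) `^ be) <=
   S / (cm * - be) * M * (1 + r0) `^ be.
  have -> : S * M / (b * be) * (q `^ be - (1 + r0) `^ be) =
    S * M / (b * - be) * ((1 + r0) `^ be - q `^ be).
    by field; rewrite ?be_neq0 ?oppr_eq0 ?be_neq0 ?gt_eqF.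
  apply: (@le_trans _ _ (S * M / (b * - be) * (1 + r0) `^ be)).
    apply: ler_wpM2l; last by have := powR_ge0 q be; lra.
    by rewrite divr_ge0// mulr_ge0// ltW.
  rewrite [_ * M in leRHS]mulrAC; apply: ler_wpM2r; first exact: powR_ge0.
  apply: ler_wpM2l => //; rewrite lef_pV2 ?posrE ?mulr_gt0//.
  by rewrite ler_wpM2r// ltW.
move=> H3.
set X := heat r0 _ x in H3 *; set Y := heat _ _ x in H1 H3.
have : `|X| <= `|X - Y| + `|Y| by rewrite -{1}(subrK Y X) ler_normD.
set P := (1 + r0) `^ be in H1 H2 H3 *.
have P0 : 0 <= P by exact: powR_ge0.
have S0 : 0 <= S by lra.
have A1 : 0 <= kk * cm `^ m * M * P.
  exact: mulr_ge0 (mulr_ge0 (mulr_ge0 kk0 (powR_ge0 _ _)) M0) P0.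
have A2 : 0 <= S / (cm * - be) * (K * (t - a) `^ m) * P.
  exact: mulr_ge0 (mulr_ge0 (divr_ge0 S0 (ltW cbe))
    (mulr_ge0 K0 (powR_ge0 _ _))) P0.
rewrite (_ : _ * _ * P = S / (cm * - be) * M * P + kk * cm `^ m * (K * (t - a) `^ m) * P
  + kk * cm `^ m * M * P + S / (cm * - be) * (K * (t - a) `^ m) * P); last by ring.
by move=> H4; apply: (le_trans H4); move: (le_trans H3 H2) H1 A1 A2; lra.
Qed.

(** A time derivative of the flow is a Laplacian, that is [n] pairs of further differences; their
    bound with exponent [be - 1] integrates to exponent [be]. *)
Lemma time_variation (F be : R) vs g x (r1 r2 : R) :
  0 <= F -> 0 < be -> 0 <= r1 -> r1 <= r2 -> all gens vs ->
  (forall vs' r, all gens vs' -> size vs' = (size vs).+2 -> r1 <= r <= r2 ->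
    `|heat r (diffs vs' g) x| <= F * (1 + r) `^ (be - 1)) ->
  `|heat r2 (diffs vs g) x - heat r1 (diffs vs g) x| <=
    n%:R * F / be * ((1 + r2) `^ be - (1 + r1) `^ be).
Proof.
move=> F0 be0 r10 r12 vsS hF.
pose H r := (n%:R * F / be) * (1 + 1 * r) `^ be.
pose dH r := (n%:R * F / be) * (be * (1 + 1 * r) `^ (be - 1) * 1).
have DH s : r1 <= s -> is_derive s 1 H (dH s).
  by move=> rs; apply: is_deriveZ; apply: is_derive_powR_affine; lra.
have CH : {within `[r1, r2], continuous H}.
  apply: continuous_in_subspaceT => s; rewrite inE/= in_itv/= => /andP[st _].
  exact: is_derive_continuous (DH s st).
have DG s := is_derive_heat e (diffs vs g) x s.
have CG : {within `[r1, r2], continuous (fun s => heat s (diffs vs g) x)}.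
  by apply: continuous_subspaceT => s; exact: is_derive_continuous (DG s).
have := ler_abs_increment r12 (fun s _ => DG s)
  (fun s sr => DH s (ltW (andP sr).1)) CG CH.
rewrite -mulrBr /H !mul1r; apply => s /andP[s1 s2].
rewrite heat_lap lap_diff2.
apply: le_trans (ler_norm_sum _ _ _) _.
apply: (@le_trans _ _ (\sum_(i < n) F * (1 + s) `^ (be - 1))).
  apply: ler_sum => i _; rewrite normrN.
  have -> : diff (- e i) (diff (e i) (heat s (diffs vs g))) x =
      heat s (diffs (- e i :: e i :: vs) g) x.
    by rewrite /= !heat_diff; congr (diff _ _ x); apply/funext => y; rewrite heat_diff.
  apply: hF; rewrite ?(ltW s1) ?(ltW s2)//= vsS andbT.
  by apply/andP; split; apply/gensP; exists i; [right|left].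
rewrite sumr_const card_ord -mulr_natl /dH mul1r mulr1.
by rewrite le_eqVlt; apply/orP; left; apply/eqP; field; rewrite gt_eqF.
Qed.

Lemma powR_weight (t : R) (N : nat) : 0 < t -> (0 < N)%N ->
  (t / N%:R) `^ (- (1 + alpha) / 2) <= N%:R * t `^ (- (1 + alpha) / 2).
Proof.
case/andP: alpha01 => a0 a1 t0 N0.
have N1 : 1 <= N%:R :> R by rewrite (ler_nat R 1).
rewrite powRM ?(ltW t0) ?invr_ge0// mulrC ler_wpM2r ?powR_ge0//.
rewrite -powR_inv1// -powRrM mulN1r.
by apply: ler1_powR => //; lra.
Qed.

Lemma holder_expSS k : holder_exp k.+2 = holder_exp k - 1.
Proof. by rewrite /holder_exp -addn2 natrD; lra. Qed.

Lemma far_const_ge0 k c : 0 <= c -> holder_exp k < 0 -> 0 <= far_const k c.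
Proof.
move=> c0 hk; rewrite /far_const.
have S1 := source_const_ge1 k.+1 c0; have k1 := kernel_const_ge1 k.
apply: addr_ge0.
  by apply: divr_ge0; [lra|apply: mulr_ge0; [exact: ltW|lra]].
by apply: mulr_ge0; [lra|exact: powR_ge0].
Qed.

Lemma near_const_ge0 k : 0 < holder_exp k -> 0 <= near_const k.
Proof.
move=> hk; rewrite /near_const.
have c0 : 0 <= 1 + cm^-1 by rewrite addr_ge0// invr_ge0 ltW.
have S1 := source_const_ge1 k.+1 c0.
have cp0 : 0 < cp := lt_le_trans cm0 cmp.
apply: mulr_ge0; last lra.
by apply: divr_ge0; [lra|apply: mulr_ge0; exact: ltW].
Qed.

Definition time_const k : R := near_const k +
  n%:R * (far_const k.+2 (1 + cm^-1) * 2) / holder_exp k * (cp + 1).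

(* Both [w t0] and [w t1] are compared with the flow started from [w t1]. *)
Lemma time_holder w dw j (M K t1 t0 b0 b1 : R) x0 vs :
  0 < t1 -> t1 <= t0 -> cm <= b0 <= cp -> cm <= b1 <= cp -> 0 <= M -> 0 <= K ->
  all gens vs -> 0 < holder_exp (size vs) < 1 ->
  (forall y, {within `[t1 / 2, t0], continuous (fun r => w r y)}) ->
  (forall s y, t1 / 2 < s < t0 -> is_derive s 1 (fun r => w r y) (dw s y)) ->
  center_source w dw j M t1 t0 t0 b0 x0 ->
  center_source w dw j M (t1 / 2) t1 t1 b1 x0 ->
  (forall y, `|w (t1 / 2) y| <= K) ->
  `|diffs vs (w t0) x0 - diffs vs (w t1) x0| <= time_const (size vs) *
    (M + K * t1 `^ (- (1 + alpha) / 2)) * (t0 - t1) `^ holder_exp (size vs).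
Proof.
move=> t10 t10' b0c b1c M0 K0 vsS /andP[be0 be1] Cw Dw src0 src1 wK.
set k := size vs in be0 be1 *; set D0 := M + _.
have t1h : t1 / 2 < t1 by lra.
have icm : 0 < cm^-1 by rewrite invr_gt0.
have c0 : 0 <= 1 + cm^-1 by lra.
have kt0 : 0 <= K * t1 `^ (- (1 + alpha) / 2) by rewrite mulr_ge0 ?powR_ge0.
have D00 : 0 <= D0 by rewrite /D0; lra.
have h2 : holder_exp k.+2 < 0 by rewrite holder_expSS; lra.
have F0 := far_const_ge0 c0 h2.
have ta : 0 <= t0 - t1 by lra.
have b00 : 0 <= b0 by case/andP: b0c => b0c _; apply: le_trans b0c; exact: ltW.
have R0 : 0 <= b0 * (t0 - t1) by exact: mulr_ge0.
have N := @near_bound w dw j M t1 t0 b0 x0 vs t10' b0c M0 vsS.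
rewrite -/k be0 (ltW be1) in N.
have {}N := N isT.
have t1sub : `[t1, t0] `<=` `[t1 / 2, t0].
  by apply: subset_itvr; rewrite bnd_simp ltW.
have {}N := N (fun y => continuous_subspaceW t1sub (Cw y)).
have Dw1 s y : t1 < s < t0 -> is_derive s 1 (fun r => w r y) (dw s y).
  by case/andP=> s0 s1; apply: Dw; rewrite s1 (lt_trans t1h).
have {}N := N Dw1 src0.
(* The factor [2] pays for replacing [t1 - t1 / 2] by [t1] in the weight. *)
have V := @time_variation (far_const k.+2 (1 + cm^-1) * (2 * D0)) (holder_exp k)
  vs (w t1) x0 0 (b0 * (t0 - t1)).
rewrite -/k heat0 in V.
have F20 : 0 <= far_const k.+2 (1 + cm^-1) * (2 * D0).
  by apply: mulr_ge0 => //; lra.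
have {}V := V F20 be0 (lexx 0) R0 vsS.
have {}V : `|heat (b0 * (t0 - t1)) (diffs vs (w t1)) x0 - diffs vs (w t1) x0| <=
  n%:R * (far_const k.+2 (1 + cm^-1) * (2 * D0)) / holder_exp k *
    ((1 + b0 * (t0 - t1)) `^ holder_exp k - (1 + 0) `^ holder_exp k).
  apply: V => vs' r vs'S vs'k /andP[r0 _].
  have := @far_bound w dw j M K (t1 / 2) t1 t1 b1 r (1 + cm^-1) x0 x0 vs'
    t1h b1c M0 K0 c0 r0 vs'S.
  rewrite vs'k => /(_ h2) Fb.
  apply: le_trans (Fb _ _ src1 _ _ wK) _.
  - by move=> y; apply: continuous_subspaceW (Cw y); apply: subset_itvl; rewrite bnd_simp.
  - by move=> s y /andP[s0 s1]; apply: Dw; rewrite s0 (lt_le_trans s1).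
  - move=> s /andP[_ st]; case/andP: b1c => b1c _.
    have ts : 0 <= t1 - s by rewrite subr_ge0 ltW.
    rewrite ger0_norm//.
    have : t1 - s <= cm^-1 * (b1 * (t1 - s)).
      by rewrite mulrA ler_peMl// mulrC ler_pdivlMr// mul1r.
    have : 0 <= b1 * (t1 - s) by rewrite mulr_ge0// (le_trans (ltW cm0)).
    have : 0 <= cm^-1 * r by rewrite mulr_ge0// ltW.
    lra.
  - by rewrite subrr nu0 expr0n/=; have : 0 <= cm^-1 * r by [rewrite mulr_ge0// ltW]; lra.
  rewrite holder_expSS; apply: ler_wpM2r; first exact: powR_ge0.
  apply: ler_wpM2l => //.
  have -> : t1 - t1 / 2 = t1 / 2%:R by lra.
  by have := ler_wpM2l K0 (powR_weight t10 (isT : (0 < 2)%N)); rewrite /D0; lra.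
have S := powR_subadd be0 (ltW be1) R0.
have P : (b0 * (t0 - t1)) `^ holder_exp k <= (cp + 1) * (t0 - t1) `^ holder_exp k.
  by apply: powR_scale => //; [rewrite be0 ltW|rewrite b00; case/andP: b0c].
have W : `|heat (b0 * (t0 - t1)) (diffs vs (w t1)) x0 - diffs vs (w t1) x0| <=
  n%:R * (far_const k.+2 (1 + cm^-1) * 2) / holder_exp k * (cp + 1) * D0 *
    (t0 - t1) `^ holder_exp k.
  apply: (le_trans V); rewrite addr0 powR1.
  rewrite (_ : _ * D0 * _ = n%:R * (far_const k.+2 (1 + cm^-1) * (2 * D0)) / holder_exp k *
    ((cp + 1) * (t0 - t1) `^ holder_exp k)); last by ring.
  apply: ler_wpM2l; last lra.
  by apply: divr_ge0; [exact: mulr_ge0|exact: ltW].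
rewrite /time_const.
have N0 := near_const_ge0 be0.
have N1 : near_const k * M * (t0 - t1) `^ holder_exp k <=
    near_const k * D0 * (t0 - t1) `^ holder_exp k.
  apply: ler_wpM2r; first exact: powR_ge0.
  by apply: ler_wpM2l => //; rewrite /D0; lra.
rewrite (mulrDl (near_const k)) (mulrDl (near_const k * D0)).
set X := diffs vs (w t0) x0 in N *; set Y := diffs vs (w t1) x0 in W *.
set Z := heat _ _ x0 in N W.
have -> : X - Y = (X - Z) + (Z - Y) by ring.
by apply: le_trans (ler_normD _ _) _; apply: lerD => //; exact: le_trans N N1.
Qed.

(** The slack [l - m] pays for the length of the path, which thus never leaves the ball where single
    differences are controlled. *)
Lemma path_bound g (E l : R) x0 :
  (forall u x, u \in gens -> nu (x - x0) <= l -> `|diff u g x| <= E) ->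
  forall p x (m : R), all gens p -> nu (x - x0) <= m -> m + (size p)%:R <= l ->
    `|g (x + \sum_(u <- p) u) - g x| <= (size p)%:R * E.
Proof.
move=> hg; elim=> [x m _ _ _|u p IH x m] /=.
  by rewrite big_nil addr0 subrr normr0 mul0r.
case/andP=> uS pS nx; rewrite -natr1 => ml; rewrite big_cons addrA.
have p0 : 0 <= (size p)%:R :> R by [].
have H1 : `|diff u g x| <= E by apply: hg => //; lra.
have H2 : `|g (x + u + \sum_(j <- p) j) - g (x + u)| <= (size p)%:R * E.
  apply: (IH (x + u) (m + 1)) => //; last lra.
  by rewrite addrAC; apply: le_trans (nu_step _ uS) _; lra.
rewrite mulrDl mul1r -(subrKA (g (x + u))).
by apply: le_trans (ler_normD _ _) _; exact: lerD.
Qed.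

(** Two comparisons of the solution with a flow, two changes of heat time and one path in space. The
    factors [4] come from lowering the time in the weight from [t] to [t / 4]. *)
Definition space_const : R := 2 * near_const 1 +
  2 * (n%:R * (far_const 3 (1 + cm^-1) * 4) / holder_exp 1 * (cp + 1)) +
  far_const 2 (1 + cm^-1) * 4 * cm `^ holder_exp 2.

(* Both points are compared with flows started from the same [w (t - l^2)], with the
   two frozen coefficients; a change of coefficient is a change of heat time. *)
Lemma space_holder w dw j (M K t b0 b1 : R) x0 v p :
  0 < t -> cm <= b0 <= cp -> cm <= b1 <= cp -> 0 <= M -> 0 <= K ->
  v \in gens -> all gens p -> (0 < size p)%N -> 4 * (size p)%:R ^+ 2 <= t ->
  (forall y, {within `[t / 2, t], continuous (fun r => w r y)}) ->
  (forall s y, t / 2 < s < t -> is_derive s 1 (fun r => w r y) (dw s y)) ->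
  center_source w dw j M (t / 2) t t b0 x0 ->
  center_source w dw j M (t / 2) t t b1 (x0 + \sum_(u <- p) u) ->
  (forall y, `|w (t / 2) y| <= K) ->
  `|diff v (w t) x0 - diff v (w t) (x0 + \sum_(u <- p) u)| <= space_const *
    (M + K * t `^ (- (1 + alpha) / 2)) * (size p)%:R `^ alpha.
Proof.
case/andP: alpha01 => al0 al1.
move=> t0 b0c b1c M0 K0 vS pS p0 pt Cw Dw src0 src1 wK.
set x1 := x0 + _ in src1 *; set D0 := M + _; set l : R := (size p)%:R in pt *.
have l1 : 1 <= l by rewrite /l (ler_nat R 1).
have l0 : 0 < l by lra.
have l20 : 0 < l ^+ 2 by rewrite exprn_gt0.
have icm : 0 < cm^-1 by rewrite invr_gt0.
have c0 : 0 <= 1 + cm^-1 by lra.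
have cp0 : 0 < cp := lt_le_trans cm0 cmp.
have kt0 : 0 <= K * t `^ (- (1 + alpha) / 2) by rewrite mulr_ge0 ?powR_ge0.
have D00 : 0 <= D0 by rewrite /D0; lra.
(* The flows start at parabolic depth [l]; by [4 l^2 <= t] this leaves at least [t / 4] between
   [t / 2] and [sg]. *)
pose sg := t - l ^+ 2.
have sgt : sg <= t by rewrite /sg; lra.
have sg2 : t / 2 < sg by rewrite /sg; lra.
have tsg : t - sg = l ^+ 2 by rewrite /sg; lra.
have lal : (l ^+ 2) `^ holder_exp 1 = l `^ alpha.
  rewrite -powR_mulrn ?(ltW l0)// -powRrM /holder_exp; congr (_ `^ _); lra.
have h1 : 0 < holder_exp 1 <= 1 by rewrite /holder_exp; apply/andP; split; lra.
have h2 : holder_exp 2 < 0 by rewrite /holder_exp; lra.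
have h3 : holder_exp 3 < 0 by rewrite /holder_exp; lra.
have N1 := near_const_ge0 (andP h1).1.
have F2 := far_const_ge0 c0 h2; have F3 := far_const_ge0 c0 h3.
have vS1 : all gens [:: v] by rewrite /= andbT; exact: vS.
have near b x : cm <= b <= cp -> center_source w dw j M (t / 2) t t b x ->
    `|diff v (w t) x - heat (b * l ^+ 2) (diff v (w sg)) x| <=
       near_const 1 * D0 * l `^ alpha.
  move=> bc src.
  have := @near_bound w dw j M sg t b x [:: v] sgt bc M0 vS1 h1.
  rewrite tsg lal /= => Nb; apply: le_trans (Nb _ _ _) _.
  - by move=> y; apply: continuous_subspaceW (Cw y); apply: subset_itvr; rewrite bnd_simp ltW.
  - by move=> s y /andP[s0 s1]; apply: Dw; rewrite s1 (lt_trans sg2).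
  - by move=> s /andP[s0 s1]; apply: src; rewrite s1 (lt_trans sg2).
  apply: ler_wpM2r; first exact: powR_ge0.
  by apply: ler_wpM2l => //; rewrite /D0; lra.
(* Only the equation frozen at [x0] is used, also at the other point: at heat times of order [l^2] a
   displacement by [l] is within the parabolic scale. *)
have far vs r x : all gens vs -> holder_exp (size vs) < 0 -> cm * l ^+ 2 <= r ->
    nu (x - x0) <= l ->
    `|heat r (diffs vs (w sg)) x| <= far_const (size vs) (1 + cm^-1) * (4 * D0) *
       (1 + r) `^ holder_exp (size vs).
  move=> vsS hk rl nx.
  have r0 : 0 <= r by apply: le_trans rl; rewrite mulr_ge0// ltW.
  have lr : l ^+ 2 <= cm^-1 * r by rewrite mulrC ler_pdivlMr// mulrC.
  have := @far_bound w dw j M K (t / 2) sg t b0 r (1 + cm^-1) x0 x vs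
    sg2 b0c M0 K0 c0 r0 vsS hk.
  move=> Fb; apply: le_trans (Fb _ _ _ _ _ wK) _.
  - by move=> y; apply: continuous_subspaceW (Cw y); apply: subset_itvl; rewrite bnd_simp.
  - by move=> s y /andP[s0 s1]; apply: Dw; rewrite s0 (lt_le_trans s1).
  - by move=> s /andP[s0 s1]; apply: src0; rewrite s0 (lt_le_trans s1).
  - move=> s /andP[_ st]; case/andP: b0c => b0c _.
    have ts : 0 <= sg - s by rewrite subr_ge0 ltW.
    rewrite ger0_norm; last by lra.
    have : sg - s <= cm^-1 * (b0 * (sg - s)).
      by rewrite mulrA ler_peMl// mulrC ler_pdivlMr// mul1r.
    have : 0 <= b0 * (sg - s) by rewrite mulr_ge0// (le_trans (ltW cm0)).
    have -> : t - s = l ^+ 2 + (sg - s) by rewrite /sg; lra.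
    by lra.
  - have n0 := nu_ge0 (x - x0).
    have : nu (x - x0) ^+ 2 <= l ^+ 2 by apply: lerXn2r => //; rewrite nnegrE ltW.
    by lra.
  apply: ler_wpM2r; first exact: powR_ge0.
  apply: ler_wpM2l; first exact: far_const_ge0.
  have : (sg - t / 2) `^ (- (1 + alpha) / 2) <= (t / 4%:R) `^ (- (1 + alpha) / 2).
    by apply: ge_powR; rewrite /sg; lra.
  move=> /le_trans/(_ (powR_weight t0 (isT : (0 < 4)%N)))/(ler_wpM2l K0).
  by rewrite /D0; lra.
have F4 : 0 <= far_const 3 (1 + cm^-1) * (4 * D0) by apply: mulr_ge0 => //; lra.
have cl0 : 0 <= cm * l ^+ 2 by rewrite mulr_ge0// ltW.
(* Every heat time [b l^2] is brought to the common value [cm l^2], the smallest admissible one and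
   still of order [l^2]. *)
have var b x : cm <= b <= cp -> nu (x - x0) <= l ->
    `|heat (b * l ^+ 2) (diff v (w sg)) x - heat (cm * l ^+ 2) (diff v (w sg)) x| <=
      n%:R * (far_const 3 (1 + cm^-1) * 4) / holder_exp 1 * (cp + 1) * D0 * l `^ alpha.
  case/andP=> cb bc nx.
  have cbl : cm * l ^+ 2 <= b * l ^+ 2 by rewrite ler_wpM2r// ltW.
  have := @time_variation (far_const 3 (1 + cm^-1) * (4 * D0)) (holder_exp 1)
    [:: v] (w sg) x _ _ F4 (andP h1).1 cl0 cbl vS1.
  move=> V; apply: le_trans (V _) _.
    move=> vs' r vs'S vs'k /andP[r0 _].
    have := far vs' r x vs'S; rewrite vs'k -holder_expSS; exact.
  rewrite (_ : _ * D0 * _ = n%:R * (far_const 3 (1 + cm^-1) * (4 * D0)) / holder_exp 1 *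
    ((cp + 1) * l `^ alpha)); last by ring.
  apply: ler_wpM2l.
    by apply: divr_ge0; [exact: mulr_ge0|case/andP: h1 => /ltW].
  apply: (@le_trans _ _ (((cp + 1) * l ^+ 2) `^ holder_exp 1)).
    apply: (@le_trans _ _ ((1 + b * l ^+ 2) `^ holder_exp 1)).
      by rewrite gerBl powR_ge0.
    apply: le_powR.
    - by case/andP: h1 => /ltW.
    - by have : 0 <= b * l ^+ 2 by [lra]; lra.
    - have : b * l ^+ 2 <= cp * l ^+ 2 by rewrite ler_wpM2r// ltW.
      have : 1 <= l ^+ 2 by rewrite exprn_ege1.
      by lra.
  rewrite powRM ?(ltW l20)//; last lra.
  rewrite lal ler_wpM2r ?powR_ge0//.
  by apply: ler1_powR; [lra|case/andP: h1].
(* At heat time [cm l^2] two differences cost [l ^ (alpha - 1)], and the path has [l] steps. *)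
have path : `|heat (cm * l ^+ 2) (diff v (w sg)) x1 -
    heat (cm * l ^+ 2) (diff v (w sg)) x0| <=
    far_const 2 (1 + cm^-1) * 4 * cm `^ holder_exp 2 * D0 * l `^ alpha.
  have := @path_bound (heat (cm * l ^+ 2) (diff v (w sg)))
    (far_const 2 (1 + cm^-1) * (4 * D0) * (1 + cm * l ^+ 2) `^ holder_exp 2) l x0.
  move=> PB; apply: le_trans (PB _ p x0 0 pS _ _) _.
  - move=> u x uS nx; rewrite -heat_diff.
    apply: (far [:: u; v]) => //=; rewrite ?andbT; first exact/andP.
  - by rewrite subrr nu0.
  - by rewrite add0r.
  rewrite -/l.
  have E : (1 + cm * l ^+ 2) `^ holder_exp 2 <= cm `^ holder_exp 2 * l `^ (alpha - 1).
    have <- : (l ^+ 2) `^ holder_exp 2 = l `^ (alpha - 1).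
      rewrite -powR_mulrn ?(ltW l0)// -powRrM /holder_exp; congr (_ `^ _); lra.
    rewrite -powRM ?(ltW cm0) ?(ltW l20)//; apply: ge_powR; first exact: ltW.
      exact: mulr_gt0.
    by lra.
  rewrite -(mulr_powRB1 (ltW l0) al0).
  rewrite (_ : _ * D0 * _ = l * (far_const 2 (1 + cm^-1) * (4 * D0) *
     (cm `^ holder_exp 2 * l `^ (alpha - 1)))); last by ring.
  apply: ler_wpM2l; first exact: ltW.
  by apply: ler_wpM2l => //; apply: mulr_ge0 => //; lra.
have nx1 : nu (x1 - x0) <= l.
  have : forall q, all gens q -> nu (\sum_(u <- q) u) <= (size q)%:R.
    elim=> [|u q IH] /=; first by rewrite big_nil nu0.
    case/andP=> uS qS; rewrite big_cons addrC -natr1.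
    by apply: le_trans (nu_step _ uS) _; rewrite lerD2r IH.
  by rewrite /x1 [x0 + _]addrC addrK; exact.
have nx0 : nu (x0 - x0) <= l by rewrite subrr nu0 ltW.
have B0 := near b0 x0 b0c src0; have B1 := near b1 x1 b1c src1.
have V0 := var b0 x0 b0c nx0; have V1 := var b1 x1 b1c nx1.
have -> : space_const * D0 * l `^ alpha = 2 * (near_const 1 * D0 * l `^ alpha) +
  2 * (n%:R * (far_const 3 (1 + cm^-1) * 4) / holder_exp 1 * (cp + 1) * D0 * l `^ alpha) +
  far_const 2 (1 + cm^-1) * 4 * cm `^ holder_exp 2 * D0 * l `^ alpha.
  by rewrite /space_const; ring.
set A0 := diff v (w t) x0 in B0 *; set A1 := diff v (w t) x1 in B1 *.
set Z0 := heat _ _ x0 in B0 V0; set Z1 := heat _ _ x1 in B1 V1.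
set Y0 := heat _ _ x0 in V0 path; set Y1 := heat _ _ x1 in V1 path.
have -> : A0 - A1 = (A0 - Z0) + (Z0 - Y0) - (Y1 - Y0) - (Z1 - Y1) - (A1 - Z1) by ring.
have T a b : `|a - b| <= `|a| + `|b| :> R by rewrite -[`|b|]normrN ler_normD.
have := T (A0 - Z0 + (Z0 - Y0) - (Y1 - Y0) - (Z1 - Y1)) (A1 - Z1).
have := T (A0 - Z0 + (Z0 - Y0) - (Y1 - Y0)) (Z1 - Y1).
have := T (A0 - Z0 + (Z0 - Y0)) (Y1 - Y0).
have := ler_normD (A0 - Z0) (Z0 - Y0).
move: B0 B1 V0 V1 path; lra.
Qed.

End Center.

(** * Absorption of the gradient *)

Section Constants.
Variables (R : realType) (n : nat) (alpha cm cp : R).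
Hypothesis alpha01 : 0 < alpha < 1.
Hypothesis cm0 : 0 < cm.
Hypothesis cmp : cm <= cp.

Let c0 : 0 <= 1 + cm^-1. Proof. by rewrite addr_ge0// invr_ge0 ltW. Qed.

Let cp0 : 0 < cp := lt_le_trans cm0 cmp.

Lemma holder_exp01 k : (k <= 1)%N -> 0 < holder_exp alpha k < 1.
Proof.
case/andP: alpha01 => al0 al1.
by rewrite /holder_exp; case: k => [|[|//]] _; apply/andP; split; lra.
Qed.

Lemma holder_exp_lt0 k : (k <= 1)%N -> holder_exp alpha k.+2 < 0.
Proof. by move=> /holder_exp01/andP[_]; rewrite holder_expSS subr_lt0. Qed.

Lemma time_const_ge0 k : (k <= 1)%N -> 0 <= time_const n alpha cm cp k.
Proof.
move=> k1; have [he0 _] := andP (holder_exp01 k1).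
apply: addr_ge0; first exact: near_const_ge0.
apply: mulr_ge0; last by rewrite addr_ge0// ltW.
apply: divr_ge0; last exact: ltW.
by rewrite !mulr_ge0//; apply: far_const_ge0 => //; exact: holder_exp_lt0.
Qed.

Lemma space_const_ge0 : 0 <= space_const n alpha cm cp.
Proof.
have [he0 _] := andP (holder_exp01 (leqnn 1)).
have F2 := far_const_ge0 n cm0 c0 (holder_exp_lt0 (leq0n 1)).
have F3 := far_const_ge0 n cm0 c0 (holder_exp_lt0 (leqnn 1)).
apply: addr_ge0; last by rewrite !mulr_ge0 ?powR_ge0.
apply: addr_ge0; first by rewrite mulr_ge0// near_const_ge0.
apply: mulr_ge0 => //; apply: mulr_ge0; last by rewrite addr_ge0// ltW.
by apply: divr_ge0; [rewrite !mulr_ge0|exact: ltW].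
Qed.

End Constants.

(** * Hoelder bounds for the system on the mesh-one lattice *)

Section LatticeSystem.
Variables (R : realType) (L : finZmodType) (n : nat) (e : 'I_n -> L).
Variables (nu : L -> R) (alpha cm cp : R).
Implicit Types (s t : R) (x y : L).
Hypothesis alpha01 : 0 < alpha < 1.
Hypothesis cm0 : 0 < cm.
Hypothesis cmp : cm <= cp.
Hypothesis nu_ge0 : forall y, 0 <= nu y.
Hypothesis nu0 : nu 0 = 0.
Hypothesis nu_step : forall v y, v \in gens e -> nu (y + v) <= nu y + 1.
Hypothesis nu_semiconcave : forall i y,
  nu (y + e i) ^+ 2 + nu (y - e i) ^+ 2 <= 2 * nu y ^+ 2 + 2.

Variables (T A B G K : R) (w : 'I_n -> R -> L -> R) (aa g : R -> L -> R).

Let div s y := \sum_i (w i s y - w i s (y - e i)).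
Let dw j s y := diff (e j) (fun z => aa s z * div s z + g s z) y.

Hypothesis A0 : 0 <= A.
Hypothesis B0 : 0 <= B.
Hypothesis G0 : 0 <= G.
Hypothesis K0 : 0 <= K.
Hypothesis w_cont : forall j y, {within `]0, T], continuous (fun s => w j s y)}.
Hypothesis w_eq : forall j s y, 0 < s < T ->
  is_derive s 1 (fun r => w j r y) (dw j s y).
Hypothesis w_curl : forall i j s y, 0 < s <= T ->
  diff (e i) (w j s) y = diff (e j) (w i s) y.
Hypothesis aa_bound : forall s y, 0 < s <= T -> cm <= aa s y <= cp.
Hypothesis aa_holder : forall (sg : R) s (s' : R) y (y' : L), 0 < sg ->
  sg <= s <= T -> sg <= s' <= T ->
  `|aa s y - aa s' y'| <=
    A * sg `^ (- alpha / 2) * (`|s' - s| + nu (y - y') ^+ 2) `^ (alpha / 2).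
Hypothesis w_grad : forall i j s y, 0 < s <= T ->
  Num.sqrt s * `|diff (e i) (w j s) y| <= B.
Hypothesis g_holder : forall s y x, 0 < s <= T ->
  `|g s y - g s x| * s `^ ((1 + alpha) / 2) <= G * nu (y - x) `^ alpha.
Hypothesis w_bound : forall j s y, 0 < s <= T -> `|w j s y| <= K.

(** For a curl-free field the gradient of the divergence is the Laplacian of each component; this
    decouples the system once the coefficient is frozen. *)
Lemma lap_w j s y : 0 < s <= T -> lap e (w j s) y = diff (e j) (div s) y.
Proof.
move=> sT; rewrite lapE /diff /div -sumrB; apply: eq_bigr => i _.
have := w_curl i j y sT; have := w_curl i j (y - e i) sT.
rewrite /diff subrK [y - e i + e j]addrAC; lra.
Qed.

Lemma div_bound s y : 0 < s <= T -> `|div s y| <= n%:R * B * s `^ (- 1 / 2).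
Proof.
move=> sT; case/andP: (sT) => s0 _.
apply: le_trans (ler_norm_sum _ _ _) _.
apply: (@le_trans _ _ (\sum_(i < n) B * s `^ (- 1 / 2))).
  apply: ler_sum => i _; have := w_grad i i (y - e i) sT.
  rewrite /diff subrK => H.
  rewrite mulNr mul1r powRN powR12_sqrt ?(ltW s0)//.
  by rewrite ler_pdivlMr ?sqrtr_gt0// mulrC.
by rewrite sumr_const card_ord -[_ *+ n]mulr_natl mulrA.
Qed.

Let M t := 2 * (n%:R * (A * B) + G) * t `^ (- (1 + alpha) / 2).

(** The time weights [- alpha / 2] of the coefficient and [- 1 / 2] of [div] add up to
    [- (1 + alpha) / 2]. The factor [2] in [M] passes from [t / 2], below which [s] does not go, to
    [t]. *)
Lemma lattice_source j t a' t0 x0 : 0 < t -> t / 2 <= a' -> t0 <= T ->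
  center_source e nu alpha (w j) (dw j) j (M t) a' t0 t0 (aa t0 x0) x0.
Proof.
case/andP: alpha01 => al0 al1 tp ta t0T s /andP[as_ st].
have sT : 0 < s <= T by apply/andP; split; lra.
case/andP: (sT) => s0 _.
(* Subtracting [g s x0] is invisible to a difference in space and makes the source small near the
   centre. *)
exists (fun z => (aa s z - aa t0 x0) * div s z + (g s z - g s x0)); split.
  by move=> y; rewrite lap_w// /dw /diff; ring.
move=> y; set D := (`|t0 - s| + _).
have D0 : 0 <= D by apply: addr_ge0; [exact: normr_ge0|exact: sqr_ge0].
have -> : D `^ alpha = (D `^ (alpha / 2)) ^+ 2.
  by rewrite -powR_mulrn ?powR_ge0// -powRrM; congr powR; lra.
rewrite -exprMn -[leLHS]real_normK ?num_real//.
have t20 : 0 < t / 2 by lra.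
have M0 : 0 <= M t by rewrite !mulr_ge0 ?powR_ge0// addr_ge0// !mulr_ge0.
apply: lerXn2r; rewrite ?nnegrE ?(mulr_ge0 M0 (powR_ge0 _ _))//.
set m := - (1 + alpha) / 2.
have P2 : (t / 2) `^ m <= 2 * t `^ m := powR_weight alpha01 tp (isT : (0 < 2)%N).
have Db0 : 0 <= D `^ (alpha / 2) by exact: powR_ge0.
have P0 : 0 <= (t / 2) `^ m by exact: powR_ge0.
have E1 : `|(aa s y - aa t0 x0) * div s y| <=
    n%:R * (A * B) * (t / 2) `^ m * D `^ (alpha / 2).
  have -> : m = - alpha / 2 + - 1 / 2 by rewrite /m; lra.
  rewrite powR_add// normrM.
  have sg1 : t / 2 <= s <= T by apply/andP; split; lra.
  have sg2 : t / 2 <= t0 <= T by apply/andP; split; lra.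
  have H1 := aa_holder y x0 t20 sg1 sg2.
  have H2 := div_bound y sT.
  have H3 : s `^ (- 1 / 2) <= (t / 2) `^ (- 1 / 2) by apply: ge_powR; lra.
  apply: le_trans (ler_pM _ _ H1 H2) _ => //.
  rewrite (_ : n%:R * (A * B) * _ * _ = A * (t / 2) `^ (- alpha / 2) * D `^ (alpha / 2) *
    (n%:R * B * (t / 2) `^ (- 1 / 2))); last by ring.
  apply: ler_wpM2l; first by rewrite !mulr_ge0 ?powR_ge0.
  by apply: ler_wpM2l => //; rewrite mulr_ge0.
have E2 : `|g s y - g s x0| <= G * (t / 2) `^ m * D `^ (alpha / 2).
  have H1 := g_holder y x0 sT.
  have sp : 0 < s `^ ((1 + alpha) / 2) by exact: powR_gt0.
  have H2 : `|g s y - g s x0| <= G * nu (y - x0) `^ alpha * s `^ m.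
    by rewrite /m mulNr powRN ler_pdivlMr.
  apply: (le_trans H2).
  have H3 : s `^ m <= (t / 2) `^ m by apply: ge_powR; rewrite /m; lra.
  have H4 : nu (y - x0) `^ alpha <= D `^ (alpha / 2).
    have -> : nu (y - x0) `^ alpha = (nu (y - x0) ^+ 2) `^ (alpha / 2).
      by rewrite -powR_mulrn// -powRrM; congr powR; lra.
    by apply: le_powR; [lra|exact: sqr_ge0|rewrite /D; have := normr_ge0 (t0 - s); lra].
  rewrite -!mulrA; apply: ler_wpM2l => //; rewrite mulrC.
  by apply: ler_pM; rewrite ?powR_ge0.
apply: le_trans (ler_normD _ _) _.
apply: le_trans (lerD E1 E2) _; rewrite -mulrDl; apply: ler_wpM2r => //.
rewrite -mulrDl /M -/m [2 * _]mulrC -[leRHS]mulrA.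
by apply: ler_wpM2l => //; rewrite addr_ge0// !mulr_ge0.
Qed.

Let M0 t : 0 <= M t.
Proof. by rewrite !mulr_ge0 ?powR_ge0// addr_ge0// !mulr_ge0. Qed.

Let Z := A * B + G + K.

Let MZ t : M t + K * t `^ (- (1 + alpha) / 2) <=
  (2 * n%:R + 2) * Z * t `^ (- (1 + alpha) / 2).
Proof.
rewrite /M -mulrDl ler_wpM2r ?powR_ge0// /Z.
have n0 : 0 <= n%:R :> R by [].
have := mulr_ge0 A0 B0; have := mulr_ge0 n0 G0; have := mulr_ge0 n0 K0.
have := mulr_ge0 n0 (mulr_ge0 A0 B0); have := G0; have := K0; lra.
Qed.

Let within t : 0 < t -> forall j t0 y, t0 <= T ->
  {within `[t / 2, t0], continuous (fun s => w j s y)}.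
Proof.
move=> tp j t0 y t0T; apply: continuous_subspaceW (w_cont (y := y)).
by move=> r /=; rewrite !in_itv/= => /andP[r1 r2]; apply/andP; split; lra.
Qed.

Lemma lattice_time_holder j t1 t0 x vs : 0 < t1 -> t1 <= t0 <= T ->
  all (gens e) vs -> (size vs <= 1)%N ->
  `|diffs vs (w j t0) x - diffs vs (w j t1) x| <=
    time_const n alpha cm cp (size vs) * (2 * n%:R + 2) * Z
      * t1 `^ (- (1 + alpha) / 2) * (t0 - t1) `^ holder_exp alpha (size vs).
Proof.
move=> t10 /andP[t10' t0T] vsS vs1.
have he := holder_exp01 alpha01 vs1.
have := @time_holder _ _ _ e nu alpha cm cp alpha01 cm0 cmp nu_ge0 nu0 nu_step
  nu_semiconcave (w j) (dw j) j (M t1) K t1 t0 (aa t0 x) (aa t1 x) x vs t10 t10'.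
move=> H; apply: le_trans (H _ _ _ K0 vsS he _ _ _ _ _) _ => //.
- by apply: aa_bound; apply/andP; split; lra.
- by apply: aa_bound; apply/andP; split; lra.
- by move=> y; exact: within.
- by move=> s y /andP[s0 s1]; apply: w_eq; apply/andP; split; lra.
- by apply: lattice_source => //; lra.
- by apply: lattice_source => //; lra.
- by move=> y; apply: w_bound; apply/andP; split; lra.
apply: ler_wpM2r; first exact: powR_ge0.
apply: le_trans (ler_wpM2l (time_const_ge0 n alpha01 cm0 cmp vs1) (MZ t1)) _.
by rewrite !mulrA.
Qed.

Lemma lattice_space_holder i j t x p : 0 < t <= T ->
  all (gens e) p ->
  `|diff (e i) (w j t) x - diff (e i) (w j t) (x + \sum_(u <- p) u)| <=
    (space_const n alpha cm cp * (2 * n%:R + 2) + 4) * (Z + B)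
      * t `^ (- (1 + alpha) / 2) * (size p)%:R `^ alpha.
Proof.
case/andP: alpha01 => al0 al1.
move=> tT pS; case/andP: (tT) => t0 t0T.
have sc0 := space_const_ge0 n alpha01 cm0 cmp.
have Z0 : 0 <= Z by rewrite !addr_ge0// mulr_ge0.
have W0 : 0 <= t `^ (- (1 + alpha) / 2) by exact: powR_ge0.
have [/size0nil->|p0] := eqVneq (size p) 0%N.
  rewrite big_nil addr0 subrr normr0.
  by rewrite !mulr_ge0 ?powR_ge0// addr_ge0// mulr_ge0// addr_ge0// mulr_ge0.
rewrite -lt0n in p0.
set l : R := (size p)%:R; have l1 : 1 <= l by rewrite /l (ler_nat R 1).
have l0 : 0 < l by lra.
have [lt|tl] := leP (4 * l ^+ 2) t.
  have vS : e i \in gens e by apply/gensP; exists i; left.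
  have H := @space_holder _ _ _ e nu alpha cm cp alpha01 cm0 cmp nu_ge0 nu0 nu_step
    nu_semiconcave (w j) (dw j) j (M t) K t (aa t x) (aa t (x + \sum_(u <- p) u))
    x (e i) p t0.
  apply: le_trans (H _ _ _ K0 vS pS p0 lt _ _ _ _ _) _ => //.
  - exact: aa_bound.
  - exact: aa_bound.
  - by move=> y; exact: within.
  - by move=> s y /andP[s0 s1]; apply: w_eq; apply/andP; split; lra.
  - by apply: lattice_source => //; lra.
  - by apply: lattice_source => //; lra.
  - by move=> y; apply: w_bound; apply/andP; split; lra.
  rewrite -/l; apply: ler_wpM2r; first exact: powR_ge0.
  apply: le_trans (ler_wpM2l sc0 (MZ t)) _.
  rewrite !mulrA; apply: ler_wpM2r => //.
  have X0 : 0 <= space_const n alpha cm cp * (2 * n%:R + 2).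
    by rewrite mulr_ge0// addr_ge0// mulr_ge0.
  by have := mulr_ge0 X0 B0; have := B0; lra.
(* The points are now at least of order [sqrt t] apart, and the gradient bound alone suffices. This
   adds [B] to [Z], and [A B + B] is the origin of the factor [A + 1]. *)
have gr y : `|diff (e i) (w j t) y| <= B * t `^ (- 1 / 2).
  rewrite mulNr mul1r powRN powR12_sqrt ?(ltW t0)//.
  by rewrite ler_pdivlMr ?sqrtr_gt0// mulrC; exact: w_grad.
have tl' : t `^ (- 1 / 2) <= 2 * l `^ alpha * t `^ (- (1 + alpha) / 2).
  have -> : - 1 / 2 = alpha / 2 + - (1 + alpha) / 2 by lra.
  rewrite powR_add//; apply: ler_wpM2r => //.
  apply: (@le_trans _ _ ((4 * l ^+ 2) `^ (alpha / 2))); first by apply: le_powR; lra.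
  have -> : 4 * l ^+ 2 = (2 * l) ^+ 2 by ring.
  rewrite -powR_mulrn; last lra.
  rewrite -powRrM (_ : 2%:R * (alpha / 2) = alpha); last lra.
  by rewrite powRM ?(ltW l0)// ler_wpM2r ?powR_ge0//; apply: ler1_powR; lra.
have T2 (a b : R) : `|a - b| <= `|a| + `|b| by rewrite -[`|b|]normrN ler_normD.
apply: le_trans (T2 _ _) _.
apply: le_trans (lerD (gr _) (gr _)) _.
have := ler_wpM2l B0 tl'.
set P := t `^ (- (1 + alpha) / 2) in W0 *; set Q := l `^ alpha.
have Q0 : 0 <= Q by exact: powR_ge0.
have X0 : 0 <= (space_const n alpha cm cp * (2 * n%:R + 2) * (Z + B) + 4 * Z) * P * Q.
  by rewrite !mulr_ge0// addr_ge0// !mulr_ge0// addr_ge0// !mulr_ge0.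
move=> H; rewrite (_ : _ * (Z + B) * P * Q =
 (space_const n alpha cm cp * (2 * n%:R + 2) * (Z + B) + 4 * Z) * P * Q +
   4 * (B * (Q * P))); last by ring.
move: H; rewrite -mulrA; lra.
Qed.

End LatticeSystem.

Lemma powR_inv (R : realType) (x b : R) : 0 <= x -> (x^-1) `^ b = (x `^ b)^-1.
Proof. by move=> x0; rewrite -[x^-1]powR_inv1// -powRrM mulN1r powRN. Qed.

(** * Interpolation between the supremum and a Hoelder bound of the gradient *)

Section Interpolation.
Variables (R : realType) (L : finZmodType).

(** Averaged over [k] steps, the difference telescopes to two values of [f], at most [2 K / k],
    while each shift changes it by at most [H h ^ alpha]. Here [k] is the integer part of [h], and
    [4] absorbs the rounding [h < k + 1 <= 2 k]. For [h < 1] the difference is just two values. *)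
Lemma diff_interpolation (f : L -> R) (v : L) (alpha H K h : R) (x : L) :
  0 < alpha -> 0 <= H -> 0 <= K -> 0 < h -> (forall y, `|f y| <= K) ->
  (forall k : nat, `|diff v f x - diff v f (x + v *+ k)| <= H * k%:R `^ alpha) ->
  `|diff v f x| <= H * h `^ alpha + 4 * K / h.
Proof.
move=> al0 H0 K0 h0 fK fH.
have Hh0 : 0 <= H * h `^ alpha by rewrite mulr_ge0 ?powR_ge0.
have T2 (a b : R) : `|a - b| <= `|a| + `|b| by rewrite -[`|b|]normrN ler_normD.
have f2 y z : `|f y - f z| <= 2 * K.
  by apply: le_trans (T2 _ _) _; have := fK y; have := fK z; lra.
have [h1|h1] := ltP h 1.
  have : 2 * K <= 4 * K / h.
    by rewrite ler_pdivlMr//; nra.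
  by have := f2 (x + v) x; rewrite -/(diff v f x); lra.
pose k := Num.truncn h.
have /andP[kh hk] : k%:R <= h < k.+1%:R by exact: truncn_itv (ltW h0).
have k1 : (0 < k)%N by rewrite truncn_gt0.
have k1R : 1 <= k%:R :> R by rewrite (ler_nat R 1).
have tel : \sum_(j < k) diff v f (x + v *+ j) = f (x + v *+ k) - f x.
  rewrite -(big_mkord xpredT (fun j => diff v f (x + v *+ j))).
  have := telescope_sumr (fun j => f (x + v *+ j)) (leq0n k).
  rewrite mulr0n addr0 => <-.
  by apply: eq_bigr => j _; rewrite /diff mulrSr addrA.
have avg : `|k%:R * diff v f x| <= k%:R * (H * h `^ alpha) + 2 * K.
  have -> : k%:R * diff v f x =
     \sum_(j < k) (diff v f x - diff v f (x + v *+ j)) + (f (x + v *+ k) - f x).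
    by rewrite sumrB tel subrK sumr_const card_ord mulr_natl.
  apply: le_trans (ler_normD _ _) _; apply: lerD => //.
  apply: le_trans (ler_norm_sum _ _ _) _.
  apply: (@le_trans _ _ (\sum_(j < k) H * h `^ alpha)); last first.
    by rewrite sumr_const card_ord -[_ *+ k]mulr_natl.
  apply: ler_sum => j _; apply: (le_trans (fH j)); apply: ler_wpM2l => //.
  apply: le_powR => //; first exact: ltW.
  by apply: le_trans kh; rewrite ler_nat ltnW.
have kp : 0 < k%:R :> R by lra.
rewrite -(ler_pM2l kp) -[in leLHS](gtr0_norm kp) -normrM; apply: (le_trans avg).
rewrite mulrDr lerD2l.
have : 2 * K * h <= 4 * K * k%:R by move: hk; rewrite -natr1; nra.
by rewrite [k%:R * _]mulrA ler_pdivlMr// [k%:R * _]mulrC.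
Qed.

End Interpolation.

Section Absorption.
Variables (R : realType) (L : finZmodType) (n : nat) (e : 'I_n -> L).
Variables (nu : L -> R) (alpha cm cp : R).
Implicit Types (s t : R) (x y : L).
Hypothesis alpha01 : 0 < alpha < 1.
Hypothesis cm0 : 0 < cm.
Hypothesis cmp : cm <= cp.
Hypothesis nu_ge0 : forall y, 0 <= nu y.
Hypothesis nu0 : nu 0 = 0.
Hypothesis nu_step : forall v y, v \in gens e -> nu (y + v) <= nu y + 1.
Hypothesis nu_semiconcave : forall i y,
  nu (y + e i) ^+ 2 + nu (y - e i) ^+ 2 <= 2 * nu y ^+ 2 + 2.

Variables (T A G K : R) (w : 'I_n -> R -> L -> R) (aa g : R -> L -> R).

Hypothesis T0 : 0 < T.
Hypothesis A0 : 0 <= A.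
Hypothesis G0 : 0 <= G.
Hypothesis K0 : 0 <= K.
Hypothesis w_cont : forall j y, {within `]0, T], continuous (fun s => w j s y)}.
Hypothesis w_eq : forall j s y, 0 < s < T ->
  is_derive s 1 (fun r => w j r y)
    (diff (e j) (fun z => aa s z * (\sum_i (w i s z - w i s (z - e i))) + g s z) y).
Hypothesis w_curl : forall i j s y, 0 < s <= T ->
  diff (e i) (w j s) y = diff (e j) (w i s) y.
Hypothesis aa_bound : forall s y, 0 < s <= T -> cm <= aa s y <= cp.
Hypothesis aa_holder : forall (sg : R) s (s' : R) y (y' : L), 0 < sg ->
  sg <= s <= T -> sg <= s' <= T ->
  `|aa s y - aa s' y'| <=
    A * sg `^ (- alpha / 2) * (`|s' - s| + nu (y - y') ^+ 2) `^ (alpha / 2).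
Hypothesis g_holder : forall s y x, 0 < s <= T ->
  `|g s y - g s x| * s `^ ((1 + alpha) / 2) <= G * nu (y - x) `^ alpha.
Hypothesis w_bound : forall j s y, 0 < s <= T -> `|w j s y| <= K.

Definition lattice_space_const : R := space_const n alpha cm cp * (2 * n%:R + 2) + 4.

Lemma lattice_space_const_gt0 : 0 < lattice_space_const.
Proof.
have sc0 := space_const_ge0 n alpha01 cm0 cmp.
have : 0 <= space_const n alpha cm cp * (2 * n%:R + 2).
  by rewrite mulr_ge0// addr_ge0// mulr_ge0.
by rewrite /lattice_space_const; lra.
Qed.

Definition grad_const : R := 1 + 4 * (2 * lattice_space_const) `^ alpha^-1.

Lemma grad_improve B :
  (forall i j s y, 0 < s <= T -> Num.sqrt s * `|diff (e i) (w j s) y| <= B) ->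
  forall i j s y, 0 < s <= T -> Num.sqrt s * `|diff (e i) (w j s) y| <=
    B / 2 + (G / (A + 1) + grad_const * (A + 1) `^ alpha^-1 * K).
Proof.
case/andP: alpha01 => al0 al1.
move=> w_grad i j s y sT; case/andP: (sT) => s0 sT'.
have B0 : 0 <= B by apply: le_trans (w_grad i j s y sT); rewrite mulr_ge0 ?sqrtr_ge0.
have sp := lattice_space_const_gt0; set c := lattice_space_const in sp *.
have Ap : 0 < A + 1 by have := A0; lra.
(* Chosen so that [c * ep * (A + 1) * B] is exactly [B / 2]. *)
pose ep := (2 * c * (A + 1))^-1.
have ep0 : 0 < ep by rewrite invr_gt0 !mulr_gt0.
(* A step proportional to the parabolic scale [sqrt s] gives both terms of the interpolation the
   weight of the left-hand side. *)
pose h := ep `^ alpha^-1 * Num.sqrt s.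
have ss0 : 0 < Num.sqrt s by rewrite sqrtr_gt0.
have h0 : 0 < h by rewrite mulr_gt0// powR_gt0.
set Z := A * B + G + K + B.
have Z0 : 0 <= Z by rewrite !addr_ge0// mulr_ge0.
set P := s `^ (- (1 + alpha) / 2).
have P0 : 0 <= P by exact: powR_ge0.
have H0 : 0 <= c * Z * P by rewrite !mulr_ge0// ltW.
have fH k : `|diff (e i) (w j s) y - diff (e i) (w j s) (y + e i *+ k)| <=
    c * Z * P * k%:R `^ alpha.
  have eS : all (gens e) (nseq k (e i)).
    by apply/allP => u /nseqP[-> _]; apply/gensP; exists i; left.
  have := @lattice_space_holder _ _ _ e nu alpha cm cp alpha01 cm0 cmp nu_ge0 nu0
    nu_step nu_semiconcave T A B G K w aa g A0 B0 G0 K0 w_cont w_eq w_curl aa_bound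
    aa_holder w_grad g_holder w_bound i j s y (nseq k (e i)) sT eS.
  by rewrite size_nseq big_nseq iter_addr_0.
have := diff_interpolation al0 H0 K0 h0 (fun z => w_bound j z sT) fH.
move=> /(ler_wpM2l (ltW ss0)) /le_trans; apply.
have hal : h `^ alpha = ep * s `^ (alpha / 2).
  rewrite powRM ?powR_ge0 ?(ltW ss0)// -powRrM mulVf ?gt_eqF// powRr1 ?(ltW ep0)//.
  by rewrite -powR12_sqrt ?(ltW s0)// -powRrM mulrC [alpha / 2]mulrC mulrC.
rewrite hal mulrDr.
have -> : Num.sqrt s * (c * Z * P * (ep * s `^ (alpha / 2))) = c * ep * Z.
  have -> : Num.sqrt s * (c * Z * P * (ep * s `^ (alpha / 2))) =
     c * ep * Z * (s `^ 2^-1 * P * s `^ (alpha / 2)) by rewrite powR12_sqrt ?(ltW s0)//; ring.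
  rewrite /P -!powR_add//.
  have -> : 2^-1 + - (1 + alpha) / 2 + alpha / 2 = 0 by lra.
  by rewrite powRr0 mulr1.
have -> : Num.sqrt s * (4 * K / h) = 4 * (2 * c) `^ alpha^-1 * (A + 1) `^ alpha^-1 * K.
  have -> : 4 * (2 * c) `^ alpha^-1 * (A + 1) `^ alpha^-1 = 4 * (ep `^ alpha^-1)^-1.
    have c20 : 0 <= 2 * c by lra.
    by rewrite -mulrA -powRM ?(ltW Ap)// /ep powR_inv ?invrK// mulr_ge0// ltW.
  rewrite /h; field; rewrite (gt_eqF ss0) gt_eqF// powR_gt0//.
have -> : c * ep * Z = B / 2 + (G + K) / (A + 1) / 2.
  by rewrite /ep /Z; field; rewrite (gt_eqF sp) (gt_eqF Ap).
have A1 : 1 <= A + 1 by have := A0; lra.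
have E1 : K / (A + 1) <= (A + 1) `^ alpha^-1 * K.
  apply: (@le_trans _ _ K); first by rewrite ler_pdivrMr// ler_peMr.
  rewrite ler_peMl// -[leLHS](powRr0 (A + 1)); apply: ler_powR => //.
  by rewrite invr_ge0 ltW.
have E2 : 0 <= G / (A + 1) by rewrite divr_ge0// ltW.
have E3 : 0 <= K / (A + 1) by rewrite divr_ge0// ltW.
have -> : (G + K) / (A + 1) / 2 = (G / (A + 1)) / 2 + (K / (A + 1)) / 2.
  by field; rewrite gt_eqF.
rewrite /grad_const -/c !mulrDl mul1r; lra.
Qed.

Definition grad_bound : R :=
  2 * (G / (A + 1) + grad_const * (A + 1) `^ alpha^-1 * K).

(* [grad_improve] for the supremum, which is finite because the lattice is. *)
Lemma lattice_grad i j s y : 0 < s <= T ->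
  Num.sqrt s * `|diff (e i) (w j s) y| <= grad_bound.
Proof.
move=> sT.
pose V : set R := [set r | exists i j s y, 0 < s <= T /\
  r = Num.sqrt s * `|diff (e i) (w j s) y|].
have V0 : V (Num.sqrt s * `|diff (e i) (w j s) y|) by exists i, j, s, y.
have Vub : has_ubound V.
  exists (Num.sqrt T * (2 * K)) => _ [i' [j' [s' [y' [s'T ->]]]]].
  case/andP: (s'T) => s0 s1.
  apply: ler_pM; rewrite ?sqrtr_ge0// ?ler_sqrt//; first exact: ltW.
  rewrite /diff; apply: le_trans (ler_normB _ _) _.
  by have := w_bound j' (y' + e i') s'T; have := w_bound j' y' s'T; lra.
have H i' j' s' y' : 0 < s' <= T -> Num.sqrt s' * `|diff (e i') (w j' s') y'| <= sup V.
  by move=> h; apply: ub_le_sup => //; exists i', j', s', y'.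
have : sup V <= sup V / 2 + (G / (A + 1) + grad_const * (A + 1) `^ alpha^-1 * K).
  apply: ge_sup; first by exists (Num.sqrt s * `|diff (e i) (w j s) y|).
  by move=> _ [i' [j' [s' [y' [s'T ->]]]]]; exact: (grad_improve H).
by have := H i j s y sT; rewrite /grad_bound; lra.
Qed.

End Absorption.

(** * The discrete torus *)

Section Torus.
Variables (R : realType) (n m : nat).
Local Notation N := (m.+1).
Local Notation L := ('rV['I_N]_n).
Implicit Types (x k d : 'rV[int]_n) (y v : L) (i j : 'I_n).

(** Reduction modulo [N] as an integer multiple of the class of one: additivity is that of
    multiples, and [N = 1], where this class is zero, is included. *)
Definition red x : L := \row_i ((inZp 1 : 'I_N) *~ x ord0 i).

Definition lift y : 'rV[int]_n := \row_i (nat_of_ord (y ord0 i))%:Z.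

Definition basis i : 'rV[int]_n := delta_mx ord0 i.

Definition dir i : L := red (basis i).

Lemma redD x x' : red (x + x') = red x + red x'.
Proof. by apply/rowP => i; rewrite !mxE mulrzDr. Qed.

Lemma redN x : red (- x) = - red x.
Proof. by apply/rowP => i; rewrite !mxE mulrNz. Qed.

Lemma redB x x' : red (x - x') = red x - red x'.
Proof. by rewrite redD redN. Qed.

Lemma inZp1_muln (k : nat) : (inZp 1 : 'I_N) *+ k = inZp k.
Proof. by rewrite Zp_mulrn; apply: val_inj; rewrite /= modnMml mul1n. Qed.

Lemma lift_red y : red (lift y) = y.
Proof.
by apply/rowP => i; rewrite !mxE -pmulrn inZp1_muln valZpK.
Qed.

Lemma red_eq x x' : red x = red x' -> exists k, x = x' + N%:Z *: k.
Proof.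
move=> E; exists (\row_i ((x ord0 i - x' ord0 i) %/ N%:Z)%Z).
apply/rowP => i; rewrite !mxE mulrC.
have : (inZp 1 : 'I_N) *~ (x ord0 i - x' ord0 i) = 0.
  move/rowP: E => /(_ i); rewrite !mxE => E.
  by rewrite mulrzBr E subrr.
set d := x ord0 i - x' ord0 i => d0.
have : (d %% N%:Z)%Z = 0.
  have := divz_eq d N%:Z.
  have := modz_ge0 d (isT : N%:Z != 0); have := ltz_pmod d (isT : 0 < N%:Z).
  case: (d %% N%:Z)%Z => [r|//] rN _ dE.
  move: d0; rewrite dE mulrzDr [(_ * N%:Z)]mulrC mulrzA -!pmulrn inZp1_muln.
  have -> : inZp N = 0 :> 'I_N by apply: val_inj; rewrite /= modnn.
  rewrite mul0rz add0r inZp1_muln => /(congr1 val)/=.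
  by rewrite modn_small// => ->.
by move=> /dvdz_mod0P/divzK ->; rewrite /d addrC subrK.
Qed.

(** Valued in [nat] so that [ex_minn] can select a shortest representative. *)
Definition sqn x : nat := (\sum_i `|x ord0 i| ^ 2)%N.

Lemma sqnE x : (sqn x)%:R = \sum_i (x ord0 i)%:~R ^+ 2 :> R.
Proof.
rewrite /sqn natr_sum; apply: eq_bigr => i _.
by rewrite natrX natr_absz intr_norm real_normK ?num_real.
Qed.

Let nuP y : exists k : nat, `[< exists x, red x = y /\ sqn x = k >].
Proof. by exists (sqn (lift y)); apply/asboolP; exists (lift y); rewrite lift_red. Qed.

(* Length of the shortest integer vector representing [y]. *)
Definition nu y : R := Num.sqrt (ex_minn (nuP y))%:R.

Lemma nu_ge0 y : 0 <= nu y. Proof. exact: sqrtr_ge0. Qed.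

Lemma nu_attained y : exists2 x, red x = y & nu y ^+ 2 = \sum_i (x ord0 i)%:~R ^+ 2.
Proof.
rewrite /nu sqr_sqrtr//; case: ex_minnP => k /asboolP[x [xy <-]] _.
by exists x; rewrite ?sqnE.
Qed.

Lemma nu_le x : nu (red x) ^+ 2 <= \sum_i (x ord0 i)%:~R ^+ 2.
Proof.
rewrite /nu sqr_sqrtr// -sqnE ler_nat; case: ex_minnP => k _ -> //.
by apply/asboolP; exists x.
Qed.

Lemma nu0 : nu 0 = 0.
Proof.
apply/eqP; rewrite -sqrf_eq0 eq_le sqr_ge0 andbT.
have -> : (0 : L) = red 0 by apply/rowP => i; rewrite !mxE mulr0z.
by apply: le_trans (nu_le 0) _; rewrite big1// => i _; rewrite mxE mulr0z expr0n.
Qed.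

Lemma sum_sqr_basis x i (s : int) : s ^+ 2 = 1 ->
  \sum_j ((x + s *: basis i) ord0 j)%:~R ^+ 2 =
  \sum_j (x ord0 j)%:~R ^+ 2 + 2 * s%:~R * (x ord0 i)%:~R + 1 :> R.
Proof.
move=> s1; rewrite (bigD1 i)//= [in RHS](bigD1 i)//=.
rewrite [X in _ + X](eq_bigr (fun j => (x ord0 j)%:~R ^+ 2)); last first.
  by move=> j ji; rewrite !mxE (negbTE ji) andbF mulr0 addr0.
have : (s%:~R : R) ^+ 2 = 1 by rewrite -rmorphXn/= s1.
by rewrite !mxE !eqxx mulr1 rmorphD/=; set S : R := \sum_(_ | _) _; lra.
Qed.

Lemma redZN i (s : int) : s ^+ 2 = 1 -> red (s *: basis i) = if s == 1 then dir i else - dir i.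
Proof.
move=> /eqP; rewrite sqrf_eq1 => /orP[]/eqP ->; first by rewrite scale1r eqxx.
by rewrite scaleN1r redN.
Qed.

(** Moving a shortest representative of [y] by a unit vector gives squared length at most
    [(nu y + 1)^2], as each coordinate is bounded by the length. *)
Lemma nu_step v y : v \in gens dir -> nu (y + v) <= nu y + 1.
Proof.
move=> /gensP[i vE].
have [s s1 ->] : exists2 s : int, s ^+ 2 = 1 & v = red (s *: basis i).
  by case: vE => ->; [exists 1|exists (-1)]; rewrite ?redZN//= ?sqrrN ?expr1n.
have [x <- nx] := nu_attained y.
rewrite -redD; have := nu_le (x + s *: basis i); rewrite sum_sqr_basis// -nx.
have n0 := nu_ge0 (red x); have n1 := nu_ge0 (red (x + s *: basis i)).
have : `|(x ord0 i)%:~R : R| <= nu (red x).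
  rewrite -(@ler_pXn2r _ 2) ?nnegrE// real_normK ?num_real// nx (bigD1 i)//=.
  by rewrite lerDl sumr_ge0// => j _; exact: sqr_ge0.
set a : R := (x ord0 i)%:~R; rewrite ler_norml => /andP[a1 a2].
have : s%:~R * a <= nu (red x).
  move/eqP: s1; rewrite sqrf_eq1 => /orP[]/eqP ->; first by rewrite mul1r.
  by rewrite mulrNz mulN1r; lra.
move=> H1 H2; rewrite -(@ler_pXn2r _ 2) ?nnegrE//; last lra.
by apply: (le_trans H2); rewrite -mulrA; lra.
Qed.

(** The parallelogram identity for a shortest representative of [y]; on the left, minimality can
    only lower the lengths. *)
Lemma nu_semiconcave i y :
  nu (y + dir i) ^+ 2 + nu (y - dir i) ^+ 2 <= 2 * nu y ^+ 2 + 2.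
Proof.
have [x <- nx] := nu_attained y.
have := nu_le (x + 1 *: basis i); rewrite sum_sqr_basis// -nx redD redZN// eqxx => H1.
have := nu_le (x + (-1) *: basis i); rewrite sum_sqr_basis ?sqrrN ?expr1n// -nx.
rewrite redD redZN ?sqrrN ?expr1n//= => H2.
by move: H1 H2; rewrite mulrNz mulr1z; lra.
Qed.

Lemma nu_diam y : nu y <= n%:R * N%:R.
Proof.
have := nu_le (lift y); rewrite lift_red => H.
rewrite -(@ler_pXn2r _ 2) ?nnegrE ?nu_ge0 ?mulr_ge0//.
apply: (le_trans H); apply: (@le_trans _ _ (\sum_(i < n) N%:R ^+ 2)).
  apply: ler_sum => i _; rewrite mxE -pmulrn lerXn2r ?nnegrE// ler_nat.
  exact/ltnW/ltn_ord.
rewrite sumr_const card_ord -[_ *+ n]mulr_natl exprMn ler_wpM2r ?sqr_ge0//.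
case: n => [|n']; first by rewrite expr0n.
by rewrite expr2 ler_peMr// (ler_nat R 1).
Qed.

Lemma lattice_path d : exists p : seq L,
  [/\ all (gens dir) p, \sum_(u <- p) u = red d &
      size p = (\sum_i `|d ord0 i|)%N].
Proof.
pose sg i := if 0 <= d ord0 i then dir i else - dir i.
pose pp i := nseq `|d ord0 i|%N (sg i).
exists (flatten (map pp (index_enum 'I_n))); split.
- apply/allP => u /flattenP[s /mapP[i _ ->]] /nseqP[-> _].
  by apply/gensP; exists i; rewrite /sg; case: ifP; [left|right].
- rewrite big_flatten big_map.
  have r0 : red 0 = 0 by apply/rowP => i; rewrite !mxE mulr0z.
  rewrite [in RHS](row_sum_delta d) (big_morph red redD r0).
  apply: eq_bigr => i _; rewrite big_nseq iter_addr_0 /sg.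
  have -> : red (d ord0 i *: basis i) = dir i *~ d ord0 i.
    apply/rowP => j; case: (d ord0 i) => k.
      by rewrite -pmulrn mulmxnE !mxE mulrC mulrzA pmulrn.
    rewrite NegzE mulrNz -pmulrn [in RHS]mxE mulmxnE !mxE.
    by rewrite mulNr mulrNz mulrC mulrzA pmulrn.
  case: ifP => z0; first by rewrite pmulrn gez0_abs.
  by rewrite mulNrn pmulrn ltz0_abs ?ltNge ?z0// mulrNz opprK.
- rewrite size_flatten /shape -map_comp sumnE big_map.
  by apply: eq_bigr => i _; rewrite /= size_nseq.
Qed.

End Torus.

Lemma within_continuous_precomp (R : realType) (f h : R -> R) (A D : set R) :
  continuous h -> (forall s, D s -> A (h s)) ->
  {within A, continuous f} -> {within D, continuous (f \o h)}.
Proof.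
move=> ch DA /subspace_continuousP cf; apply/subspace_continuousP => x Dx.
apply: cvg_comp (cf _ (DA _ Dx)) => P /= wP.
apply: (@filterS _ (nbhs x) _ _ _ _ (ch x _ wP)) => s /= AP Ds.
by apply: AP; exact: DA.
Qed.

(** * From the torus to the mesh-one lattice *)

Section Bridge.
Variables (R : realType) (n m : nat).
Local Notation N := (m.+1).
Local Notation L := ('rV['I_N]_n).
Local Notation NR := (N%:R : R).
Implicit Types (x d k : 'rV[int]_n) (y v : L) (i j : 'I_n) (t s : R).
Implicit Types (F : R * 'rV[R]_n -> R) (X Y : R * 'rV[R]_n).

Definition pos x : 'rV[R]_n := NR^-1 *: intvec R x.

(* The lattice has mesh one after multiplying space by [N] and time by [N^2]. *)
Definition samp F s y : R := F ((NR ^+ 2)^-1 * s, pos (lift y)).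

Let N0 : 0 < NR. Proof. by []. Qed.
Let Nn0 : NR != 0. Proof. by []. Qed.

Lemma intvecD x x' : intvec R (x + x') = intvec R x + intvec R x'.
Proof. by apply/rowP => i; rewrite !mxE rmorphD. Qed.

Lemma intvecN x : intvec R (- x) = - intvec R x.
Proof. by apply/rowP => i; rewrite !mxE rmorphN. Qed.

Lemma unitvecE i : unitvec R i = intvec R (basis i).
Proof. by apply/rowP => j; rewrite !mxE; case: (_ && _). Qed.

Lemma posD x x' : pos (x + x') = pos x + pos x'.
Proof. by rewrite /pos intvecD scalerDr. Qed.

Lemma posN x : pos (- x) = - pos x.
Proof. by rewrite /pos intvecN scalerN. Qed.

Lemma posMN k : pos (N%:Z *: k) = intvec R k.
Proof. by apply/rowP => i; rewrite !mxE rmorphM/= -pmulrn mulKf. Qed.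

Lemma enorm_pos x : enorm (pos x) = NR^-1 * Num.sqrt (\sum_i (x ord0 i)%:~R ^+ 2).
Proof.
rewrite /enorm -[NR^-1 in RHS]ger0_norm ?invr_ge0// -sqrtr_sqr -sqrtrM ?sqr_ge0//.
by rewrite mulr_sumr; congr (Num.sqrt _); apply: eq_bigr => i _; rewrite !mxE exprMn.
Qed.

Lemma torus_dist_has_lbound (z z' : 'rV[R]_n) :
  has_lbound [set enorm (z - z' + intvec R k) | k in [set: 'rV[int]_n]].
Proof. by exists 0 => _ [k _ <-]; exact: sqrtr_ge0. Qed.

Lemma torus_dist_lt (z z' : 'rV[R]_n) (r : R) : torus_dist z z' < r ->
  exists k, enorm (z - z' + intvec R k) < r.
Proof.
move=> /inf_lt[]; first by exists (enorm (z - z' + intvec R 0)); exists 0.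
by move=> _ [k _ <-] kr; exists k.
Qed.

Lemma torus_dist_pos x x' : torus_dist (pos x) (pos x') <= NR^-1 * nu R (red m (x - x')).
Proof.
have [d dE dn] := nu_attained R (red m (x - x')).
have [k xE] := red_eq (esym dE).
apply: (@le_trans _ _ (enorm (pos x - pos x' + intvec R (- k)))).
  by apply: ge_inf; [exact: torus_dist_has_lbound|exists (- k)].
have -> : pos x - pos x' + intvec R (- k) = pos d.
  by rewrite -posMN -posN -!posD xE scalerN addrK.
by rewrite enorm_pos -dn sqrtr_sqr ger0_norm ?nu_ge0.
Qed.

(** The squared length of a lattice displacement is [N^-2] times a natural number, which vanishes
    once it is below one. Hence [pdist] is positive at distinct lattice points. *)
Lemma torus_eq_of_close x x' : torus_dist (pos x) (pos x') < NR^-1 ->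
  torus_eq (pos x) (pos x').
Proof.
move=> /torus_dist_lt[k]; rewrite -posMN -posN -!posD enorm_pos.
rewrite -[ltRHS]mulr1 ltr_pM2l ?invr_gt0// -[ltRHS]sqrtr1 ltr_sqrt// -sqnE (ltr_nat R _ 1).
rewrite ltnS leqn0 sum_nat_eq0 => /forallP d0; exists (- k).
have E : x - x' + N%:Z *: k = 0.
  by apply/rowP => i; have := d0 i; rewrite /= expn_eq0 absz_eq0 andbT => /eqP ->; rewrite mxE.
have -> : x = x' + N%:Z *: (- k).
  by rewrite scalerN; apply/eqP; rewrite -subr_eq0 opprD opprK addrA E.
by rewrite posD posMN.
Qed.

Variables (T : R).

Lemma OmegaN_pos t x : 0 <= t <= T -> OmegaN T N (t, pos x).
Proof. by move=> tT; split => //; exists x. Qed.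

Lemma OmegaNP X : OmegaN T N X -> exists2 x, X = (X.1, pos x) & 0 <= X.1 <= T.
Proof. by case: X => t z [/= tT [x ->]]; exists x. Qed.

Lemma samp_red F t x : lattice_function T N F -> 0 <= t <= T ->
  F (t, pos x) = samp F (NR ^+ 2 * t) (red m x).
Proof.
move=> perF tT; rewrite /samp mulKf ?expf_neq0//.
have [k kE] := red_eq (esym (lift_red (red m x))).
by rewrite {1}kE posD posMN (perF (t, _) _ (OmegaN_pos _ tT)).
Qed.

Lemma nabla_pos F t x (d : 'rV[int]_n) :
  nabla N (intvec R d) F (t, pos x) = NR * (F (t, pos (x + d)) - F (t, pos x)).
Proof. by rewrite /nabla/= posD. Qed.

Lemma nabla_samp F t x i : lattice_function T N F -> 0 <= t <= T ->
  nabla N (unitvec R i) F (t, pos x) =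
    NR * diff (dir m i) (samp F (NR ^+ 2 * t)) (red m x).
Proof. by move=> pF tT; rewrite unitvecE nabla_pos !samp_red// redD. Qed.

Lemma nabla_star_samp F t x i : lattice_function T N F -> 0 <= t <= T ->
  nabla_star N (unitvec R i) F (t, pos x) =
    NR * (samp F (NR ^+ 2 * t) (red m x - dir m i) - samp F (NR ^+ 2 * t) (red m x)).
Proof.
by move=> pF tT; rewrite /nabla_star unitvecE -intvecN nabla_pos !samp_red// redB.
Qed.

Lemma lattice_function_nabla F i : lattice_function T N F ->
  lattice_function T N (nabla N (unitvec R i) F).
Proof.
move=> pF X k XO; have [x -> tT] := OmegaNP XO.
rewrite /nabla /= unitvecE addrAC.
rewrite (pF (_, pos x) _ (OmegaN_pos _ tT)) -/(pos (basis i)) -posD.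
by rewrite (pF (_, pos (x + _)) _ (OmegaN_pos _ tT)).
Qed.

End Bridge.

(** * Polylinear interpolation *)

Section Polylinear.
Variables (R : realType) (n m : nat).
Local Notation N := (m.+1).
Local Notation NR := (N%:R : R).
(* [frac] alone now denotes MathComp's projection to a field of fractions. *)
Local Notation frac := Defs.frac.
Local Notation corner := {ffun 'I_n -> bool}.
Implicit Types (z y : 'rV[R]_n) (x k : 'rV[int]_n) (i j l : 'I_n) (v : corner).
Implicit Types (f : 'rV[int]_n -> R).

Let N0 : 0 < NR. Proof. by []. Qed.

Definition cell z v : 'rV[int]_n :=
  \row_i (Num.floor (NR * z ord0 i) + (v i : nat)%:Z).

Definition weight z v : R := \prod_i vartheta N (v i) (z ord0 i).

Definition polylinear f z : R := \sum_v weight z v * f (cell z v).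

Lemma interpE F (t : R) z :
  interp N F (t, z) = polylinear (fun x => F (t, pos R m x)) z.
Proof.
apply: eq_bigr => v _; congr (_ * F (t, _ *: _)).
by apply/rowP => i; rewrite !mxE rmorphD.
Qed.

Lemma frac01 (b : R) : 0 <= frac b < 1.
Proof.
rewrite /frac subr_ge0 floor_le/= ltrBlDr addrC.
by have := floorD1_gt b; rewrite rmorphD/= rmorph1.
Qed.

Lemma vartheta_ge0 (c : bool) (b : R) : 0 <= vartheta N c b.
Proof. by have /andP[] := frac01 (NR * b); rewrite /vartheta; case: c; lra. Qed.

Lemma varthetaD (b : R) (c : bool) : vartheta N c b + vartheta N (~~ c) b = 1.
Proof. by rewrite /vartheta; case: c => /=; lra. Qed.

Lemma weight_ge0 z v : 0 <= weight z v.
Proof. by apply: prodr_ge0 => i _; exact: vartheta_ge0. Qed.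

Lemma sum_weight z : \sum_v weight z v = 1.
Proof.
rewrite /weight -(bigA_distr_bigA (fun i c => vartheta N c (z ord0 i))).
rewrite big1// => i _; rewrite (bigD1 true)//= (bigD1 false)//= big1.
  by rewrite addr0 (varthetaD _ true).
by case.
Qed.

Lemma frac_addint (b : R) (c : int) : frac (b + c%:~R) = frac b.
Proof. by rewrite /frac floorDrz ?intr_int// rmorphD/= intrKfloor; lra. Qed.

Lemma floor_addint (b : R) (c : int) : Num.floor (b + c%:~R) = Num.floor b + c.
Proof. by rewrite floorDrz ?intr_int// intrKfloor. Qed.

Lemma polylinear_translate f z k :
  polylinear f (z + pos R m k) = polylinear (fun x => f (x + k)) z.
Proof.
have E i : NR * (z + pos R m k) ord0 i = NR * z ord0 i + (k ord0 i)%:~R.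
  by rewrite !mxE mulrDr mulVKf.
apply: eq_bigr => v _; congr (_ * f _).
  by apply: eq_bigr => i _; rewrite /vartheta E frac_addint.
by apply/rowP => i; rewrite [LHS]mxE E floor_addint !mxE addrAC.
Qed.

(** Interpolation commutes with lattice differences, so only the interpolation of the lattice
    gradient has to be estimated. *)
Lemma nabla_interp F (t : R) z i :
  nabla N (unitvec R i) (interp N F) (t, z) =
  polylinear (fun x => nabla N (unitvec R i) F (t, pos R m x)) z.
Proof.
rewrite {1}/nabla/= unitvecE -/(pos R m (basis i)) !interpE polylinear_translate.
rewrite -sumrB mulr_sumr; apply: eq_bigr => v _.
by rewrite nabla_pos; ring.
Qed.

Lemma polylinear_close f g z (E : R) : (forall x, `|f x - g x| <= E) ->
  `|polylinear f z - polylinear g z| <= E.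
Proof.
move=> fg; rewrite -sumrB; apply: le_trans (ler_norm_sum _ _ _) _.
rewrite -[leRHS]mul1r -(sum_weight z) mulr_suml; apply: ler_sum => v _.
by rewrite -mulrBr normrM (ger0_norm (weight_ge0 _ _)) ler_wpM2l ?weight_ge0.
Qed.

Lemma polylinear_const (c : R) z : polylinear (fun=> c) z = c.
Proof. by rewrite /polylinear -mulr_suml sum_weight mul1r. Qed.

Lemma polylinear_far f z y (E : R) :
  (forall v v', `|f (cell z v) - f (cell y v')| <= E) ->
  `|polylinear f z - polylinear f y| <= E.
Proof.
move=> fE.
have H v : `|f (cell z v) - polylinear f y| <= E.
  rewrite -{1}(polylinear_const (f (cell z v)) y) /polylinear -sumrB.
  apply: le_trans (ler_norm_sum _ _ _) _.
  rewrite -[leRHS]mul1r -(sum_weight y) mulr_suml; apply: ler_sum => v' _.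
  by rewrite -mulrBr normrM (ger0_norm (weight_ge0 _ _)) ler_wpM2l ?weight_ge0.
rewrite -(polylinear_const (polylinear f y) z) /polylinear -sumrB.
apply: le_trans (ler_norm_sum _ _ _) _.
rewrite -[leRHS]mul1r -(sum_weight z) mulr_suml; apply: ler_sum => v _.
by rewrite -mulrBr normrM (ger0_norm (weight_ge0 _ _)) ler_wpM2l ?weight_ge0.
Qed.

Lemma piecewise_affine_lipschitz (c : int -> R) (D b b' : R) : 0 <= D ->
  (forall k : int, `|c (k + 1) - c k| <= D) -> `|b - b'| < 1 ->
  `|((1 - frac b) * c (Num.floor b) + frac b * c (Num.floor b + 1)) -
    ((1 - frac b') * c (Num.floor b') + frac b' * c (Num.floor b' + 1))|
  <= `|b - b'| * D.
Proof.
move=> D0 cD; wlog bb : b b' / b' <= b.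
  move=> W h; have [bb|/ltW bb] := leP b' b; first exact: W.
  by rewrite distrC [`|b - b'|]distrC; apply: W => //; rewrite distrC.
rewrite (ger0_norm (_ : 0 <= b - b')) ?subr_ge0// => b1.
have /andP[f0 f1] := frac01 b; have /andP[g0 g1] := frac01 b'.
have bE : b = (Num.floor b)%:~R + frac b by rewrite /frac addrC subrK.
have bE' : b' = (Num.floor b')%:~R + frac b' by rewrite /frac addrC subrK.
set u := frac b in bE f0 f1 *; set v := frac b' in bE' g0 g1 *.
set p := Num.floor b in bE *; set q := Num.floor b' in bE' *.
have qp : q <= p by exact: le_floor.
have pq : p <= q + 1.
  have : p%:~R < (q + 2)%:~R :> R by rewrite rmorphD/=; lra.
  by rewrite ltr_int -ltzD1 -addrA.
have := cD q; have := cD p.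
have [pE|pq'] := eqVneq p q.
  rewrite pE in bE * => _ cq.
  rewrite (_ : _ - _ = (b - b') * (c (q + 1) - c q)); last by rewrite bE bE'; ring.
  by rewrite normrM (ger0_norm (_ : 0 <= b - b')) ?subr_ge0// ler_wpM2l ?subr_ge0.
have pE : p = q + 1.
  by apply/eqP; rewrite eq_le pq /= lezD1 lt_neqAle eq_sym pq'.
rewrite pE in bE * => cp cq.
(* The node [q + 1] cuts the increment into two affine pieces, of lengths [u] and [1 - v]. *)
rewrite (_ : _ - _ = u * (c (q + 1 + 1) - c (q + 1)) +
  (1 - v) * (c (q + 1) - c q)); last by ring.
apply: le_trans (ler_normD _ _) _; rewrite !normrM (ger0_norm f0).
rewrite (ger0_norm (_ : 0 <= 1 - v)); last lra.
have -> : b - b' = u + (1 - v) by rewrite bE bE' rmorphD/=; lra.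
rewrite [leRHS]mulrDl lerD// ler_wpM2l//; lra.
Qed.

Definition flip i v : corner := [ffun j => if j == i then ~~ v j else v j].

Lemma flipK i : involutive (flip i).
Proof. by move=> v; apply/ffunP => j; rewrite !ffunE; case: (j == i); rewrite ?negbK. Qed.

(* Pairing each corner with its neighbour across direction [i] exhibits a
   one-dimensional interpolation in that direction. *)
Lemma sum_flip i (F : corner -> R) : \sum_v F v = 2^-1 * \sum_v (F v + F (flip i v)).
Proof.
rewrite big_split/= -(reindex_inj (inv_inj (flipK i)) (P := xpredT) (F := F)).
by lra.
Qed.

Lemma polylinear_lipschitz1 f z y i (D : R) : 0 <= D ->
  (forall x, `|f (x + basis i) - f x| <= D) ->
  (forall j, j != i -> z ord0 j = y ord0 j) -> `|NR * z ord0 i - NR * y ord0 i| < 1 ->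
  `|polylinear f z - polylinear f y| <= `|NR * z ord0 i - NR * y ord0 i| * D.
Proof.
move=> D0 fD zy zy1.
pose W v := \prod_(j | j != i) vartheta N (v j) (z ord0 j).
have W0 v : 0 <= W v by apply: prodr_ge0 => j _; exact: vartheta_ge0.
have WE v : weight z v = vartheta N (v i) (z ord0 i) * W v.
  by rewrite /weight (bigD1 i).
have WE' v : weight y v = vartheta N (v i) (y ord0 i) * W v.
  by rewrite /weight (bigD1 i)//=; congr (_ * _); apply: eq_bigr => j /zy ->.
have Wf v : W (flip i v) = W v.
  by apply: eq_bigr => j ji; rewrite ffunE (negbTE ji).
(* [W] does not see [v i], so every corner of the face is counted twice; the [2^-1] of [sum_flip]
   compensates. *)
have SW : \sum_v W v = 2.
  have := sum_weight z; rewrite (sum_flip i).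
  rewrite (eq_bigr W); first by lra.
  move=> v _; rewrite !WE Wf -mulrDl ffunE eqxx.
  by rewrite varthetaD mul1r.
pose c v (k : int) := f (\row_j if j == i then k else cell z v ord0 j).
pose h v (b : R) := (1 - frac b) * c v (Num.floor b) + frac b * c v (Num.floor b + 1).
have key (u : 'rV[R]_n) v : (forall j, j != i -> u ord0 j = z ord0 j) ->
    vartheta N (v i) (u ord0 i) * f (cell u v) +
    vartheta N (~~ v i) (u ord0 i) * f (cell u (flip i v)) = h v (NR * u ord0 i).
  move=> uz.
  have cE (v' : corner) : (forall j, j != i -> v' j = v j) ->
      f (cell u v') = c v (Num.floor (NR * u ord0 i) + (v' i : nat)%:Z).
    move=> vv; congr f; apply/rowP => j; rewrite !mxE.
    by have [->//|ji] := eqVneq j i; rewrite uz// vv.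
  have vE j : j != i -> flip i v j = v j by move=> ji; rewrite ffunE (negbTE ji).
  rewrite (cE v (fun _ _ => erefl)) (cE (flip i v) vE).
  by rewrite /h /vartheta !ffunE eqxx; case: (v i) => /=; rewrite addr0// addrC.
rewrite /polylinear (sum_flip i (fun v => weight z v * _))
  (sum_flip i (fun v => weight y v * _)) -mulrBr normrM ger0_norm ?invr_ge0// -sumrB.
apply: (@le_trans _ _
  (2^-1 * \sum_v W v * (`|NR * z ord0 i - NR * y ord0 i| * D))); last first.
  by rewrite -mulr_suml SW mulrA mulVf ?mul1r.
rewrite ler_wpM2l ?invr_ge0//; apply: le_trans (ler_norm_sum _ _ _) _.
apply: ler_sum => v _.
have fi : flip i v i = ~~ v i by rewrite ffunE eqxx.
rewrite !WE !WE' Wf fi.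
rewrite (_ : _ - _ = W v * (h v (NR * z ord0 i) - h v (NR * y ord0 i))); last first.
  rewrite -(key z)// -(key y); last by move=> j /zy.
  by ring.
rewrite normrM (ger0_norm (W0 v)) ler_wpM2l//.
apply: piecewise_affine_lipschitz => // k; rewrite /c.
rewrite (_ : (\row_j if j == i then k + 1 else _) =
  (\row_j if j == i then k else cell z v ord0 j) + basis i)//.
apply/rowP => j; rewrite !mxE eqxx /=.
by have [_|_] := eqVneq j i; rewrite ?addr0.
Qed.

Lemma polylinear_near f z y (D r : R) : 0 <= D ->
  (forall x i, `|f (x + basis i) - f x| <= D) ->
  (forall i, `|NR * z ord0 i - NR * y ord0 i| <= r) -> r < 1 ->
  `|polylinear f z - polylinear f y| <= n%:R * (r * D).
Proof.
move=> D0 fD zy r1.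
pose mix (p : nat) : 'rV[R]_n := \row_j if (j < p)%N then z ord0 j else y ord0 j.
have m0 : mix 0%N = y by apply/rowP => j; rewrite mxE.
have mn : mix n = z by apply/rowP => j; rewrite mxE ltn_ord.
suff H p : (p <= n)%N -> `|polylinear f (mix p) - polylinear f y| <= p%:R * (r * D).
  by have := H n (leqnn n); rewrite mn.
elim: p => [|p IH] pn; first by rewrite m0 subrr normr0 mul0r.
have S : `|polylinear f (mix p.+1) - polylinear f (mix p)| <= r * D.
  pose i := Ordinal pn.
  have i1 : mix p.+1 ord0 i = z ord0 i by rewrite mxE /= ltnSn.
  have i0 : mix p ord0 i = y ord0 i by rewrite mxE /= ltnn.
  apply: (@le_trans _ _ (`|NR * mix p.+1 ord0 i - NR * mix p ord0 i| * D)).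
    apply: polylinear_lipschitz1 => //.
      move=> j ji; rewrite !mxE ltnS leq_eqVlt.
      suff -> : (j == p :> nat) = false by [].
      by apply: negbTE; apply: contra ji => /eqP jp; apply/eqP/val_inj.
    by rewrite i1 i0; exact: le_lt_trans r1.
  by rewrite i1 i0 ler_wpM2r.
rewrite -(subrKA (polylinear f (mix p))); apply: le_trans (ler_normD _ _) _.
rewrite -natr1 mulrDl mul1r [leRHS]addrC; apply: lerD => //.
exact: IH (ltnW pn).
Qed.

Lemma floor_dist (a b : R) : `|(Num.floor a)%:~R - (Num.floor b)%:~R| <= `|a - b| + 1.
Proof.
have /andP[f0 f1] := frac01 a; have /andP[g0 g1] := frac01 b.
rewrite /frac in f0 f1 g0 g1.
by have := ler_norm (a - b); have := ler_norm (b - a); rewrite [`|b - a|]distrC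
  ler_norml => H1 H2; apply/andP; split; lra.
Qed.

Lemma polylinear_holder f z y (H al r : R) : 0 < al < 1 -> 0 <= H -> 0 < r ->
  (forall x x', `|f x - f x'| <=
    H * (NR^-1 * (\sum_l absz ((x' - x)%R ord0 l))%:R) `^ al) ->
  (forall i, `|z ord0 i - y ord0 i| <= 2 * r) ->
  `|polylinear f z - polylinear f y| <= (6 * n%:R + 1) * H * r `^ al.
Proof.
move=> /andP[al0 al1] H0 r0 fH zy.
have n0 : 0 <= n%:R :> R by [].
have Nzy i : `|NR * z ord0 i - NR * y ord0 i| <= 2 * (NR * r).
  by rewrite -mulrBr normrM ger0_norm// mulrCA ler_wpM2l.
have ra0 : 0 <= r `^ al by exact: powR_ge0.
(* Below mesh scale the Lipschitz bound suffices, because [N r <= (N r) ^ al] there; above it,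
   corner values are compared. *)
have [Nr|Nr] := leP 1 (2 * (NR * r)); last first.
  pose D := H * NR^-1 `^ al.
  have D0 : 0 <= D by rewrite mulr_ge0 ?powR_ge0.
  have fD x i : `|f (x + basis i) - f x| <= D.
    rewrite distrC; apply: (le_trans (fH _ _)).
    rewrite addrC addKr (bigD1 i)//= big1 => [|j ji].
      by rewrite mxE !eqxx mulr1.
    by rewrite mxE (negbTE ji) andbF.
  apply: le_trans (polylinear_near D0 fD Nzy Nr) _.
  have E : NR * r * NR^-1 `^ al <= r `^ al.
    have Nr0 : 0 < NR * r by rewrite mulr_gt0.
    have -> : r `^ al = (NR * r) `^ al * NR^-1 `^ al.
      by rewrite -powRM ?(ltW Nr0) ?invr_ge0//; congr powR; field.
    rewrite ler_wpM2r ?powR_ge0//; apply: ger1_powR; last exact: ltW.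
    by rewrite Nr0 /=; lra.
  have -> : n%:R * (2 * (NR * r) * D) = 2 * n%:R * H * (NR * r * NR^-1 `^ al).
    by rewrite /D; ring.
  apply: (@le_trans _ _ (2 * n%:R * H * r `^ al)).
    by rewrite ler_wpM2l// !mulr_ge0.
  by rewrite !ler_wpM2r//; lra.
apply: polylinear_far => v v'; apply: (le_trans (fH _ _)).
(* Per coordinate the corners differ by at most [2 N r], plus one for the integer parts and one for
   the corner bits; [1 <= 2 N r] turns this into [6 N r]. *)
have S : NR^-1 * (\sum_l absz ((cell y v' - cell z v)%R ord0 l))%:R <= 6 * n%:R * r.
  rewrite mulrC ler_pdivrMr// natr_sum.
  apply: (@le_trans _ _ (\sum_(l < n) 6 * (NR * r))); last first.
    rewrite sumr_const card_ord -[_ *+ n]mulr_natl.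
    by rewrite le_eqVlt; apply/orP; left; apply/eqP; ring.
  apply: ler_sum => l _; rewrite natr_absz intr_norm !mxE.
  rewrite rmorphB !rmorphD/=.
  have := floor_dist (NR * y ord0 l) (NR * z ord0 l); have := Nzy l.
  rewrite distrC.
  set p := (Num.floor _)%:~R; set q := (Num.floor _)%:~R; set d := `|_ * _ - _| => d1.
  rewrite !ler_norml => /andP[h1 h2].
  by apply/andP; split; case: (v l); case: (v' l) => /=; lra.
rewrite [6 * n%:R + 1]addrC mulrDl mul1r mulrDl.
apply: (@le_trans _ _ (H * ((6 * n%:R + 1) * r `^ al))); last by lra.
rewrite ler_wpM2l//.
apply: (@le_trans _ _ (((6 * n%:R + 1) * r) `^ al)).
  apply: le_powR; [exact: ltW|by rewrite mulr_ge0|].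
  by apply: (le_trans S); rewrite ler_wpM2r ?(ltW r0)//; lra.
have n6 : 1 <= 6 * n%:R + 1 :> R by lra.
rewrite powRM ?(ltW r0)//.
rewrite ler_wpM2r//; apply: ler1_powR => //; exact: ltW.
Qed.

End Polylinear.

(** * The system on the torus *)

Section System.
Variables (R : realType) (n m : nat) (T alpha cm cp A K Gam : R).
Variables (psi a g : R * 'rV[R]_n -> R).
Local Notation N := (m.+1).
Local Notation L := ('rV['I_N]_n).
Local Notation NR := (N%:R : R).
Implicit Types (x d k : 'rV[int]_n) (y v : L) (i j : 'I_n) (t s : R).

Let xi i := nabla N (unitvec R i) psi.

Hypothesis T0 : 0 < T.
Hypothesis alpha01 : 0 < alpha < 1.
Hypothesis cm0 : 0 < cm.
Hypothesis cmp : cm <= cp.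
Hypothesis A0 : 0 <= A.
Hypothesis K0 : 0 <= K.
Hypothesis Gam0 : 0 <= Gam.
Hypothesis psi_per : lattice_function T N psi.
Hypothesis a_per : lattice_function T N a.
Hypothesis g_per : lattice_function T N g.
Hypothesis psi_sol : solves_system T N a g xi.
Hypothesis a_bound : forall X, OmegaN T N X -> cm <= a X <= cp.
Hypothesis a_holder : (holder_a T N alpha a <= A%:E)%E.
Hypothesis xi_bound : forall i X, OmegaN T N X -> `|xi i X| <= K.
Hypothesis g_bound : forall i X, OmegaN T N X -> `|nabla N (unitvec R i) g X| <= Gam.

Let w i s y := samp (xi i) s y.
Let aa s y := samp a s y.
(** Rescaling time gives [N^-2]. It cancels the two lattice gradients around [a], but only one
    factor [N] comes from the gradient of [g]. *)
Let gg s y := NR^-1 * samp g s y.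
Let kT := NR ^+ 2 * T.
Let e := dir m : 'I_n -> L.

Let N0 : 0 < NR. Proof. by []. Qed.
Let Nn0 : NR != 0. Proof. by []. Qed.
Let kap0 : 0 < NR ^+ 2. Proof. by rewrite exprn_gt0. Qed.

Let scale_time s : 0 < s <= kT -> exists2 t, s = NR ^+ 2 * t & 0 < t <= T.
Proof.
move=> /andP[s0 sT]; exists ((NR ^+ 2)^-1 * s); first by rewrite mulVKf.
by rewrite mulr_gt0 ?invr_gt0//= mulrC ler_pdivrMr// mulrC.
Qed.

Let w_nonneg t : 0 < t <= T -> 0 <= t <= T.
Proof. by move=> /andP[/ltW-> ->]. Qed.

Let xi_per i : lattice_function T N (xi i).
Proof. exact: lattice_function_nabla. Qed.

Let w_diff j s y : 0 < s <= kT -> w j s y = NR * diff (e j) (samp psi s) y.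
Proof.
move=> /scale_time[t -> /w_nonneg tT].
rewrite /w -{1}(lift_red y) -(samp_red (lift y) (xi_per j) tT) /xi.
by rewrite (nabla_samp _ _ psi_per tT) lift_red.
Qed.

Let w_curl i j s y : 0 < s <= kT -> diff (e i) (w j s) y = diff (e j) (w i s) y.
Proof.
move=> sT; rewrite /diff !w_diff//.
rewrite -!mulrBr; congr (_ * _).
exact: (congr1 (@^~ y) (diffC (e i) (e j) (samp psi s))).
Qed.

Let w_cont j y : {within `]0, kT], continuous (fun s => w j s y)}.
Proof.
have T00 : 0 <= (0 : R) <= T by apply/andP; split => //; exact: ltW.
have [C _] := psi_sol j (OmegaN_pos m (lift y) T00).
apply: (within_continuous_precomp (h := fun s => (NR ^+ 2)^-1 * s)) C.
  move=> s; apply: is_derive_continuous (is_deriveZ (NR ^+ 2)^-1 (is_derive_id s 1)).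
move=> s /=; rewrite !in_itv/= => /scale_time[t -> tT].
by rewrite mulKf.
Qed.

Let w_eq j s y : 0 < s < kT -> is_derive s 1 (fun r => w j r y)
  (diff (e j) (fun z => aa s z * (\sum_i (w i s z - w i s (z - e i))) + gg s z) y).
Proof.
move=> /andP[s0 sT].
have [t sE tT] : exists2 t, s = NR ^+ 2 * t & 0 < t <= T.
  by apply: scale_time; rewrite s0 ltW.
have tT' := w_nonneg tT.
have T00 : 0 <= (0 : R) <= T by apply/andP; split => //; exact: ltW.
have [_ D] := psi_sol j (OmegaN_pos m (lift y) T00).
have t0T : 0 < t < T.
  by case/andP: tT => -> _; rewrite -(ltr_pM2l kap0) -sE.
have {}D := D t t0T.
have sk : 0 + (NR ^+ 2)^-1 * s = t by rewrite sE add0r mulKf.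
rewrite -{1}sk in D; have := is_derive_affine D.
under [X in is_derive _ _ X _ -> _]eq_fun do rewrite add0r.
move=> D2; apply: (is_derive_eq D2).
pose H z := aa s z * \sum_i (w i s z - w i s (z - e i)).
have HE x : a (t, pos R m x) * \sum_(i < n) nabla_star N (unitvec R i) (xi i) (t, pos R m x)
    = - NR * H (red m x).
  rewrite /H (samp_red x a_per tT') -sE mulrCA; congr (_ * _).
  rewrite mulr_sumr; apply: eq_bigr => i _.
  by rewrite (nabla_star_samp x i (xi_per i) tT') -sE /w; ring.
rewrite unitvecE /nabla/= -/(pos R m (lift y)) -/(pos R m (basis j)) -posD.
rewrite !HE !(samp_red _ g_per tT') -sE redD lift_red -/(dir m j) /diff /gg /H.
by rewrite -/(e j); field.
Qed.

Let aa_bound s y : 0 < s <= kT -> cm <= aa s y <= cp.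
Proof.
move=> /scale_time[t -> /w_nonneg tT]; rewrite /aa /samp mulKf//.
exact/a_bound/OmegaN_pos.
Qed.

Let w_bound j s y : 0 < s <= kT -> `|w j s y| <= K.
Proof.
move=> /scale_time[t -> /w_nonneg tT]; rewrite /w /samp mulKf//.
exact/xi_bound/OmegaN_pos.
Qed.

Lemma coef_holder (sg t t' : R) x x' : 0 < sg -> sg <= t <= T -> sg <= t' <= T ->
  `|a (t, pos R m x) - a (t', pos R m x')| <=
    A * sg `^ (- alpha / 2) *
    (`|t' - t| + (NR^-1 * nu R (red m (x - x'))) ^+ 2) `^ (alpha / 2).
Proof.
case/andP: alpha01 => al0 al1.
move=> sg0 /andP[st tT] /andP[st' tT'].
set X := (t, _); set Y := (t', _).
have tO : 0 <= t <= T by rewrite (le_trans (ltW sg0) st).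
have tO' : 0 <= t' <= T by rewrite (le_trans (ltW sg0) st').
have XO : OmegaN T N X by exact: OmegaN_pos.
have YO : OmegaN T N Y by exact: OmegaN_pos.
set D := (`|t' - t| + _).
have D0 : 0 <= D by apply: addr_ge0; [exact: normr_ge0|exact: sqr_ge0].
have rhs0 : 0 <= A * sg `^ (- alpha / 2) * D `^ (alpha / 2).
  by rewrite !mulr_ge0 ?powR_ge0.
have [[/= tE [k kE]]|nsame] := pselect (same_point X Y).
  suff -> : a X = a Y by rewrite subrr normr0.
  by rewrite /X kE tE -[RHS](a_per k YO).
have P0 : 0 < pdist X Y.
  rewrite /pdist lt_max; have [tE|tt'] := eqVneq t t'; last first.
    by rewrite sqrtr_gt0 normr_gt0 subr_eq0 tt'.
  apply/orP; right; rewrite ltNge; apply/negP => td.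
  apply: nsame; split => //; apply: torus_eq_of_close.
  by apply: le_lt_trans td _; rewrite invr_gt0.
have PD : pdist X Y <= Num.sqrt D.
  rewrite /pdist ge_max; apply/andP; split.
    by rewrite ler_sqrt// distrC lerDl sqr_ge0.
  apply: le_trans (torus_dist_pos _ _ _ _) _.
  rewrite -[leLHS]ger0_norm ?mulr_ge0 ?invr_ge0 ?nu_ge0//.
  by rewrite -sqrtr_sqr ler_sqrt// lerDr.
set dm := Num.min (dist0 X) (dist0 Y).
have H : dm `^ alpha * `|a X - a Y| / pdist X Y `^ alpha <= A.
  rewrite -lee_fin; apply: le_trans a_holder; apply: ereal_sup_ubound.
  by exists X, Y.
rewrite ler_pdivrMr ?powR_gt0// in H.
have sgd : Num.sqrt sg <= dm.
  rewrite /dm le_min /dist0 /=.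
  by apply/andP; split; apply: ler_wsqrtr.
have E1 : sg `^ (alpha / 2) <= dm `^ alpha.
  have -> : sg `^ (alpha / 2) = (Num.sqrt sg) `^ alpha.
    by rewrite -powR12_sqrt ?(ltW sg0)// -powRrM; congr powR; lra.
  by apply: le_powR => //; exact: ltW.
have E2 : pdist X Y `^ alpha <= D `^ (alpha / 2).
  have -> : D `^ (alpha / 2) = (Num.sqrt D) `^ alpha.
    by rewrite -powR12_sqrt// -powRrM; congr powR; lra.
  by apply: le_powR => //; exact: ltW.
have sp : 0 < sg `^ (alpha / 2) by exact: powR_gt0.
rewrite [- alpha / 2]mulNr powRN mulrAC ler_pdivlMr//.
rewrite mulrC; apply: le_trans (ler_wpM2r (normr_ge0 _) E1) _.
by apply: (le_trans H); exact: ler_wpM2l.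
Qed.

(** The weighted seminorm is invariant under parabolic scaling, so [A] is kept as it is. *)
Let aa_holder (sg : R) s (s' : R) y (y' : L) : 0 < sg ->
  sg <= s <= kT -> sg <= s' <= kT ->
  `|aa s y - aa s' y'| <= A * sg `^ (- alpha / 2) *
    (`|s' - s| + nu R (y - y') ^+ 2) `^ (alpha / 2).
Proof.
move=> sg0 /andP[s1 s2] /andP[s1' s2'].
have [u sgE /andP[u0 uT]] := scale_time (introT andP (conj sg0 (le_trans s1 s2))).
have [t sE /andP[t0 tT]] := scale_time (introT andP (conj (lt_le_trans sg0 s1) s2)).
have [t' sE' /andP[t0' tT']] := scale_time (introT andP (conj (lt_le_trans sg0 s1') s2')).
rewrite sgE sE ler_pM2l// in s1; rewrite sgE sE' ler_pM2l// in s1'.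
have := @coef_holder u t t' (lift y) (lift y') u0.
rewrite s1 tT s1' tT' redB !lift_red => /(_ isT isT).
rewrite /aa /samp sE sE' sgE !mulKf// => /le_trans; apply.
rewrite -mulrBr normrM (ger0_norm (ltW kap0)).
have -> : NR ^+ 2 * `|t' - t| + nu R (y - y') ^+ 2 =
  NR ^+ 2 * (`|t' - t| + (NR^-1 * nu R (y - y')) ^+ 2) by field.
rewrite !powRM ?(ltW kap0) ?(ltW u0)//; last by rewrite addr_ge0// sqr_ge0.
rewrite le_eqVlt; apply/orP; left; apply/eqP.
rewrite mulNr !powRN; field.
by rewrite !gt_eqF ?powR_gt0.
Qed.

(** One [n] compares path length with Euclidean length, [n + 1] turns a Lipschitz bound into a
    Hoelder bound at distances up to [n N], and the power of [T] bounds the time weight. This is how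
    [T] enters the final constant. *)
Definition lipschitz_const : R := n%:R * (n%:R + 1) * T `^ ((1 + alpha) / 2).

Let G := lipschitz_const * Gam.

Let gg_holder s (y x : L) : 0 < s <= kT ->
  `|gg s y - gg s x| * s `^ ((1 + alpha) / 2) <= G * nu R (y - x) `^ alpha.
Proof.
case/andP: alpha01 => al0 al1.
move=> sT; have [t sE tT] := scale_time sT; have tT' := w_nonneg tT.
case/andP: tT => t0 tT.
have gE u z : u \in gens e -> `|diff u (samp g s) z| <= NR^-1 * Gam.
  move=> /gensP[i].
  have H z' : `|diff (e i) (samp g s) z'| <= NR^-1 * Gam.
    have := g_bound i (OmegaN_pos m (lift z') tT').
    rewrite (nabla_samp _ _ g_per tT') lift_red -sE normrM ger0_norm// => H.
    by rewrite mulrC ler_pdivlMr// mulrC.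
  case=> ->; first exact: H.
  by have := H (z - e i); rewrite /diff subrK distrC.
have [d dE dn] := nu_attained R (y - x).
have [p [pS psum psize]] := lattice_path m d.
(* [path_bound] is applied with the zero function as distance, since the differences of [g] are
   bounded everywhere. *)
have nu_trivial (u z : L) : u \in gens e -> (0 : R) <= 0 + 1 by rewrite add0r.
have P := @path_bound R L n e (fun=> 0) nu_trivial (samp g s)
  (NR^-1 * Gam) (0 + (size p)%:R) x (fun u z uS _ => gE u z uS) p x 0 pS
  (lexx _) (lexx _).
rewrite psum dE [x + _]addrC subrK in P.
set v := nu R (y - x).
have v0 : 0 <= v by exact: nu_ge0.
have sz : (size p)%:R <= n%:R * v.
  rewrite psize natr_sum; apply: (@le_trans _ _ (\sum_(i < n) v)).
    apply: ler_sum => i _; rewrite natr_absz intr_norm.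
    rewrite -(@ler_pXn2r _ 2) ?nnegrE// real_normK ?num_real// dn (bigD1 i)//=.
    by rewrite lerDl sumr_ge0// => j _; exact: sqr_ge0.
  by rewrite sumr_const card_ord -[_ *+ n]mulr_natl.
have E1 : `|gg s y - gg s x| <= n%:R * v * (NR^-1 ^+ 2 * Gam).
  rewrite /gg -mulrBr normrM ger0_norm ?invr_ge0//.
  have -> : n%:R * v * (NR^-1 ^+ 2 * Gam) = NR^-1 * (n%:R * v * (NR^-1 * Gam)) by ring.
  rewrite ler_wpM2l ?invr_ge0//; apply: (le_trans P).
  by rewrite ler_wpM2r// mulr_ge0 ?invr_ge0.
have vN : v * NR `^ (alpha - 1) <= (n%:R + 1) * v `^ alpha.
  rewrite -(mulr_powRB1 v0 al0).
  case: (ltgtP 0 v) v0 => // [vp _|<- _]; last by rewrite !mul0r mulr0.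
  rewrite mulrCA ler_wpM2l ?(ltW vp)//.
  have n1 : 1 <= n%:R + 1 :> R by rewrite lerDr.
  apply: (@le_trans _ _ ((n%:R + 1) * ((n%:R + 1) * NR) `^ (alpha - 1))).
    rewrite powRM//.
    rewrite mulrA mulr_powRB1//.
    rewrite ler_peMl ?powR_ge0// -[leLHS](powRr0 (n%:R + 1)).
    by apply: ler_powR => //; exact: ltW.
  apply: ler_wpM2l; first lra.
  apply: ge_powR => //; first lra.
  apply: le_trans (nu_diam _ _) _.
  by rewrite ler_wpM2r// lerDl.
have E2 : s `^ ((1 + alpha) / 2) <= NR ^+ 2 * NR `^ (alpha - 1) * T `^ ((1 + alpha) / 2).
  rewrite sE powRM ?(ltW kap0) ?(ltW t0)//.
  have -> : (NR ^+ 2) `^ ((1 + alpha) / 2) = NR ^+ 2 * NR `^ (alpha - 1).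
    by rewrite -powR_mulrn// -powRrM -powR_add//; congr powR; lra.
  by rewrite ler_wpM2l ?mulr_ge0 ?powR_ge0//; apply: le_powR => //; [lra|exact: ltW].
apply: le_trans (ler_pM _ _ E1 E2) _; rewrite ?powR_ge0//.
have -> : n%:R * v * (NR^-1 ^+ 2 * Gam) *
    (NR ^+ 2 * NR `^ (alpha - 1) * T `^ ((1 + alpha) / 2)) =
   n%:R * T `^ ((1 + alpha) / 2) * Gam * (v * NR `^ (alpha - 1)) by field.
have -> : G * v `^ alpha = n%:R * T `^ ((1 + alpha) / 2) * Gam * ((n%:R + 1) * v `^ alpha).
  by rewrite /G /lipschitz_const; ring.
by rewrite ler_wpM2l// !mulr_ge0 ?powR_ge0.
Qed.

Let G0 : 0 <= G.
Proof. by rewrite !mulr_ge0 ?powR_ge0// addr_ge0. Qed.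

Let kT0 : 0 < kT. Proof. exact: mulr_gt0. Qed.

Let B := grad_bound n alpha cm cp A G K.

Let w_grad i j s y : 0 < s <= kT -> Num.sqrt s * `|diff (e i) (w j s) y| <= B.
Proof.
exact: (lattice_grad alpha01 cm0 cmp (@nu_ge0 R n m) (nu0 R n m)
  (@nu_step R n m) (@nu_semiconcave R n m) kT0 A0 G0 K0 w_cont w_eq w_curl
  aa_bound aa_holder gg_holder w_bound).
Qed.

Let nabla_w i j t x : 0 <= t <= T -> nabla N (unitvec R i) (xi j) (t, pos R m x) =
  NR * diff (e i) (w j (NR ^+ 2 * t)) (red m x).
Proof. by move=> tT; rewrite (nabla_samp _ _ (xi_per j) tT). Qed.

Let in_kT t : 0 < t <= T -> 0 < NR ^+ 2 * t <= kT.
Proof. by move=> /andP[t0 tT]; rewrite mulr_gt0//= ler_pM2l. Qed.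

Lemma system_grad i j t x : 0 < t <= T ->
  Num.sqrt t * `|nabla N (unitvec R i) (xi j) (t, pos R m x)| <= B.
Proof.
move=> tT; case/andP: (tT) => t0 _; rewrite nabla_w ?w_nonneg//.
have := w_grad i j (red m x) (in_kT tT).
rewrite sqrtrM ?(ltW kap0)// sqrtr_sqr normrM !(ger0_norm (ltW N0)) mulrA.
by rewrite [Num.sqrt t * _]mulrC.
Qed.

Let B0 i : 0 <= B.
Proof.
apply: le_trans (@system_grad i i T 0 _); last by rewrite T0 lexx.
by rewrite mulr_ge0 ?sqrtr_ge0.
Qed.

(** The sum [Z + B] of the space estimate, with [Z = A B + G + K]; it dominates the [Z] of the time
    estimates too. *)
Definition system_bound : R := (A + 1) * B + G + K.

Let scale_weight t : 0 < t ->
  (NR ^+ 2 * t) `^ (- (1 + alpha) / 2) = NR^-1 * NR `^ (- alpha) * t `^ (- (1 + alpha) / 2).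
Proof.
move=> t0; rewrite powRM ?(ltW kap0) ?(ltW t0)//; congr (_ * _).
rewrite -powR_mulrn// -powRrM -[NR^-1]powR_inv1// -powR_add//.
by congr powR; lra.
Qed.

(** Back in the original scale the powers of [N] cancel: [N] from the gradient, [N ^ (- 1 - alpha)]
    from the time weight, [N ^ alpha] from the distance. *)
Lemma system_space i j t x x' : 0 < t <= T ->
  `|nabla N (unitvec R i) (xi j) (t, pos R m x) -
    nabla N (unitvec R i) (xi j) (t, pos R m x')| <=
  lattice_space_const n alpha cm cp * system_bound * t `^ (- (1 + alpha) / 2) *
    (NR^-1 * (\sum_l absz ((x' - x)%R ord0 l))%:R) `^ alpha.
Proof.
move=> tT; case/andP: (tT) => t0 _; rewrite !nabla_w ?w_nonneg//.
have [p [pS psum psize]] := lattice_path m (x' - x).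
have := lattice_space_holder alpha01 cm0 cmp (@nu_ge0 R n m) (nu0 R n m)
  (@nu_step R n m) (@nu_semiconcave R n m) A0 (B0 i) G0 K0 w_cont w_eq w_curl
  aa_bound aa_holder w_grad gg_holder w_bound i j (red m x) (in_kT tT) pS.
rewrite psum redB [red m x + _]addrC subrK -psize => H.
rewrite -mulrBr normrM ger0_norm//.
apply: le_trans (ler_wpM2l (ltW N0) H) _.
rewrite scale_weight// powRM ?invr_ge0// powR_inv// -powRN.
rewrite -/(lattice_space_const n alpha cm cp) (_ : _ + B = system_bound); last first.
  by rewrite /system_bound; ring.
by rewrite le_eqVlt; apply/orP; left; apply/eqP; field.
Qed.

Let Z_le i : A * B + G + K <= system_bound.
Proof. by rewrite /system_bound; have := B0 i; lra. Qed.

Let mul_cancel (u q tc z P Q : R) : u != 0 -> q != 0 ->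
  u * (tc * z * (u^-1 * q^-1 * P) * (q * Q)) = tc * z * P * Q.
Proof. by move=> u0 q0; field; rewrite u0 q0. Qed.

Lemma system_time_grad i j t1 t0 x : 0 < t1 -> t1 <= t0 <= T ->
  `|nabla N (unitvec R i) (xi j) (t0, pos R m x) -
    nabla N (unitvec R i) (xi j) (t1, pos R m x)| <=
  time_const n alpha cm cp 1 * (2 * n%:R + 2) * system_bound *
    t1 `^ (- (1 + alpha) / 2) * (t0 - t1) `^ (alpha / 2).
Proof.
move=> t1p /andP[t10 t0T].
have tT1 : 0 <= t1 <= T by rewrite (ltW t1p) (le_trans t10).
have tT0 : 0 <= t0 <= T by rewrite (le_trans (ltW t1p)).
rewrite !nabla_w//.
have vS : all (gens e) [:: e i] by rewrite /= andbT; apply/gensP; exists i; left.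
have k1 : 0 < NR ^+ 2 * t1 by rewrite mulr_gt0.
have k2 : NR ^+ 2 * t1 <= NR ^+ 2 * t0 <= kT by rewrite !ler_pM2l// t10.
have := lattice_time_holder alpha01 cm0 cmp (@nu_ge0 R n m) (nu0 R n m)
  (@nu_step R n m) (@nu_semiconcave R n m) A0 (B0 i) G0 K0 w_cont w_eq w_curl
  aa_bound aa_holder w_grad gg_holder w_bound j (red m x) k1 k2 vS (leqnn 1).
rewrite /= => H; rewrite -mulrBr normrM ger0_norm//.
apply: le_trans (ler_wpM2l (ltW N0) H) _.
rewrite scale_weight// -mulrBr powRM ?(ltW kap0) ?subr_ge0//.
have -> : holder_exp alpha 1 = alpha / 2 by rewrite /holder_exp; lra.
have -> : (NR ^+ 2) `^ (alpha / 2) = NR `^ alpha.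
  by rewrite -powR_mulrn// -powRrM; congr powR; lra.
set tc := time_const n alpha cm cp 1 * _.
have tc0 : 0 <= tc.
  apply: mulr_ge0; last by rewrite addr_ge0// mulr_ge0.
  exact: time_const_ge0.
set P := t1 `^ _; set Q := (t0 - t1) `^ _.
have -> : NR * (tc * (A * B + G + K) * (NR^-1 * NR `^ (- alpha) * P) * (NR `^ alpha * Q)) =
  tc * (A * B + G + K) * P * Q.
  by rewrite powRN mul_cancel// gt_eqF ?powR_gt0.
by rewrite !ler_wpM2r ?powR_ge0// ler_wpM2l// (Z_le i).
Qed.

Lemma system_time j t1 t0 x : 0 < t1 -> t1 <= t0 <= T ->
  `|xi j (t0, pos R m x) - xi j (t1, pos R m x)| <=
  time_const n alpha cm cp 0 * (2 * n%:R + 2) * system_bound *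
    t1 `^ (- (1 + alpha) / 2) * (t0 - t1) `^ ((1 + alpha) / 2).
Proof.
move=> t1p /andP[t10 t0T].
have tT1 : 0 <= t1 <= T by rewrite (ltW t1p) (le_trans t10).
have tT0 : 0 <= t0 <= T by rewrite (le_trans (ltW t1p)).
rewrite !(samp_red _ (xi_per j))//.
have k1 : 0 < NR ^+ 2 * t1 by rewrite mulr_gt0.
have k2 : NR ^+ 2 * t1 <= NR ^+ 2 * t0 <= kT by rewrite !ler_pM2l// t10.
have := lattice_time_holder alpha01 cm0 cmp (@nu_ge0 R n m) (nu0 R n m)
  (@nu_step R n m) (@nu_semiconcave R n m) A0 (B0 j) G0 K0 w_cont w_eq w_curl
  aa_bound aa_holder w_grad gg_holder w_bound j (red m x) k1 k2 (isT : all (gens e) [::])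
  (isT : (0 <= 1)%N).
rewrite /= => H; apply: (le_trans H).
rewrite scale_weight// -mulrBr powRM ?(ltW kap0) ?subr_ge0//.
have -> : holder_exp alpha 0 = (1 + alpha) / 2 by rewrite /holder_exp subr0.
have -> : (NR ^+ 2) `^ ((1 + alpha) / 2) = NR * NR `^ alpha.
  rewrite -powR_mulrn// -powRrM (_ : _ * _ = 1 + alpha); last lra.
  by rewrite powR_add// powRr1.
set tc := time_const n alpha cm cp 0 * _.
have tc0 : 0 <= tc.
  apply: mulr_ge0; last by rewrite addr_ge0// mulr_ge0.
  exact: time_const_ge0.
set P := t1 `^ _; set Q := (t0 - t1) `^ _.
have -> : tc * (A * B + G + K) * (NR^-1 * NR `^ (- alpha) * P) * (NR * NR `^ alpha * Q) =
  tc * (A * B + G + K) * P * Q.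
  rewrite -[RHS](mul_cancel _ _ _ _ Nn0 (lt0r_neq0 (powR_gt0 alpha N0))) powRN.
  by ring.
by rewrite !ler_wpM2r ?powR_ge0// ler_wpM2l// (Z_le j).
Qed.

(** The maximum with [0] matches the base of the maxima over directions; [B0] takes a direction and
    says nothing for [n = 0]. *)
Lemma weighted_grad_le : (weighted_grad T N xi <= (Num.max 0 B)%:E)%E.
Proof.
have B00 : (0 <= (Num.max 0 B)%:E)%E by rewrite lee_fin le_max lexx.
apply: bigmax_le => // i _; apply: bigmax_le => // j _.
apply: ge_ereal_sup => _ [X /OmegaNP[x -> /= /andP[t0 tT]] <-].
rewrite lee_fin /dist0 /=; move: t0 tT; set t := X.1 => t0 tT.
case: (ltgtP 0 t) t0 => // [tp _|<- _]; last first.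
  by rewrite sqrtr0 mul0r le_max lexx.
by rewrite le_max system_grad ?orbT// tp.
Qed.

Let Z0 i : 0 <= system_bound.
Proof.
rewrite /system_bound; have := mulr_ge0 A0 (B0 i); have := B0 i.
by have := G0; have := K0; lra.
Qed.

Let weight0 : 0 < 1 + alpha.
Proof. by case/andP: alpha01 => a0 _; rewrite addr_gt0. Qed.

Let min_sqrt t s : Num.min (Num.sqrt t) (Num.sqrt s) = Num.sqrt (Num.min t s).
Proof.
have [ts|st] := leP t s; first by rewrite min_l//; exact: ler_wsqrtr.
by rewrite min_r//; exact/ler_wsqrtr/ltW.
Qed.

(* The weights vanish at [t = 0], where nothing is known about [xi]. *)
Let weighted_le (t s q d b : R) : 0 <= t -> 0 <= s -> 0 <= b -> 0 <= d ->
  (0 < t -> 0 < s -> q <= b * (Num.min t s) `^ (- (1 + alpha) / 2) * d) ->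
  0 <= q ->
  Num.min (Num.sqrt t) (Num.sqrt s) `^ (1 + alpha) * q / d <= b.
Proof.
move=> t0 s0 b0 d0 H q0; rewrite min_sqrt.
have m0 : 0 <= Num.min t s by rewrite le_min t0.
have -> : Num.sqrt (Num.min t s) `^ (1 + alpha) = (Num.min t s) `^ ((1 + alpha) / 2).
  by rewrite -powR12_sqrt// -powRrM; congr powR; lra.
have w0 : (1 + alpha) / 2 != 0 by rewrite gt_eqF// divr_gt0.
have [dp|dn] := ltP 0 d; last first.
  by rewrite (_ : d = 0) ?invr0 ?mulr0//; apply/eqP; rewrite eq_le dn.
rewrite ler_pdivrMr//.
case: (ltgtP 0 (Num.min t s)) m0 => // [mp _|<- _]; last first.
  by rewrite powR0// mul0r mulr_ge0.
have [tp sp] : 0 < t /\ 0 < s by move: mp; rewrite lt_min => /andP.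
have P : 0 < (Num.min t s) `^ ((1 + alpha) / 2) by exact: powR_gt0.
rewrite -ler_pdivlMl//; apply: le_trans (H tp sp) _.
by rewrite mulNr powRN le_eqVlt; apply/orP; left; apply/eqP; ring.
Qed.

Let sym_time (F : R -> R) (c ex : R) :
  (forall t1 t0 : R, 0 < t1 -> t1 <= t0 <= T ->
    `|F t0 - F t1| <= c * t1 `^ (- (1 + alpha) / 2) * (t0 - t1) `^ ex) ->
  forall t s : R, 0 < t <= T -> 0 < s <= T ->
  `|F t - F s| <= c * (Num.min t s) `^ (- (1 + alpha) / 2) * `|t - s| `^ ex.
Proof.
move=> H t s /andP[t0 tT] /andP[s0 sT]; have [ts|st] := leP t s.
  rewrite distrC [`|t - s|]distrC (ger0_norm (_ : 0 <= s - t)) ?subr_ge0//.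
  by apply: H => //; rewrite ts.
rewrite (ger0_norm (_ : 0 <= t - s)) ?subr_ge0; last exact: ltW.
by apply: H => //; rewrite tT ltW.
Qed.

Lemma holder_time_le j : (holder_time T N alpha (xi j) <=
  (time_const n alpha cm cp 0 * (2 * n%:R + 2) * system_bound)%:E)%E.
Proof.
apply: ge_ereal_sup => _ [t [s [z [tO sO ts ->]]]].
have [x [zE] t0] := OmegaNP tO.
have [_ _ s0] := OmegaNP sO.
rewrite lee_fin /dist0 /=.
have c0 : 0 <= time_const n alpha cm cp 0 * (2 * n%:R + 2) * system_bound.
  apply: mulr_ge0 (Z0 j); apply: mulr_ge0; first exact: time_const_ge0.
  by rewrite addr_ge0// mulr_ge0.
case/andP: t0 => t0 tT; case/andP: s0 => s0 sT.
apply: weighted_le => //.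
move=> tp sp; rewrite zE.
apply: (sym_time (F := fun t => xi j (t, pos R m x))); rewrite ?tp ?sp//.
by move=> t1 t0' H1 H2; exact: system_time.
Qed.

Definition interp_const : R := (6 * n%:R + 1) * lattice_space_const n alpha cm cp +
  time_const n alpha cm cp 1 * (2 * n%:R + 2).

Lemma holder_1alpha_le j : (holder_1alpha T N alpha (interp N (xi j)) <=
  (interp_const * system_bound)%:E)%E.
Proof.
apply: ge_ereal_sup => _ [[t z] [[s y] [/= /andP[t0 tT] /andP[s0 sT] _ ->]]].
rewrite lee_fin /dist0 /=; set rho := pdist _ _.
have sc0 := lattice_space_const_gt0 n alpha01 cm0 cmp.
have tc0 := time_const_ge0 n alpha01 cm0 cmp (leqnn 1).
have n0 : 0 <= n%:R :> R by [].
have tc0' : 0 <= time_const n alpha cm cp 1 * (2 * n%:R + 2).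
  by rewrite mulr_ge0// addr_ge0// mulr_ge0.
have i0 : 0 <= interp_const.
  by rewrite addr_ge0// mulr_ge0 ?(ltW sc0)// addr_ge0// mulr_ge0.
have rho0 : 0 <= rho by rewrite /rho /pdist le_max sqrtr_ge0.
case/andP: (alpha01) => al0 al1.
(* At [rho = 0] the quotient is zero by the convention for division. *)
have [rp|rn] := ltP 0 rho; last first.
  have -> : rho = 0 by apply/eqP; rewrite eq_le rn.
  by rewrite powR0 ?gt_eqF// invr0 mulr0 mulr_ge0// (Z0 j).
apply: weighted_le => //; [by rewrite mulr_ge0// (Z0 j)|exact: powR_ge0| |]; last first.
  by apply: bigmax_ge_id.
move=> tp sp.
have mp : 0 < Num.min t s by rewrite lt_min tp.
apply: bigmax_le => [|i _].
  by rewrite !mulr_ge0 ?powR_ge0// (Z0 j).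
have tT' : 0 < t <= T by rewrite tp.
have sT' : 0 < s <= T by rewrite sp.
(* The distance is an infimum; the factor [2] leaves room to pick a representative, to which [z] is
   then moved by periodicity. *)
have td : torus_dist z y < 2 * rho.
  have : torus_dist z y <= rho by rewrite /rho /pdist le_max lexx orbT.
  by lra.
have [k zk] := torus_dist_lt td.
pose f (r : R) x := nabla N (unitvec R i) (xi j) (r, pos R m x).
rewrite !nabla_interp -/(f t) -/(f s).
have per : polylinear m (f t) (z + pos R m (N%:Z *: k)) = polylinear m (f t) z.
  rewrite polylinear_translate; congr (polylinear m _ z); apply/funext => x.
  rewrite /f posD posMN; apply: (lattice_function_nabla i (xi_per j) (X := (t, pos R m x))).
  by apply: OmegaN_pos; rewrite t0.
set P := (Num.min t s) `^ _; set Q := rho `^ alpha.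
have P0 : 0 <= P by exact: powR_ge0.
have Q0 : 0 <= Q by exact: powR_ge0.
have E1 : `|polylinear m (f t) z - polylinear m (f t) y| <=
    (6 * n%:R + 1) * (lattice_space_const n alpha cm cp * system_bound * P) * Q.
  rewrite -per; apply: polylinear_holder => //.
  - by rewrite !mulr_ge0 ?(ltW sc0)// (Z0 j).
  - move=> x x'; apply: le_trans (system_space i j x x' tT') _.
    rewrite ler_wpM2r ?powR_ge0// ler_wpM2l ?mulr_ge0 ?(ltW sc0)// ?(Z0 j)//.
    apply: ge_powR => //; last by rewrite ge_min lexx.
    by have := weight0; lra.
  - move=> l; apply: le_trans (ltW zk); rewrite posMN /enorm.
    have -> : (z + intvec R k) ord0 l - y ord0 l = (z - y + intvec R k) ord0 l.
      by rewrite !mxE; ring.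
    rewrite -sqrtr_sqr; apply: ler_wsqrtr; rewrite (bigD1 l)//= lerDl.
    by apply: sumr_ge0 => l' _; exact: sqr_ge0.
have E2 : `|polylinear m (f t) y - polylinear m (f s) y| <=
    time_const n alpha cm cp 1 * (2 * n%:R + 2) * system_bound * P * Q.
  apply: polylinear_close => x.
  have H := sym_time (F := fun r => f r x)
    (fun t1 t0' H1 H2 => system_time_grad i j x H1 H2) tT' sT'.
  apply: (le_trans H); rewrite ler_wpM2l//.
    by rewrite mulr_ge0// mulr_ge0// (Z0 j).
  have -> : `|t - s| `^ (alpha / 2) = (Num.sqrt `|t - s|) `^ alpha.
    by rewrite -powR12_sqrt// -powRrM; congr powR; lra.
  apply: le_powR; [exact: ltW|exact: sqrtr_ge0|].
  by rewrite /rho /pdist le_max lexx.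
rewrite -(subrKA (polylinear m (f t) y)); apply: le_trans (ler_normD _ _) _.
by apply: le_trans (lerD E1 E2) _; rewrite /interp_const; lra.
Qed.

Lemma full_norm_le : (full_norm T N alpha xi <= (Num.max 0 B +
  Num.max 0 (interp_const * system_bound) +
  Num.max 0 (time_const n alpha cm cp 0 * (2 * n%:R + 2) * system_bound))%:E)%E.
Proof.
have M0 (c : R) : (0 <= (Num.max 0 c)%:E)%E by rewrite lee_fin le_max lexx.
have M1 (c : R) : (c%:E <= (Num.max 0 c)%:E)%E by rewrite lee_fin le_max lexx orbT.
rewrite !EFinD; apply: leeD; first apply: leeD; first exact: weighted_grad_le.
  by apply: bigmax_le => // j _; exact: le_trans (holder_1alpha_le j) (M1 _).
by apply: bigmax_le => // j _; exact: le_trans (holder_time_le j) (M1 _).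
Qed.

End System.

(** * Choice of the constant and conclusion *)

Lemma holder_a_ge0 (R : realType) (n N : nat) (T alpha : R)
    (a : R * 'rV[R]_n -> R) : 0 < T -> (0 <= holder_a T N alpha a)%E.
Proof.
move=> T0; set X : R * 'rV[R]_n := (0, 0); set Y : R * 'rV[R]_n := (T, 0).
apply: (@le_trans _ _ ((Num.min (dist0 X) (dist0 Y) `^ alpha * `|a X - a Y|
    / pdist X Y `^ alpha)%:E)).
  by rewrite lee_fin divr_ge0 ?mulr_ge0 ?powR_ge0.
have z0 : (0 : 'rV[R]_n) = N%:R^-1 *: intvec R 0.
  by apply/rowP => i; rewrite !mxE mulr0.
apply: ereal_sup_ubound; exists X, Y; split => //.
- by split; [apply/andP; split => //; exact: ltW|exists 0].
- by split; [apply/andP; split => //; exact: ltW|exists 0].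
- by case=> /= E _; move: T0; rewrite -E ltxx.
Qed.

Lemma bigmaxe_fin (R : realType) (n : nat) (F : 'I_n -> \bar R) :
  (\big[maxe/0]_(i < n) F i < +oo)%E ->
  exists2 M : R, 0 <= M & \big[maxe/0%E]_(i < n) F i = M%:E.
Proof.
move=> Foo; have F0 : (0 <= \big[maxe/0]_(i < n) F i)%E by exact: bigmax_ge_id.
move: F0 Foo; case: (\big[maxe/0%E]_(i < n) F i) => [M| |]// M0 _.
by exists M => //; rewrite -lee_fin.
Qed.

Lemma sup_lattice_ub (R : realType) (n N : nat) (T : R) (F : R * 'rV[R]_n -> R) X :
  OmegaN T N X -> (`|F X|%:E <= sup_lattice T N F)%E.
Proof. by move=> XO; apply: ereal_sup_ubound; exists X. Qed.

(** The two right-hand sides, [E2] and [E1], differ by the factor [A + 1], which is also the factor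
    of [B] in [Z]. So [B <= C1 * E1] yields both estimates. *)
Lemma estimate_constants (R : realType) (A K Gam GC gc CH CT al : R) :
  0 <= A -> 0 <= K -> 0 <= Gam -> 0 <= GC -> 0 <= gc -> 0 <= CH -> 0 <= CT -> 0 < al ->
  let B := 2 * (GC * Gam / (A + 1) + gc * (A + 1) `^ al^-1 * K) in
  let Z := (A + 1) * B + GC * Gam + K in
  let C1 := 2 * (GC + gc) in
  let C := 1 + C1 + (CH + CT) * (C1 + GC + 1) in
  Num.max 0 B + Num.max 0 (CH * Z) + Num.max 0 (CT * Z) <=
    C * ((A + 1) `^ (1 + al^-1) * K + Gam) /\
  Num.max 0 B <= C * ((A + 1) `^ al^-1 * K + (A + 1)^-1 * Gam).
Proof.
move=> A0 K0 G0 GC0 gc0 CH0 CT0 al0 B Z C1 C.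
have A1 : 1 <= A + 1 by lra.
have Ap : 0 < A + 1 by lra.
set p := (A + 1) `^ al^-1.
have p1 : 1 <= p.
  rewrite /p -[leLHS](powRr0 (A + 1)); apply: ler_powR => //.
  by rewrite invr_ge0 ltW.
have -> : (A + 1) `^ (1 + al^-1) = (A + 1) * p.
  by rewrite powR_add// powRr1// ltW.
set E1 := p * K + (A + 1)^-1 * Gam; set E2 := (A + 1) * p * K + Gam.
have pK : 0 <= p * K by rewrite mulr_ge0//; lra.
have iG : 0 <= (A + 1)^-1 * Gam by rewrite mulr_ge0// invr_ge0 ltW.
have E12 : (A + 1) * E1 = E2 by rewrite /E1 /E2; field; rewrite gt_eqF.
have E10 : 0 <= E1 by rewrite /E1; lra.
have C10 : 0 <= C1 by rewrite /C1; lra.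
have BE : B = 2 * (GC * ((A + 1)^-1 * Gam) + gc * (p * K)).
  by rewrite /B -/p; ring.
have B0 : 0 <= B by rewrite BE mulr_ge0// addr_ge0// mulr_ge0.
have B1 : B <= C1 * E1.
  rewrite BE /C1 /E1; have := mulr_ge0 GC0 pK; have := mulr_ge0 gc0 iG; lra.
have E1E2 : E1 <= E2 by rewrite -E12 ler_peMl.
have KE : K <= E2.
  rewrite /E2 -mulrA; have : K <= p * K by rewrite ler_peMl.
  have : p * K <= (A + 1) * (p * K) by rewrite ler_peMl.
  lra.
have GE : Gam <= E2 by rewrite /E2 -mulrA; have := mulr_ge0 (ltW Ap) pK; lra.
have E20 : 0 <= E2 by lra.
have Z1 : Z <= (C1 + GC + 1) * E2.
  have -> : (C1 + GC + 1) * E2 = (A + 1) * (C1 * E1) + (GC + 1) * E2.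
    by rewrite -E12; ring.
  rewrite /Z; have := ler_wpM2l (ltW Ap) B1.
  have := ler_wpM2l GC0 GE; lra.
have Z0 : 0 <= Z.
  by rewrite /Z !addr_ge0// mulr_ge0// ltW.
have c0 : 0 <= (CH + CT) * (C1 + GC + 1) by rewrite mulr_ge0//; lra.
rewrite (max_r B0) (max_r (mulr_ge0 CH0 Z0)) (max_r (mulr_ge0 CT0 Z0)); split.
  have H1 := ler_wpM2l CH0 Z1; have H2 := ler_wpM2l CT0 Z1.
  have H3 := ler_wpM2l C10 E1E2.
  rewrite /C; lra.
rewrite /C; have := mulr_ge0 c0 E10; lra.
Qed.

Unset Implicit Arguments.

Theorem corollary5p6 (R : realType) (n : nat) (cm cp T alpha : R)
    (hcm : 0 < cm) (hcp : cm < cp) (hT : 0 < T) (halpha : 0 < alpha < 1) :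
  exists C : R, 0 < C /\
  forall (N : nat) (Abar : R) (psi a g : R * 'rV[R]_n -> R),
    let xi (i : 'I_n) := nabla N (unitvec R i) psi in
    (0 < N)%N ->
    lattice_function T N psi ->
    lattice_function T N a ->
    lattice_function T N g ->
    (forall z : 'rV[R]_n, OmegaN T N (0, z) ->
      {within [set` `[0, T]], continuous (fun t : R => g (t, z))}) ->
    solves_system T N a g xi ->
    (forall X : R * 'rV[R]_n, OmegaN T N X -> cm <= a X <= cp) ->
    (holder_a T N alpha a <= Abar%:E)%E ->
    (norm_grad T N g < +oo)%E ->
    (norm_xi T N xi < +oo)%E ->
    (full_norm T N alpha xi <=
       C%:E * (((Abar + 1) `^ (1 + alpha^-1))%:E * norm_xi T N xi
               + norm_grad T N g))%E /\
    (weighted_grad T N xi <=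
       C%:E * (((Abar + 1) `^ (alpha^-1))%:E * norm_xi T N xi
               + ((Abar + 1)^-1)%:E * norm_grad T N g))%E.
Proof.
case/andP: (halpha) => al0 al1; have cmcp := ltW hcp.
pose GC := lipschitz_const n T alpha; pose gc := grad_const n alpha cm cp.
pose CH := interp_const n alpha cm cp.
pose CT := time_const n alpha cm cp 0 * (2 * n%:R + 2).
have n0 : 0 <= n%:R :> R by [].
have GC0 : 0 <= GC by rewrite !mulr_ge0 ?powR_ge0// addr_ge0.
have gc0 : 0 <= gc by rewrite addr_ge0// mulr_ge0// powR_ge0.
have n2 : 0 <= 2 * n%:R + 2 :> R by lra.
have CT0 : 0 <= CT by apply: mulr_ge0 => //; exact: time_const_ge0.
have CH0 : 0 <= CH.
  apply: addr_ge0; apply: mulr_ge0 => //; last exact: time_const_ge0.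
  exact/ltW/lattice_space_const_gt0.
exists (1 + 2 * (GC + gc) + (CH + CT) * (2 * (GC + gc) + GC + 1)); split.
  by have : 0 <= (CH + CT) * (2 * (GC + gc) + GC + 1) by [rewrite mulr_ge0//; lra]; lra.
case=> [//|m] Abar psi a g xi _ psi_per a_per g_per _ sol aB aH gF xiF.
(* The times [0] and [T] at one site form an admissible pair for [holder_a], so the supremum is
   nonnegative. *)
have A0 : 0 <= Abar by rewrite -lee_fin; exact: le_trans (holder_a_ge0 _ _ _ hT) aH.
have [Gam Gam0 GamE] := bigmaxe_fin gF.
have [K K0 KE] := bigmaxe_fin xiF.
have xi_bound i X : OmegaN T m.+1 X -> `|xi i X| <= K.
  move=> XO; rewrite -lee_fin -KE; apply: le_trans (sup_lattice_ub _ XO) _.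
  exact: le_bigmax.
have g_bound i X : OmegaN T m.+1 X -> `|nabla m.+1 (unitvec R i) g X| <= Gam.
  move=> XO; rewrite -lee_fin -GamE; apply: le_trans (sup_lattice_ub _ XO) _.
  apply: le_trans (le_bigmax _ _ i); by rewrite le_max lexx.
rewrite /norm_xi /norm_grad KE GamE -!EFinM.
have [H1 H2] := estimate_constants A0 K0 Gam0 GC0 gc0 CH0 CT0 al0.
split.
  apply: le_trans (full_norm_le hT halpha hcm cmcp A0 K0 Gam0 psi_per a_per g_per
    sol aB aH xi_bound g_bound) _.
  by rewrite lee_fin; exact: H1.
apply: le_trans (weighted_grad_le hT halpha hcm cmcp A0 K0 Gam0 psi_per a_per g_per
    sol aB aH xi_bound g_bound) _.
by rewrite lee_fin; exact: H2.
Qed.
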